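(* Let $(\mathcal A,\psi)$ be an $\mathcal A_0$-expected probability space and let $\mathcal B$ and $\mathcal C$ be two von Neumann subalgebras of $\mathcal A$ such that the $\psi$-preserving conditional expectations $E_{\mathcal B}$ and $E_{\mathcal C}$ exist. If $\mathcal B$ and $\mathcal C$ are $\mathcal A_0$-independent, then $$\mathcal E_{\mathcal B}\times\mathcal E_{\mathcal C}\ni(x,y)\mapsto xy\in\mathcal E_{\mathcal B\vee\mathcal C}$$ defines a product which extends the left multiplication $\mathcal B\times\mathcal E\ni(x,y)\mapsto xy\in\mathcal E$ (that is, for $x\in\mathcal B$ and $y\in\mathcal E_{\mathcal C}$ the product of $xe_0$ and $y$ is the left multiple of $y$ by $x$). This product is jointly $\|\cdot\|_0$-continuous. If its first component is $\|\cdot\|_0$-bounded, it is also jointly $\sigma$-stop–$\sigma$-stop-continuous. The product satisfies $$\langle x_1y_1|x_2y_2\rangle_0=\langle y_1|\langle x_1|x_2\rangle_0\,y_2\rangle_0$$ for any $x_1,x_2\in\mathcal E_{\mathcal B}$ and $y_1,y_2\in\mathcal E_{\mathcal C}$. Moreover, the module property of the conditional expectations $E_{\mathcal B}$ and $E_{\mathcal C}$ extends to $$E_{\mathcal B}\,xy=x\,E_0y\qquad\text{and}\qquad E_{\mathcal C}\,xy=(E_0x)\,y$$ for any $x\in\mathcal E_{\mathcal B}$ and $y\in\mathcal E_{\mathcal C}$.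
   Context: A probability space $(\mathcal A,\psi)$ is a von Neumann algebra $\mathcal A$ with separable predual and a faithful normal state $\psi$. A subalgebra of $(\mathcal A,\psi)$ is a von Neumann subalgebra $\mathcal B\subseteq\mathcal A$ for which the (unique) $\psi$-preserving conditional expectation $E_{\mathcal B}$ onto $\mathcal B$ exists. An $\mathcal A_0$-expected probability space has a distinguished subalgebra $\mathcal A_0$; $E_0$ is the $\psi$-preserving conditional expectation onto $\mathcal A_0$. Subalgebras $\mathcal B,\mathcal C$ with $\mathcal A_0\subseteq\mathcal B\cap\mathcal C$ are $\mathcal A_0$-independent if $E_0(xy)=E_0(x)E_0(y)$ for $x\in\mathcal B$, $y\in\mathcal C$ (the inclusion $\mathcal A_0\subseteq\mathcal B\cap\mathcal C$ is part of the notion). $\mathcal B\vee\mathcal C$ is the von Neumann algebra generated by $\mathcal B\cup\mathcal C$. $\mathcal A$ acts on its GNS Hilbert space $\mathcal H_\psi$ with cyclic separating vector $\Omega$; $e_0$ is the orthogonal projection onto $\mathcal H_0=\overline{\mathcal A_0\Omega}$, so $E_0(x)e_0=e_0xe_0$ for $x\in\mathcal A$. $\mathcal E$ is the closure of $\mathcal Ae_0$ in the strong operator topology of $\mathcal B(\mathcal H_\psi)$; it is an $\mathcal A$-$\mathcal A_0$-bimodule (left: $(y,xe_0)\mapsto yxe_0$; right: $(xe_0,a)\mapsto xae_0$) with $\mathcal A_0$-valued inner product $\langle x|y\rangle_0=x^*y$, where $\mathcal A_0e_0$ is identified with $\mathcal A_0$. Put $|x|_0=\langle x|x\rangle_0^{1/2}$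 and $\|x\|_0=\||x|_0\|$. For a subalgebra $\mathcal B\supseteq\mathcal A_0$, $\mathcal E_{\mathcal B}$ is the strong closure of $\mathcal Be_0$. The stop topology on $\mathcal E$ is given by the seminorms $x\mapsto\||x|_0\xi\|$, $\xi\in\mathcal H_0$; the $\sigma$-stop topology by $x\mapsto\varphi(\langle x|x\rangle_0)^{1/2}$, $\varphi$ a positive normal functional on $\mathcal A_0$. A conditional expectation $E_{\mathcal B}$ (likewise $E_{\mathcal C}$, $E_0$) extends to $\mathcal E$ as $x\mapsto\overline{E_{\mathcal B}}x$, where $\overline{E_{\mathcal B}}$ is the projection of $\mathcal H_\psi$ onto $\overline{\mathcal B\Omega}$; the extension maps $xe_0$ to $E_{\mathcal B}(x)e_0$, maps $\mathcal E$ onto $\mathcal E_{\mathcal B}$, and is denoted by the same symbol. The product of $x\in\mathcal E_{\mathcal B}$ and $y\in\mathcal E_{\mathcal C}$ is to be understood as the stop limit $xy:=\lim_nx_ny$ for a sequence $x_n\in\mathcal B$ with $x_ne_0\to x$ in the stop topology, $x_ny$ being the left multiplication of $\mathcal A$ on $\mathcal E$. *)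

(* Defs.v *)
From HB Require Import structures.
From mathcomp Require Import all_boot all_order all_algebra.
From mathcomp Require Import all_classical all_reals all_analysis.
From mathcomp Require Import complex.
Set Implicit Arguments.
Unset Strict Implicit.
Unset Printing Implicit Defensive.
Import Order.TTheory GRing.Theory Num.Theory numFieldNormedType.Exports.
Local Open Scope classical_set_scope.
Local Open Scope ring_scope.
Local Open Scope complex_scope.

(* [hdot] is linear in its FIRST argument and conjugate-linear in its second
   one, so hdot xi eta is the physicists' <eta | xi>. *)
HB.mixin Record NormedModule_isHilbert (R : realType) H
    of CompleteNormedModule R[i] H := {
  hdot : {dot H for (@Num.conj R[i])} ;
  hdot_norm : forall xi : H, hdot xi xi = `|xi| ^+ 2
}.

#[short(type="hilbertType")]
HB.structure Definition Hilbert (R : realType) :=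
  { H of NormedModule_isHilbert R H & CompleteNormedModule R[i] H }.

Section Operators.
Context {R : realType} {H : hilbertType R}.
Implicit Types (S T : H -> H) (M : set (H -> H)) (phi : (H -> H) -> R[i]).

(* The library norm is R[i]-valued; this is the same number in R. *)
Definition rnorm (xi : H) : R := complex.Re `|xi|.

Definition bounded_op T : Prop := linear T /\ continuous T.

Definition opnorm T : R := sup [set rnorm (T xi) | xi in [set xi | rnorm xi <= 1]].

Definition adjoint T : H -> H :=
  get [set S | bounded_op S /\
               forall xi eta, hdot (T xi) eta = hdot xi (S eta)].

(* The order of R[i] makes 0 <= z include that z is real. *)
Definition positive_op T : Prop :=
  bounded_op T /\ forall xi, 0 <= hdot (T xi) xi.

Definition op_sqrt T : H -> H := get [set S | positive_op S /\ S \o S = T].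

Definition oproj (K : set H) (xi : H) : H :=
  get [set eta | K eta /\ forall zeta, K zeta -> hdot (xi - eta) zeta = 0].

Definition commutant M : set (H -> H) :=
  [set T | bounded_op T /\ forall S, M S -> T \o S = S \o T].

Definition von_neumann M : Prop :=
  [/\ M `<=` bounded_op,
      forall T, M T -> M (adjoint T) &
      commutant (commutant M) = M].

(* Closure in B(H) for the strong operator topology, which is the topology of
   pointwise convergence. *)
Definition sot_closure M : set (H -> H) :=
  [set T | bounded_op T /\ closure (M : set {ptws H -> H}) T].

(* Normal (i.e. sigma-weakly continuous linear) functionals on M, the elements
   of its predual; only the values of phi on M matter, and linearity of phi on
   M is a consequence of the formula. *)
Definition normal_functional M phi : Prop :=
  exists xi eta : nat -> H,
    [/\ cvgn (series (fun k => rnorm (xi k) ^+ 2)),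
        cvgn (series (fun k => rnorm (eta k) ^+ 2)) &
        forall a, M a ->
          (fun n => \sum_(k < n) hdot (a (xi k)) (eta k)) @ \oo
            --> (phi a : R[i]^o)].

Definition positive_functional M phi : Prop :=
  forall a, M a -> positive_op a -> 0 <= phi a.

Definition separable_predual M : Prop :=
  exists2 d : nat -> (H -> H) -> R[i],
    forall n, normal_functional M (d n) &
    forall phi, normal_functional M phi -> forall eps : R, 0 < eps ->
      exists n, forall a, M a -> `|phi a - d n a| <= (eps * opnorm a)%:C.

Definition faithful_normal_state M phi : Prop :=
  [/\ normal_functional M phi, positive_functional M phi, phi idfun = 1 &
      forall a, M a -> positive_op a -> phi a = 0 -> a = (fun=> 0)].

Definition probability_space M phi : Prop :=
  [/\ von_neumann M, separable_predual M & faithful_normal_state M phi].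

(* H is the GNS space of (M, phi), M acting on it by the GNS representation,
   with canonical cyclic vector Omega. *)
Definition is_gns M phi (Omega : H) : Prop :=
  (forall a, M a -> phi a = hdot (a Omega) Omega) /\
  closure [set a Omega | a in M] = setT.

Record conditional_expectation M phi (B : set (H -> H))
    (E : (H -> H) -> (H -> H)) : Prop := {
  ce_range : forall a, M a -> B (E a) ;
  ce_id : forall b, B b -> E b = b ;
  ce_linear : forall (c : R[i]) a a', M a -> M a' ->
    E (fun xi => c *: a xi + a' xi) = (fun xi => c *: E a xi + E a' xi) ;
  ce_positive : forall a, M a -> positive_op a -> positive_op (E a) ;
  ce_module : forall b a b', B b -> M a -> B b' ->
    E (b \o a \o b') = b \o E a \o b' ;
  ce_preserves : forall a, M a -> phi (E a) = phi a
}.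

Definition expected_subalgebra M phi (B : set (H -> H)) E : Prop :=
  [/\ von_neumann B, B `<=` M & conditional_expectation M phi B E].

Definition independent (A0 : set (H -> H)) (E0 : (H -> H) -> (H -> H))
    (B C : set (H -> H)) : Prop :=
  A0 `<=` B `&` C /\
  forall x y, B x -> C y -> E0 (x \o y) = E0 x \o E0 y.

Definition vn_join (B C : set (H -> H)) : set (H -> H) :=
  smallest von_neumann (B `|` C).

End Operators.

Section SeminormTopologies.
Context {R : realType} {H : hilbertType R}.
Implicit Types (P : set ((H -> H) -> R)) (X Y : set (H -> H)).

Definition seq_limit P (u : nat -> H -> H) (x : H -> H) : Prop :=
  forall p, P p -> (fun n => p (u n \- x)) @ \oo --> (0 : R).

(* Joint continuity on X * Y of m, where X, Y and the target all carry the
   topology given by the family of seminorms P. *)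
Definition jointly_continuous P X Y (m : (H -> H) -> (H -> H) -> (H -> H)) :
    Prop :=
  forall x y, X x -> Y y -> forall p eps, P p -> 0 < eps ->
    exists Q (delta : R), [/\ finite_set Q, Q `<=` P, 0 < delta &
      forall x' y', X x' -> Y y' ->
        (forall q, Q q -> q (x' \- x) < delta) ->
        (forall q, Q q -> q (y' \- y) < delta) ->
        p (m x' y' \- m x y) < eps].

End SeminormTopologies.

Section HilbertModule.
Context {R : realType} {H : hilbertType R}.
Variables (A A0 : set (H -> H)) (Omega : H).
Implicit Types (B : set (H -> H)) (x y z : H -> H).

Definition gns_subspace B : set H := closure [set b Omega | b in B].

Definition ebar B : H -> H := oproj (gns_subspace B).

Definition hmod B : set (H -> H) := sot_closure [set b \o ebar A0 | b in B].

(* <x|y>_0 = x^* y, as the element a of A0 identified with a e_0. *)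
Definition inner0 x y : H -> H :=
  get [set a | A0 a /\ a \o ebar A0 = adjoint x \o y].

Definition abs0 x : H -> H := op_sqrt (inner0 x x).

Definition norm0 x : R := opnorm (abs0 x).

Definition norm0_top : set ((H -> H) -> R) := [set norm0].

Definition stop : set ((H -> H) -> R) :=
  [set (fun x => rnorm (abs0 x xi)) | xi in gns_subspace A0].

Definition sigma_stop : set ((H -> H) -> R) :=
  [set (fun x => Num.sqrt (complex.Re (phi (inner0 x x)))) | phi in
    [set phi | normal_functional A0 phi /\ positive_functional A0 phi]].

(* Extension to hmod A of the conditional expectation onto B. *)
Definition ext_ce B x : H -> H := ebar B \o x.

Definition approximates B (u : nat -> H -> H) x : Prop :=
  (forall n, B (u n)) /\ seq_limit stop (fun n => u n \o ebar A0) x.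

(* That the limit exists and does not depend on u is not built in here. *)
Definition mprod B x y : H -> H :=
  get [set z | hmod A z /\
       exists2 u, approximates B u x & seq_limit stop (fun n => u n \o y) z].

End HilbertModule.

(* Main.v *)
Require Import Defs.
From HB Require Import structures.
From mathcomp Require Import all_boot all_order all_algebra.
From mathcomp Require Import all_classical all_reals all_analysis.
From mathcomp Require Import complex.
From mathcomp Require Import ring lra.
Set Implicit Arguments.
Unset Strict Implicit.
Unset Printing Implicit Defensive.
Import Order.TTheory GRing.Theory Num.Theory numFieldNormedType.Exports.
Local Open Scope classical_set_scope.
Local Open Scope ring_scope.
Local Open Scope complex_scope.

(** Write e0 for the projection onto H0, the closure of A0 Omega, and HB, HC for
    the closures of B Omega, C Omega.  On GNS vectors a state-preserving
    expectation is an orthogonal projection, so E0(a) e0 = e0 a e0, and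
    independence becomes the commuting square E_C(b) = E0(b) for b in B
    ([expect_square]).  Every element y of the module over C maps into HC,
    whence, for b1 and b2 in B,

      <b1 (y v), b2 (y w)> = <E0(b2^* b1) (y v), y w>        ([gram]).

    So the size of b on the range of y depends only on the element E0(b^* b) of
    A0, which is known as soon as it is known on H0, that is, as soon as b e0
    is known.  This makes b y depend on b e0 only, and continuously; the inner
    product formula is the limit of this identity ([mul_dot]), and the module
    properties of the expectations are the limits of E_B y = E0 y and
    E_C b = E0(b) on HC.

    Information about an element a of A0 is carried from H0 to the whole space
    by one device.  Omega separates A0, so it is cyclic for the commutant A0'.
    For b in A0' let S be the square root of e0 b^* b e0; it commutes with A0,
    so the vector state of a at b Omega is its vector state at S Omega, a
    vector of H0 ([transfer]).  Hence positivity and norm bounds on H0 hold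
    everywhere, and conversely an operator x^* y, with x and y in the module,
    is of the form a e0 with a in A0 ([reduction], [inner0_spec]); the operator
    a is defined on A0' Omega by a (b Omega) = b (x^* y Omega).

    Strong closures have to be reached by sequences.  The separable predual
    yields a countable total set ([total_sequence]), so bounded approximation
    suffices.  If b e0 is strongly close to x, put D = b e0 - x and replace b by
    b (1 + <D|D>)^-1: the result is still close to x and its norm is at most
    1 + |x| ([bounded_correction]).  This plays the role of the Kaplansky
    density theorem and needs no convergence of adjoints.  Conversely an
    arbitrary approximating sequence is bounded by the uniform boundedness
    principle.

    For joint continuity, xy depends bilinearly on (x, y), and the inner product
    formula bounds <xy|xy> by |x|^2 <y|y>.  In the sigma-stop topology there
    remains <y| <d|d> y> with d small and bounded; a normal functional of it is,
    up to a small error proportional to the bound, a finite sum of vector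
    functionals on H0 ([normal_control]), and these are seminorms of d. *)

(** * The real scalar product *)

Section InnerProduct.
Context {R : realType} {H : hilbertType R}.
Implicit Types (x y z : H) (r : R).

(** The real part of the scalar product: it determines the complex one
    ([hdotE]), and identities and estimates for it are plain real algebra. *)
Definition rdot x y : R := complex.Re (hdot x y).

Lemma hdotC x y : hdot x y = (hdot y x)^*.
Proof. by rewrite hermC expr0 mul1r. Qed.

Lemma rdotC x y : rdot x y = rdot y x.
Proof. by rewrite /rdot hdotC; case: (hdot y x). Qed.

Lemma rdotDl x y z : rdot (x + y) z = rdot x z + rdot y z.
Proof. by rewrite /rdot linearDl raddfD. Qed.

Lemma rdotNl x z : rdot (- x) z = - rdot x z.
Proof. by rewrite /rdot linearNl raddfN. Qed.

Lemma hdotZl (c : R[i]) x z : hdot (c *: x) z = c * hdot x z.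
Proof. by rewrite linearZl_LR. Qed.

Lemma hdotZr (c : R[i]) x z : hdot x (c *: z) = c^* * hdot x z.
Proof. by rewrite linearZr_LR. Qed.

Lemma rdotZl r x z : rdot (r%:C *: x) z = r * rdot x z.
Proof. by rewrite /rdot hdotZl; case: (hdot x z) => a b /=; rewrite mul0r subr0. Qed.

Lemma rdotil x z : rdot ('i *: x) z = - complex.Im (hdot x z).
Proof.
by rewrite /rdot hdotZl; case: (hdot x z) => a b /=; rewrite mul0r mul1r sub0r.
Qed.

Lemma rnormE2 x : rnorm x ^+ 2 = rdot x x.
Proof.
rewrite /rdot hdot_norm /rnorm.
have : 0 <= `|x| by [].
case: (`|x|) => a b; rewrite lecE /= => /andP[/eqP -> _].
by rewrite mulr0 subr0 expr2.
Qed.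

Lemma rnorm_ge0 x : 0 <= rnorm x.
Proof.
rewrite /rnorm; have : 0 <= `|x| by [].
by case: (`|x|) => a b; rewrite lecE /= => /andP[].
Qed.

Lemma rnormE x : `|x| = (rnorm x)%:C.
Proof.
rewrite /rnorm; have : 0 <= `|x| by [].
by case: (`|x|) => a b; rewrite lecE /= => /andP[/eqP -> _].
Qed.
End InnerProduct.

Section RealInnerProduct.
Context {R : realType} {H : hilbertType R}.
Implicit Types (x y z : H) (r e : R).

Lemma rdotDr x y z : rdot x (y + z) = rdot x y + rdot x z.
Proof. by rewrite rdotC rdotDl !(rdotC x). Qed.

Lemma rdotNr x z : rdot x (- z) = - rdot x z.
Proof. by rewrite rdotC rdotNl rdotC. Qed.

Lemma rdotZr r x z : rdot x (r%:C *: z) = r * rdot x z.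
Proof. by rewrite rdotC rdotZl rdotC. Qed.

Lemma rdot0l x : rdot 0 x = 0.
Proof. by rewrite -(scale0r x) (_ : 0 = (0 : R)%:C) // rdotZl mul0r. Qed.

Lemma rdot0r x : rdot x 0 = 0.
Proof. by rewrite rdotC rdot0l. Qed.

Definition rdotE := (@rdotDl R H, rdotDr, @rdotNl R H, rdotNr, @rdotZl R H, rdotZr,
  rdot0l, rdot0r).

Lemma rdotii x y : rdot ('i *: x) ('i *: y) = rdot x y.
Proof.
rewrite rdotil hdotZr; case E: (hdot x y) => [a b] /=.
by rewrite /rdot E /= !mulN1r mul0r add0r opprK.
Qed.

Lemma rdotir x y : rdot x ('i *: y) = - rdot ('i *: x) y.
Proof.
rewrite rdotC !rdotil hdotC; case: (hdot x y) => a b /=; by rewrite opprK.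
Qed.


Lemma hdotE x y : hdot x y = Complex (rdot x y) (- rdot ('i *: x) y).
Proof. by rewrite rdotil opprK /rdot; case: (hdot x y). Qed.

Lemma rdot_ge0 x : 0 <= rdot x x.
Proof. by rewrite -rnormE2 sqr_ge0. Qed.

Lemma rnorm0_eq0 x : rnorm x = 0 -> x = 0.
Proof. by move=> h; apply/normr0_eq0; rewrite rnormE h. Qed.

Lemma rdot_eq0 x : rdot x x = 0 -> x = 0.
Proof.
by move=> h; apply: rnorm0_eq0; apply/eqP; rewrite -sqrf_eq0 rnormE2 h.
Qed.

Lemma rdot_inj x y : (forall z, rdot x z = rdot y z) -> x = y.
Proof.
move=> h; apply/eqP; rewrite -subr_eq0; apply/eqP/rdot_eq0.
by rewrite !rdotE !h; ring.
Qed.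

Lemma rnorm0 : rnorm (0 : H) = 0.
Proof. by rewrite /rnorm normr0. Qed.

Lemma rnormN x : rnorm (- x) = rnorm x.
Proof. by rewrite /rnorm normrN. Qed.

Lemma rnormB x y : rnorm (x - y) = rnorm (y - x).
Proof. by rewrite -rnormN opprB. Qed.

Lemma rnormD x y : rnorm (x + y) <= rnorm x + rnorm y.
Proof.
have := ler_normD x y; rewrite !rnormE.
by rewrite -(raddfD (real_complex R)) lecR.
Qed.

Lemma rnormBD x y z : rnorm (x - z) <= rnorm (x - y) + rnorm (y - z).
Proof. by rewrite -{1}(subrK y x) -addrA rnormD. Qed.

Lemma rnormZ r x : rnorm (r%:C *: x) = `|r| * rnorm x.
Proof.
by rewrite /rnorm normrZ rnormE normc_def /= expr0n /= addr0 sqrtr_sqr mul0r subr0.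
Qed.

Lemma rnormi x : rnorm ('i *: x) = rnorm x.
Proof.
have : rnorm ('i *: x) ^+ 2 = rnorm x ^+ 2 by rewrite !rnormE2 rdotii.
by move=> h; apply/eqP; rewrite -(@eqrXn2 _ 2) ?rnorm_ge0 // h.
Qed.

Lemma rnorm_le x (r : R) : 0 <= r -> rdot x x <= r ^+ 2 -> rnorm x <= r.
Proof. by move=> r0; rewrite -rnormE2 ler_pXn2r // nnegrE rnorm_ge0. Qed.

Lemma rnorm_mono x y : rdot x x <= rdot y y -> rnorm x <= rnorm y.
Proof. by rewrite -!rnormE2 ler_pXn2r // nnegrE rnorm_ge0. Qed.

Lemma cauchy_schwarz x y : `|rdot x y| <= rnorm x * rnorm y.
Proof.
have key (u v : H) : rdot u v <= rnorm u * rnorm v.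
  have [h|v0] := eqVneq (rnorm v) 0.
    by rewrite (rnorm0_eq0 h) rdot0r rnorm0 mulr0.
  have [h|u0] := eqVneq (rnorm u) 0.
    by rewrite (rnorm0_eq0 h) rdot0l rnorm0 mul0r.
  have vp : 0 < rnorm v by rewrite lt_neqAle eq_sym v0 rnorm_ge0.
  have up : 0 < rnorm u by rewrite lt_neqAle eq_sym u0 rnorm_ge0.
  have := rdot_ge0 ((rnorm v)%:C *: u - (rnorm u)%:C *: v).
  rewrite !rdotE -!rnormE2 (rdotC v u) => h.
  have h2 : 0 <= (rnorm u * rnorm v) * (rnorm u * rnorm v - rdot u v) by nra.
  by rewrite -subr_ge0 -(pmulr_rge0 _ (mulr_gt0 up vp)).
by rewrite ler_norml key andbT lerNl -rdotNr -(rnormN y) key.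
Qed.

Lemma rnormZC (c : R[i]) x :
  rnorm (c *: x) <= (`|complex.Re c| + `|complex.Im c|) * rnorm x.
Proof.
rewrite {1}(complexE c) scalerDl -scalerA; apply: le_trans (rnormD _ _) _.
by rewrite rnormi !rnormZ mulrDl.
Qed.
End RealInnerProduct.

(** * Sequences and bounded operators *)

Section Topology.
Context {R : realType} {H : hilbertType R}.
Implicit Types (x y z : H) (r e : R) (T : H -> H).

Lemma gt0_complexE (e : R[i]) : 0 < e -> e = (complex.Re e)%:C /\ 0 < complex.Re e.
Proof. by case: e => a b; rewrite ltcE /= => /andP[/eqP -> ->]. Qed.

Lemma nbhsHP x (A : set H) :
  nbhs x A <-> exists2 e : R, 0 < e & forall y, rnorm (y - x) < e -> A y.
Proof.
split=> [/nbhs_normP[e /= /gt0_complexE[-> e0] h]|[e e0 h]].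
  by exists (complex.Re e) => // y yx; apply: h; rewrite /= rnormE ltcR rnormB.
apply/nbhs_normP; exists e%:C; first by rewrite /= ltcR.
by move=> y /=; rewrite rnormE ltcR rnormB; apply: h.
Qed.

Lemma closureP (A : set H) x :
  closure A x <-> forall e : R, 0 < e -> exists2 y, A y & rnorm (y - x) < e.
Proof.
split=> [cl e e0|h B /nbhsHP[e e0 eB]].
  have [|y [Ay yx]] := cl [set y | rnorm (y - x) < e].
    by apply/nbhsHP; exists e.
  by exists y.
by have [y Ay yx] := h e e0; exists y; split=> //; apply: eB.
Qed.

Lemma cvgHP (u : nat -> H) x :
  (u @ \oo --> x) <-> forall e : R, 0 < e ->
     exists N, forall n, (N <= n)%N -> rnorm (u n - x) < e.
Proof.
split=> [cu e e0|h].
  have : nbhs x [set y | rnorm (y - x) < e] by apply/nbhsHP; exists e.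
  by move=> /cu [N _ hN]; exists N => n Nn; apply: hN.
move=> A /nbhsHP[e e0 eA]; have [N hN] := h e e0.
by exists N => // n /= Nn; apply: eA; apply: hN.
Qed.

Lemma cvg0P (u : nat -> R) : (forall n, 0 <= u n) ->
  (u @ \oo --> (0 : R)) <-> forall e : R, 0 < e ->
     exists N, forall n, (N <= n)%N -> u n < e.
Proof.
move=> u0; split=> [/cvgr0Pnorm_lt h e e0|h].
  have [N _ hN] := h e e0.
  by exists N => n Nn; have := hN n Nn; rewrite /= ger0_norm.
apply/cvgr0Pnorm_lt => e e0; have [N hN] := h e e0.
by exists N => // n /= Nn; rewrite ger0_norm //; apply: hN.
Qed.

Lemma cvgHrP (u : nat -> H) x :
  (u @ \oo --> x) <-> (fun n => rnorm (u n - x)) @ \oo --> (0 : R).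
Proof.
by rewrite cvgHP cvg0P // => n; apply: rnorm_ge0.
Qed.

Lemma hilbert_complete (u : nat -> H) :
  (forall e : R, 0 < e -> exists N, forall n m, (N <= n)%N -> (N <= m)%N ->
     rnorm (u n - u m) < e) -> exists x, u @ \oo --> x.
Proof.
move=> cu; suff /cauchy_cvgP cc : cauchy (u @ \oo) by exists (lim (u @ \oo)).
apply/cauchy_ballP => e /gt0_complexE[-> e0]; have [N hN] := cu _ e0.
near=> xx.
have : (exists2 n, (N <= n)%N & xx.1 = u n) /\ (exists2 n, (N <= n)%N & xx.2 = u n).
  near: xx; exists ([set x | exists2 n, (N <= n)%N & x = u n],
                     [set x | exists2 n, (N <= n)%N & x = u n]) => /=.
    by split; exists N => // n /= Nn; exists n.
  by case=> a b /= [].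
move=> [[n Nn ->] [m Nm ->]].
by rewrite /= -ball_normE /= rnormE ltcR; apply: hN.
Unshelve. all: by end_near. Qed.

Lemma limH_unique (u : nat -> H) x y : u @ \oo --> x -> u @ \oo --> y -> x = y.
Proof. by move=> ux uy; apply: (cvg_unique _ ux uy). Qed.

Lemma linD T : linear T -> {morph T : x y / x + y}.
Proof. by move=> lT x y; rewrite -[x in LHS]scale1r lT scale1r. Qed.

Lemma linB T : linear T -> {morph T : x y / x - y}.
Proof. by move=> lT x y; rewrite -scaleN1r addrC lT scaleN1r addrC. Qed.

Lemma lin0 T : linear T -> T 0 = 0.
Proof. by move=> lT; have := linB lT 0 0; rewrite !subrr. Qed.

Lemma linZ T : linear T -> forall (c : R[i]) x, T (c *: x) = c *: T x.
Proof. by move=> lT c x; rewrite -[c *: x]addr0 lT lin0 // addr0. Qed.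

(** Continuity at 0 gives a ball mapped into the unit ball; scaling turns
    its radius into a bound. *)
Lemma bounded_opP T :
  bounded_op T <-> linear T /\ exists2 K, 0 <= K & forall x, rnorm (T x) <= K * rnorm x.
Proof.
split=> [[lT cT]|[lT [K K0 hK]]]; split=> //.
  have : nbhs (0 : H) [set x | rnorm (T x) < 1].
    have := cT 0 [set y | rnorm y < 1]; apply.
    by apply/nbhsHP; exists 1 => // y; rewrite (lin0 lT) subr0.
  move=> /nbhsHP[e e0 h]; exists (2 / e) => [|x]; first by rewrite divr_ge0 ?ltW.
  have [n0|n0] := eqVneq (rnorm x) 0.
    by rewrite (rnorm0_eq0 n0) (lin0 lT) rnorm0 mulr0.
  have xp : 0 < rnorm x by rewrite lt_neqAle eq_sym n0 rnorm_ge0.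
  have := h ((e / 2 / rnorm x)%:C *: x).
  rewrite subr0 /= (linZ lT) !rnormZ ger0_norm; last first.
    by rewrite !divr_ge0 ?rnorm_ge0 // ltW.
  rewrite mulfVK // => /(_ _)/ltW; rewrite ltr_pdivrMr // ltr_pMr //.
  rewrite ltr1n => /(_ isT).
  rewrite mulrAC ler_pdivrMr // mul1r -ler_pdivlMl ?divr_gt0 //.
  by rewrite invf_div.
move=> x A /nbhsHP[e e0 h]; apply/nbhsHP; exists (e / (K + 1)).
  by rewrite divr_gt0 // ltr_wpDl.
move=> y; rewrite ltr_pdivlMr ?ltr_wpDl // => yx; apply: h.
rewrite -(linB lT).
apply: le_lt_trans (hK _) _; apply: le_lt_trans yx.
by have := rnorm_ge0 (y - x); nra.
Qed.
End Topology.

(** * The projection theorem *)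

Section Limits.
Context {R : realType} {H : hilbertType R}.
Implicit Types (x y z : H) (u v : nat -> H) (r e : R) (T : H -> H).

Lemma harmonic_lt e : 0 < e -> exists N, forall n, (N <= n)%N -> n.+1%:R^-1 < e.
Proof.
move=> e0; have [N _ hN] := near_infty_natSinv_lt (PosNum e0).
by exists N => n Nn; apply: hN.
Qed.

Lemma null_squeeze (f g : nat -> R) (l : R) :
  (forall n, `|f n - l| <= g n) -> g @ \oo --> (0 : R) -> f @ \oo --> l.
Proof.
move=> fg /cvgr0Pnorm_lt g0; apply/cvgrPdist_lt => e e0.
apply: filterS (g0 e e0) => n; rewrite distrC; apply: le_lt_trans.
exact: le_trans (fg n) (ler_norm _).
Qed.

Lemma null_squeezeH (f : nat -> H) (g : nat -> R) x :
  (forall n, rnorm (f n - x) <= g n) -> g @ \oo --> (0 : R) -> f @ \oo --> x.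
Proof.
move=> fg g0; apply/cvgHrP; apply: null_squeeze g0 => n.
by rewrite subr0 ger0_norm ?rnorm_ge0.
Qed.

Lemma cvgr_rnormB u x : u @ \oo --> x -> (fun n => rnorm (u n - x)) @ \oo --> (0 : R).
Proof. by move/cvgHrP. Qed.

Lemma cvg_rdot u v x y : u @ \oo --> x -> v @ \oo --> y ->
  (fun n => rdot (u n) (v n)) @ \oo --> rdot x y.
Proof.
move=> /cvgr_rnormB ux /cvgr_rnormB vy.
apply: (@null_squeeze _ (fun n => rnorm (u n - x) * rnorm (v n - y) +
   (rnorm (u n - x) * rnorm y + rnorm (v n - y) * rnorm x))) => [n|].
  have -> : rdot (u n) (v n) - rdot x y =
     rdot (u n - x) (v n - y) + (rdot (u n - x) y + rdot (v n - y) x).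
    by rewrite !rdotE (rdotC y x) (rdotC (v n) x); ring.
  apply: le_trans (ler_normD _ _) _; apply: lerD; first exact: cauchy_schwarz.
  by apply: le_trans (ler_normD _ _) _; apply: lerD; exact: cauchy_schwarz.
rewrite -[0]addr0; apply: cvgD; first by rewrite -[0](mulr0 0); apply: cvgM.
rewrite -[0]addr0; apply: cvgD.
  by rewrite -(mul0r (rnorm y)); apply: cvgMr_tmp.
by rewrite -(mul0r (rnorm x)); apply: cvgMr_tmp.
Qed.

Lemma cvg_rnorm u x : u @ \oo --> x -> (fun n => rnorm (u n)) @ \oo --> rnorm x.
Proof.
move=> /cvgr_rnormB ux; apply: null_squeeze ux => n.
have := rnormD (u n - x) x; have := rnormD (x - u n) (u n).
by rewrite !subrK (rnormB x) => h1 h2; rewrite ler_norml; apply/andP; split; lra.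
Qed.

Lemma cvg_cstH x : (fun _ : nat => x) @ \oo --> x.
Proof. exact: cvg_cst. Qed.

Lemma cvg_op T u x : bounded_op T -> u @ \oo --> x -> (fun n => T (u n)) @ \oo --> T x.
Proof. by move=> [_ cT] ux; apply: (cvg_comp u T) ux _; apply: cT. Qed.

Lemma limr_unique (f : nat -> R) (a b : R) : f @ \oo --> a -> f @ \oo --> b -> a = b.
Proof. by move=> fa fb; apply: (cvg_unique _ fa fb). Qed.

Lemma limit_le (f : nat -> R) (a b : R) : f @ \oo --> a -> (forall n, f n <= b) -> a <= b.
Proof.
move=> fa fb; rewrite -(cvg_lim _ fa) //; apply: limr_le; first by apply/cvg_ex; exists a.
exact: nearW.
Qed.

Lemma closure_seq (A : set H) x :
  closure A x <-> exists2 u, (forall n, A (u n)) & u @ \oo --> x.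
Proof.
split=> [/closureP cl|[u Au /cvgHP ux]]; last first.
  by apply/closureP => e /ux[N hN]; exists (u N) => //; apply: hN.
have /choice[u hu] : forall n, exists y, A y /\ rnorm (y - x) < n.+1%:R^-1.
  by move=> n; have [|y Ay yx] := cl n.+1%:R^-1; [rewrite invr_gt0|exists y].
exists u => [n|]; first by have [] := hu n.
apply/cvgHP => e /harmonic_lt[N hN]; exists N => n Nn.
by have [_ h] := hu n; apply: lt_trans h (hN n Nn).
Qed.

End Limits.

Section Projection.
Context {R : realType} {H : hilbertType R}.
Implicit Types (x y z : H) (K : set H) (T : H -> H).

Definition subspace K := K 0 /\ forall (c : R[i]) x y, K x -> K y -> K (c *: x + y).

Definition closed_subspace K := subspace K /\ closure K `<=` K.

Lemma subspaceD K x y : subspace K -> K x -> K y -> K (x + y).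
Proof. by move=> [_ h] Kx Ky; rewrite -(scale1r x); apply: h. Qed.

Lemma subspaceZ K c x : subspace K -> K x -> K (c *: x).
Proof. by move=> [K0 h] Kx; rewrite -[_ *: _]addr0; apply: h. Qed.

Lemma subspaceB K x y : subspace K -> K x -> K y -> K (x - y).
Proof. by move=> sK Kx Ky; apply: subspaceD => //; rewrite -scaleN1r; apply: subspaceZ. Qed.

Lemma closure_subspace K : subspace K -> closed_subspace (closure K).
Proof.
move=> [K0 sK]; split; last by move: (@closed_closure _ K) => /closure_id <-.
split=> [|c x y]; first exact: subset_closure.
move=> /closure_seq[u Ku ux] /closure_seq[v Kv vy].
apply/closure_seq; exists (fun n => c *: u n + v n) => [n|]; first exact: sK.
by apply: cvgD => //; apply: cvgZl_tmp.
Qed.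

(** The quadratic is negative at [t = a / (b + 1)] unless [a = 0]. *)
Lemma linear_term_eq0 (a b : R) : 0 <= b -> (forall t : R, 0 <= t * t * b - 2 * t * a) -> a = 0.
Proof.
move=> b0 h; have := h (a / (b + 1)); have b1 : b + 1 != 0 by rewrite gt_eqF // ltr_wpDl.
have -> : a / (b + 1) * (a / (b + 1)) * b - 2 * (a / (b + 1)) * a =
   - (a * a * ((b + 2) / (b + 1) ^+ 2)) by field.
have p : 0 < (b + 2) / (b + 1) ^+ 2 by rewrite divr_gt0 // ?exprn_gt0 // ltr_wpDl.
rewrite oppr_ge0 pmulr_lle0 // => aa; apply/eqP; rewrite -sqrf_eq0 expr2.
by rewrite eq_le aa -expr2 sqr_ge0.
Qed.

(** By the parallelogram identity a minimizing sequence for the distance from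
    [x] to [K] is a Cauchy sequence; at its limit the derivative of the squared
    distance in the directions of [K] vanishes. *)
Lemma projection_theorem K x : closed_subspace K ->
  exists2 y, K y & forall z, K z -> rdot (x - y) z = 0.
Proof.
move=> [sK cK]; pose q y := rdot (x - y) (x - y).
have hi : has_inf (q @` K).
  split; first by exists (q 0), 0 => //; have [] := sK.
  by exists 0 => _ [y _ <-]; apply: rdot_ge0.
have dq y : K y -> inf (q @` K) <= q y by move=> Ky; apply: ge_inf; [case: hi|exists y].
have /choice[u hu] : forall n, exists y, K y /\ q y < inf (q @` K) + n.+1%:R^-1.
  move=> n; have [|_ [y Ky <-] h] := inf_adherent (eps := n.+1%:R^-1) _ hi.
    by rewrite invr_gt0.
  by exists y.
(* The parallelogram identity, with the midpoint of u n and u m in K. *)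
have par n m : rdot (u n - u m) (u n - u m) <= 2 * n.+1%:R^-1 + 2 * m.+1%:R^-1.
  have /dq : K ((2^-1 : R)%:C *: (u n + u m)).
    by apply: subspaceZ => //; apply: subspaceD => //; [case: (hu n)|case: (hu m)].
  have [_] := hu n; have [_] := hu m.
  rewrite /q !rdotE (rdotC (u n) x) (rdotC (u m) x) (rdotC (u m) (u n)) .
  move: (inf _) (n.+1%:R^-1) (m.+1%:R^-1) => d a b h1 h2 h3; lra.
have [y uy] : exists y, u @ \oo --> y.
  apply: hilbert_complete => e e0.
  have [|N hN] := @harmonic_lt _ (e ^+ 2 / 4); first by rewrite divr_gt0 // exprn_gt0.
  exists N => n m Nn Nm; rewrite -(@ltr_pXn2r _ 2) ?nnegrE ?rnorm_ge0 ?ltW //.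
  rewrite rnormE2; apply: le_lt_trans (par n m) _.
  by move: (n.+1%:R^-1) (m.+1%:R^-1) (hN n Nn) (hN m Nm) => a b; lra.
have Ky : K y by apply: cK; apply/closure_seq; exists u => // n; case: (hu n).
have qy : q y <= inf (q @` K).
  have qu : (fun n => rdot (x - u n) (x - u n)) @ \oo --> q y.
    by apply: cvg_rdot; apply: cvgB => //; apply: cvg_cst.
  rewrite -subr_le0; apply/ler_addgt0Pl => e e0; rewrite addr0 lerBlDr.
  have [N hN] := harmonic_lt e0.
  have : (fun n => rdot (x - u (n + N)%N) (x - u (n + N)%N)) @ \oo --> q y.
    by move: qu; rewrite -(cvg_shiftn N).
  move=> /limit_le; apply => n; have [_ /ltW] := hu (n + N)%N.
  move=> /le_trans; apply; rewrite addrC lerD2r ltW // hN // leq_addl //.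
exists y => // z Kz; apply: (@linear_term_eq0 _ (rdot z z)); first exact: rdot_ge0.
move=> t; have /dq/(le_trans qy) : K (y + t%:C *: z).
  by apply: subspaceD => //; apply: subspaceZ.
by rewrite /q !rdotE (rdotC y x) (rdotC z x) (rdotC z y) => h1; lra.
Qed.
End Projection.

(** * Orthogonal projections and adjoints *)

Section Operators.
Context {R : realType} {H : hilbertType R}.
Implicit Types (x y z : H) (K : set H) (S T : H -> H).

Lemma hdot0 x y : (forall c : R[i], rdot x (c *: y) = 0) -> hdot x y = 0.
Proof.
move=> h; rewrite hdotE -rdotC rdotC; have := h 'i; rewrite rdotir => /eqP.
by rewrite oppr_eq0 => /eqP ->; rewrite -[y]scale1r h oppr0.
Qed.

Lemma rdotZCl (c : R[i]) x y : rdot (c *: x) y = rdot x (c^* *: y).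
Proof. by rewrite /rdot hdotZl hdotZr conjCK. Qed.

Lemma oproj_spec K x : closed_subspace K ->
  K (oproj K x) /\ forall z, K z -> rdot (x - oproj K x) z = 0.
Proof.
move=> cK; have [y Ky hy] := projection_theorem x cK.
have : [set y | K y /\ forall z, K z -> hdot (x - y) z = 0] (oproj K x).
  apply: (@getI _ _ y); split=> // z Kz; apply: hdot0 => c; apply: hy.
  by apply: subspaceZ => //; case: cK.
by move=> [Kp hp]; split=> // z Kz; rewrite /rdot hp.
Qed.

Lemma oproj_in K x : closed_subspace K -> K (oproj K x).
Proof. by move=> /(oproj_spec x)[]. Qed.

Lemma oproj_orth K x z : closed_subspace K -> K z -> rdot (oproj K x) z = rdot x z.
Proof.
move=> /(oproj_spec x)[_ h] /h; rewrite !rdotE => /eqP.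
by rewrite subr_eq0 => /eqP.
Qed.

Lemma oproj_unique K x y : closed_subspace K -> K y ->
  (forall z, K z -> rdot y z = rdot x z) -> oproj K x = y.
Proof.
move=> cK Ky h; apply/eqP; rewrite -subr_eq0; apply/eqP/rdot_eq0.
have Kd : K (oproj K x - y).
  by apply: subspaceB => //; [case: cK|apply: oproj_in].
by rewrite rdotDl rdotNl oproj_orth // h // subrr.
Qed.

Lemma oproj_id K x : closed_subspace K -> K x -> oproj K x = x.
Proof. by move=> cK Kx; apply: oproj_unique. Qed.

Lemma oproj_sym K x y : closed_subspace K -> rdot (oproj K x) y = rdot x (oproj K y).
Proof.
move=> cK; rewrite rdotC -(oproj_orth y cK (oproj_in x cK)) rdotC.
by rewrite oproj_orth //; apply: oproj_in.
Qed.

Lemma oproj_le K x : closed_subspace K -> rnorm (oproj K x) <= rnorm x.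
Proof.
move=> cK; apply: rnorm_mono.
have := rdot_ge0 (x - oproj K x); have := oproj_orth x cK (oproj_in x cK).
by rewrite !rdotE (rdotC (oproj K x) x) => ->; lra.
Qed.

Lemma oproj_linear K : closed_subspace K -> linear (oproj K).
Proof.
move=> cK c x y; apply: oproj_unique => // [|z Kz].
  by case: (cK) => -[_ h] _; apply: h; apply: oproj_in.
rewrite !rdotDl !rdotZCl !oproj_orth //.
by apply: subspaceZ => //; case: cK.
Qed.

Lemma oproj_bounded K : closed_subspace K -> bounded_op (oproj K).
Proof.
move=> cK; apply/bounded_opP; split; first exact: oproj_linear.
by exists 1 => // x; rewrite mul1r oproj_le.
Qed.

Lemma closed_subspace_total K : closed_subspace K ->
  (forall x, (forall z, K z -> rdot x z = 0) -> x = 0) -> forall x, K x.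
Proof.
move=> cK h x; have [Kp hp] := oproj_spec x cK.
by have /eqP := h _ hp; rewrite subr_eq0 => /eqP ->.
Qed.

Lemma bopD T x y : bounded_op T -> T (x + y) = T x + T y.
Proof. by case=> lT _; apply: linD. Qed.

Lemma bopB T x y : bounded_op T -> T (x - y) = T x - T y.
Proof. by case=> lT _; apply: linB. Qed.

Lemma bopZ T (c : R[i]) x : bounded_op T -> T (c *: x) = c *: T x.
Proof. by case=> lT _; apply: linZ. Qed.

Lemma bop0 T : bounded_op T -> T 0 = 0.
Proof. by case=> lT _; apply: lin0. Qed.

Lemma bop_bound T : bounded_op T ->
  exists2 K, 0 <= K & forall x, rnorm (T x) <= K * rnorm x.
Proof. by move=> /bounded_opP[]. Qed.

Lemma bounded_id : bounded_op (idfun : H -> H).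
Proof. by split=> // x; apply: cvg_id. Qed.

Lemma bounded_comp S T : bounded_op S -> bounded_op T -> bounded_op (S \o T).
Proof.
move=> [lS cS] [lT cT]; split=> [c x y|x]; first by rewrite /= lT lS.
by apply: continuous_comp; [apply: cT|apply: cS].
Qed.

Lemma bounded_lin (c : R[i]) S T : bounded_op S -> bounded_op T ->
  bounded_op (fun x => c *: S x + T x).
Proof.
move=> bS bT; split=> [d x y|x].
  have [lS _] := bS; have [lT _] := bT.
  by rewrite lS lT !scalerDr !scalerA (mulrC c) addrACA.
apply: cvgD; last by case: bT => _; apply.
by apply: cvgZl_tmp; case: bS => _; apply.
Qed.

(** A vector orthogonal to the kernel, suitably scaled, represents the form. *)
Lemma riesz (f : H -> R[i]) :
  (forall (c : R[i]) x y, f (c *: x + y) = c * f x + f y) ->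
  closure [set x | f x = 0] `<=` [set x | f x = 0] ->
  exists s, forall x, f x = hdot x s.
Proof.
move=> lf cf; pose K := [set x | f x = 0].
have f0 : f 0 = 0.
  by have := lf (-1) 0 0; rewrite scaler0 addr0 mulN1r addNr.
have cK : closed_subspace K.
  split=> //; split=> // c x y; rewrite /K /= lf => -> ->.
  by rewrite mulr0 addr0.
have [[x0 fx0]|nK] := pselect (exists x, f x <> 0); last first.
  exists 0 => x; rewrite linear0r.
  by have [//|fx] := pselect (f x = 0); case: nK; exists x.
pose w := x0 - oproj K x0.
have wK z : K z -> hdot z w = 0.
  move=> Kz; rewrite hdotC hdot0 ?rmorph0 // => c.
  by have [_] := oproj_spec x0 cK; apply; apply: subspaceZ => //; case: cK.
have fw : f w <> 0.
  rewrite /w addrC -scaleN1r lf.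
  by have := oproj_in x0 cK; rewrite /K /= => ->; rewrite mulr0 add0r.
have w0 : hdot w w != 0.
  apply/eqP => h; apply: fw; rewrite (_ : w = 0) //.
  by apply: rdot_eq0; rewrite /rdot h.
exists ((f w / hdot w w)^* *: w) => x; rewrite hdotZr conjCK.
have := @wK (- (f x / f w) *: w + x).
rewrite /K /= lf mulNr divfK ?addNr; last exact/eqP.
move=> /(_ erefl); rewrite linearDl /= hdotZl mulNr addrC => /eqP.
rewrite subr_eq0 => /eqP ->; rewrite mulrA; have /eqP := fw => fw'.
by rewrite mulrAC mulfVK // mulrC divfK.
Qed.

Lemma adjoint_exists T : bounded_op T -> exists S, bounded_op S /\
  forall x y, hdot (T x) y = hdot x (S y).
Proof.
move=> bT; have /choice[S hS] : forall y, exists s, forall x, hdot (T x) y = hdot x s.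
  move=> y; apply: riesz => [c u v|x].
    by rewrite bopD // bopZ // linearDl /= hdotZl.
  move=> /closure_seq[u hu ux] /=.
  suff h c : rdot (T x) (c *: y) = 0 by apply: hdot0.
  have h := cvg_rdot (cvg_op bT ux) (@cvg_cstH _ _ (c *: y)).
  apply: (limr_unique h).
  rewrite (_ : (fun _ => _) = fun=> 0); first exact: cvg_cst.
  by apply/funext => n; rewrite /rdot hdotZr hu mulr0.
exists S; split=> //; apply/bounded_opP.
have rS x y : rdot (T x) y = rdot x (S y) by rewrite /rdot hS.
split=> [c x y|].
  apply: rdot_inj => z; rewrite rdotC -rS rdotDr [in RHS]rdotDl [in RHS]rdotZCl.
  by rewrite (rdotC (S x)) (rdotC (S y)) -!rS bopZ // rdotZCl conjCK.
have [K K0 hK] := bop_bound bT; exists K => // y.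
(* The bound of T is one of S: |S y|^2 = <T (S y), y>. *)
have [n0|n0] := eqVneq (rnorm (S y)) 0.
  by rewrite n0 mulr_ge0 // rnorm_ge0.
have np : 0 < rnorm (S y) by rewrite lt_neqAle eq_sym n0 rnorm_ge0.
rewrite -(ler_pM2r np) -expr2 rnormE2 -rS.
apply: le_trans (ler_norm _) _; apply: le_trans (cauchy_schwarz _ _) _.
by rewrite mulrAC ler_wpM2r ?rnorm_ge0.
Qed.

Lemma adjoint_spec T : bounded_op T -> bounded_op (adjoint T) /\
  forall x y, hdot (T x) y = hdot x (adjoint T y).
Proof.
move=> /adjoint_exists [S hS]; exact: (@getI _ [set S | bounded_op S /\
  forall x y, hdot (T x) y = hdot x (S y)] S hS).
Qed.

Lemma adjoint_bounded T : bounded_op T -> bounded_op (adjoint T).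
Proof. by move=> /adjoint_spec[]. Qed.

Lemma adjP T x y : bounded_op T -> rdot (T x) y = rdot x (adjoint T y).
Proof. by move=> /adjoint_spec[_ h]; rewrite /rdot h. Qed.

Lemma adjPl T x y : bounded_op T -> rdot x (T y) = rdot (adjoint T x) y.
Proof. by move=> bT; rewrite rdotC adjP // rdotC. Qed.

End Operators.

(** * Positive operators and their square roots *)

Section Positive.
Context {R : realType} {H : hilbertType R}.
Implicit Types (x y z : H) (S T Q : H -> H).

Definition symmetric_op T := forall x y, rdot (T x) y = rdot x (T y).

(** Positivity of [<T x, x>] contains its reality, and polarization turns
    reality into symmetry. *)
Lemma positive_opP T : positive_op T <->
  [/\ bounded_op T, symmetric_op T & forall x, 0 <= rdot (T x) x].
Proof.
split=> [[bT pT]|[bT sT pT]].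
  have iT x : rdot ('i *: T x) x = 0.
    by rewrite rdotil; have := pT x; rewrite lecE /= => /andP[/eqP -> _]; rewrite oppr0.
  have aT x y : rdot ('i *: T x) y = - rdot ('i *: T y) x.
    have := iT (x + y); rewrite bopD // scalerDr !rdotE !iT add0r addr0 => /eqP.
    by rewrite addrC addr_eq0 => /eqP.
  split=> // [x y|x]; last by have := pT x; rewrite lecE => /andP[].
  have := aT ('i *: x) y; rewrite bopZ // scalerA -expr2 sqr_i scaleN1r rdotNl.
  by rewrite rdotii => /oppr_inj ->; rewrite rdotC.
split=> // x; rewrite hdotE lecE /= pT andbT oppr_eq0.
have h : rdot ('i *: T x) x = - rdot ('i *: T x) x.
  by rewrite -{1}bopZ // sT rdotC rdotir.
by apply/eqP; lra.
Qed.

Lemma positive_cauchy T x y : symmetric_op T -> linear T -> (forall x, 0 <= rdot (T x) x) ->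
  rdot (T x) y ^+ 2 <= rdot (T x) x * rdot (T y) y.
Proof.
move=> sT lT pT.
have key (t : R) : 0 <= rdot (T x) x - 2 * t * rdot (T x) y + t ^+ 2 * rdot (T y) y.
  have := pT (x - t%:C *: y); rewrite linB // linZ // !rdotE.
  by rewrite (sT y x) (rdotC y (T x)) => h; lra.
have := pT x; have := pT y; rewrite le_eqVlt => /orP[/eqP y0|y0] x0.
  rewrite -y0 mulr0; have [-> |xy0] := eqVneq (rdot (T x) y) 0; first by rewrite expr0n.
  have := key ((rdot (T x) x + 1) / (2 * rdot (T x) y)); rewrite -y0 mulr0 addr0.
  have -> : 2 * ((rdot (T x) x + 1) / (2 * rdot (T x) y)) * rdot (T x) y = rdot (T x) x + 1.
    by field.
  by lra.
have := key (rdot (T x) y / rdot (T y) y).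
have -> : rdot (T x) x - 2 * (rdot (T x) y / rdot (T y) y) * rdot (T x) y +
    (rdot (T x) y / rdot (T y) y) ^+ 2 * rdot (T y) y =
    rdot (T x) x - rdot (T x) y ^+ 2 / rdot (T y) y.
  by field; rewrite gt_eqF.
by rewrite subr_ge0 ler_pdivrMr.
Qed.

(** The Cauchy-Schwarz inequality for the form [<T x, y>], at [y = T x]. *)
Lemma positive_norm_le T (M : R) : symmetric_op T -> linear T ->
  (forall x, 0 <= rdot (T x) x) -> 0 <= M -> (forall x, rdot (T x) x <= M * rdot x x) ->
  forall x, rnorm (T x) <= M * rnorm x.
Proof.
move=> sT lT pT M0 hM x.
have [n0|n0] := eqVneq (rdot (T x) (T x)) 0.
  by rewrite (rdot_eq0 n0) rnorm0 mulr_ge0 ?rnorm_ge0.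
have np : 0 < rdot (T x) (T x) by rewrite lt_neqAle eq_sym n0 rdot_ge0.
apply: rnorm_le; first by rewrite mulr_ge0 ?rnorm_ge0.
rewrite exprMn rnormE2.
have h1 := positive_cauchy x (T x) sT lT pT.
have h2 := hM x; have h3 := hM (T x).
have h : rdot (T x) (T x) ^+ 2 <= M * rdot x x * (M * rdot (T x) (T x)).
  by apply: le_trans h1 _; apply: ler_pM.
move: h; rewrite expr2 [leRHS]mulrA ler_pM2r // => h.
by apply: le_trans h _; rewrite expr2; lra.
Qed.

End Positive.

Section SquareRoot.
Context {R : realType} {H : hilbertType R}.
Implicit Types (x y z : H) (S T Q : H -> H).

(** The scalar iteration that dominates [root_approx] for a contraction [X]. *)
Fixpoint majorant (n : nat) : R :=
  if n is m.+1 then 2^-1 * (1 + majorant m ^+ 2) else 0.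

(** Iteration of [Y |-> (X + Y^2) / 2] from 0, whose fixed point satisfies
    [(1 - Y)^2 = 1 - X]. *)
Fixpoint root_approx (X : H -> H) (n : nat) : H -> H :=
  if n is m.+1 then fun x => (2^-1 : R)%:C *: (X x + root_approx X m (root_approx X m x))
  else fun=> 0.

Lemma majorant_01 n : 0 <= majorant n <= 1.
Proof. by elim: n => [|n /andP[h0 h1]] /=; apply/andP; split=> //; nra. Qed.

Lemma majorant_le n : majorant n <= majorant n.+1.
Proof. by have /andP[h0 h1] := majorant_01 n; rewrite /=; nra. Qed.

Lemma majorant_mono n k : majorant n <= majorant (n + k)%N.
Proof.
elim: k => [|k h]; first by rewrite addn0.
by rewrite addnS; apply: le_trans h (majorant_le _).
Qed.

Lemma majorant_cauchy (e : R) : 0 < e ->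
  exists N, forall k, majorant (N + k)%N - majorant N < e.
Proof.
move=> e0.
have hs : has_sup (range majorant).
  split; first by exists (majorant 0), 0%N.
  by exists 1 => _ [n _ <-]; have /andP[] := majorant_01 n.
have [_ [N _ <-] hN] := sup_adherent e0 hs; exists N => k.
have : majorant (N + k)%N <= sup (range majorant).
  by apply: sup_upper_bound => //; exists (N + k)%N.
by move: hN; lra.
Qed.

Lemma root_linear X n : linear X -> linear (root_approx X n).
Proof.
move=> lX; elim: n => [|n lY] c x y /=; first by rewrite scaler0 addr0.
rewrite lX !lY [c *: (_ *: _)]scalerA (mulrC c) -scalerA -scalerDr; congr (_ *: _).
by rewrite scalerDr addrACA.
Qed.

Lemma root_sym X n : symmetric_op X -> symmetric_op (root_approx X n).
Proof.
move=> sX; elim: n => [|n sY] x y /=; first by rewrite rdot0l rdot0r.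
by rewrite rdotZl rdotZr rdotDl rdotDr sX !sY.
Qed.

Lemma root_comm X Q n : linear Q -> (forall x, Q (X x) = X (Q x)) ->
  forall x, Q (root_approx X n x) = root_approx X n (Q x).
Proof.
move=> lQ cQ; elim: n => [|n h] x /=; first exact: lin0.
by rewrite linZ // linD // cQ !h.
Qed.

Section Contraction.
Variable X : H -> H.
Hypotheses (lX : linear X) (X1 : forall x, rnorm (X x) <= rnorm x).
Let Y := root_approx X.

Lemma root_norm n x : rnorm (Y n x) <= majorant n * rnorm x.
Proof.
elim: n x => [|n h] x /=; first by rewrite rnorm0 mul0r.
rewrite rnormZ ger0_norm; last by rewrite invr_ge0.
rewrite -mulrA ler_pM2l ?invr_gt0 //; apply: le_trans (rnormD _ _) _.
rewrite mulrDl mul1r; apply: lerD => //; apply: le_trans (h _) _.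
rewrite expr2 -mulrA; apply: ler_wpM2l => //.
by have /andP[] := majorant_01 n.
Qed.

Lemma root_norm1 n x : rnorm (Y n x) <= rnorm x.
Proof.
apply: le_trans (root_norm n x) _; rewrite ler_piMl ?rnorm_ge0 //.
by have /andP[] := majorant_01 n.
Qed.

(** The difference of squares [Y'^2 - Y^2 = Y' (Y' - Y) + (Y' - Y) Y] reproduces the
    scalar recursion of the majorant. *)
Lemma root_step n x :
  rnorm (Y n.+1 x - Y n x) <= (majorant n.+1 - majorant n) * rnorm x.
Proof.
elim: n x => [|n h] x.
  rewrite /= expr0n /= !addr0 !subr0 mulr1 rnormZ ger0_norm ?invr_ge0 //.
  by apply: ler_wpM2l; rewrite ?invr_ge0 ?addr0.
have lY : linear (Y n.+1) by apply: root_linear.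
have -> : Y n.+2 x - Y n.+1 x = (2^-1 : R)%:C *:
     (Y n.+1 (Y n.+1 x - Y n x) + (Y n.+1 (Y n x) - Y n (Y n x))).
  rewrite (linB lY) [Y n.+2 x]/= [X in _ - X]/= -scalerBr; congr (_ *: _).
  by rewrite -!/(Y _) addrA subrK opprD addrACA subrr add0r.
rewrite rnormZ ger0_norm ?invr_ge0 //.
apply: (@le_trans _ _ (2^-1 * (majorant n.+1 * ((majorant n.+1 - majorant n) * rnorm x)
    + (majorant n.+1 - majorant n) * (majorant n * rnorm x)))).
  apply: ler_wpM2l; rewrite ?invr_ge0 //; apply: le_trans (rnormD _ _) _; apply: lerD.
    apply: le_trans (root_norm _ _) _; apply: ler_wpM2l => //.
    by have /andP[] := majorant_01 n.+1.
  apply: le_trans (h _) _; apply: ler_wpM2l; first by rewrite subr_ge0 majorant_le.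
  exact: root_norm.
have -> : majorant n.+2 = 2^-1 * (1 + majorant n.+1 ^+ 2) by [].
have : majorant n.+1 = 2^-1 * (1 + majorant n ^+ 2) by [].
move: (majorant n) (majorant n.+1) (rnorm x) => a b r ->; lra.
Qed.
End Contraction.
End SquareRoot.

Section SquareRootLimit.
Context {R : realType} {H : hilbertType R}.
Implicit Types (x y z : H) (S T Q : H -> H).

Lemma root_cauchy (X : H -> H) : linear X -> (forall x, rnorm (X x) <= rnorm x) ->
  forall n k x, rnorm (root_approx X (n + k) x - root_approx X n x) <=
    (majorant (n + k) - majorant n) * rnorm x.
Proof.
move=> lX X1 n; elim=> [|k h] x; first by rewrite addn0 !subrr rnorm0 mul0r.
rewrite addnS; apply: le_trans (rnormBD _ (root_approx X (n + k) x) _) _.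
apply: le_trans (lerD (root_step lX X1 _ _) (h _)) _.
by rewrite -mulrDl subrKA.
Qed.

(** The approximants commute with whatever commutes with [X], and so does their
    limit. *)
Lemma root_fixpoint (X : H -> H) : linear X -> symmetric_op X ->
  (forall x, rnorm (X x) <= rnorm x) ->
  exists Y : H -> H, [/\ linear Y, symmetric_op Y, forall x, rnorm (Y x) <= rnorm x,
    forall x, (2 : R)%:C *: Y x = X x + Y (Y x) &
    forall Q, bounded_op Q -> (forall x, Q (X x) = X (Q x)) -> forall x, Q (Y x) = Y (Q x)].
Proof.
move=> lX sX X1.
have /choice[Y hY] : forall x, exists y, (fun n => root_approx X n x) @ \oo --> y.
  move=> x; apply: hilbert_complete => e e0.
  have e1 : 0 < e / 2 / (rnorm x + 1) by rewrite !divr_gt0 // ltr_wpDl // rnorm_ge0.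
  have [N hN] := @majorant_cauchy R _ e1; exists N.
  have hb n : (N <= n)%N -> rnorm (root_approx X n x - root_approx X N x) < e / 2.
    move=> /subnKC <-; apply: le_lt_trans (root_cauchy lX X1 _ _ _) _.
    have := hN (n - N)%N; rewrite ltr_pdivlMr ?ltr_wpDl ?rnorm_ge0 //.
    apply: le_lt_trans; apply: ler_wpM2l; last by rewrite lerDl.
    by rewrite subr_ge0 majorant_mono.
  move=> n m /hb hn /hb hm; apply: le_lt_trans (rnormBD _ (root_approx X N x) _) _.
  by rewrite (rnormB (root_approx X N x)) [e]splitr ltrD.
have lY : linear Y.
  move=> c x y; apply: limH_unique (hY _) _.
  rewrite (_ : (fun _ => _) = fun n => c *: root_approx X n x + root_approx X n y).
    by apply: cvgD => //; apply: cvgZl_tmp.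
  by apply/funext => n; rewrite root_linear.
have Y1 x : rnorm (Y x) <= rnorm x.
  by apply: limit_le (cvg_rnorm (hY x)) _ => n; apply: root_norm1.
exists Y; split=> //.
- move=> x y; apply: limr_unique (cvg_rdot (hY x) (cvg_cst y)) _.
  rewrite (_ : (fun _ => _) = fun n => rdot x (root_approx X n y)).
    by apply: cvg_rdot (hY y); apply: cvg_cst.
  by apply/funext => n; rewrite root_sym.
- move=> x.
  have hS : (fun n => (2 : R)%:C *: root_approx X n.+1 x) @ \oo --> (2 : R)%:C *: Y x.
    apply: cvgZl_tmp; have := hY x; rewrite -(@cvg_shiftS _ _ (nbhs (Y x))); exact.
  apply: limH_unique hS _.
  rewrite (_ : (fun _ => _) = fun n => X x + root_approx X n (root_approx X n x)); last first.
    apply/funext => n /=; rewrite scalerA -rmorphM divff ?pnatr_eq0 //.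
    by rewrite scale1r.
  apply: cvgD; first exact: cvg_cst.
  apply: (@null_squeezeH _ _ _ (fun n => rnorm (root_approx X n x - Y x) +
    rnorm (root_approx X n (Y x) - Y (Y x)))) => [n|].
    apply: le_trans (rnormBD _ (root_approx X n (Y x)) _) _; rewrite lerD2r.
    by rewrite -(linB (root_linear n lX)) root_norm1.
  by rewrite -[0]addr0; apply: cvgD; apply: cvgr_rnormB.
- move=> Q bQ cQ x; apply: limH_unique (cvg_op bQ (hY x)) _.
  rewrite (_ : (fun _ => _) = fun n => root_approx X n (Q x)); first exact: hY.
  by apply/funext => n; rewrite root_comm //; case: bQ.
Qed.

(** After rescaling to [0 <= T <= M], the fixed point [Y] for [X = 1 - T / M] gives
    the root [sqrt M (1 - Y)]. *)
Lemma positive_sqrt T : positive_op T ->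
  exists S, [/\ positive_op S, S \o S = T &
    forall Q, bounded_op Q -> Q \o T = T \o Q -> Q \o S = S \o Q].
Proof.
move=> /positive_opP[bT sT pT]; have [K K0 hK] := bop_bound bT.
pose M := K + 1; have M0 : 0 < M by rewrite ltr_wpDl.
have TM x : rdot (T x) x <= M * rdot x x.
  apply: le_trans (ler_norm _) _; apply: le_trans (cauchy_schwarz _ _) _.
  rewrite -rnormE2 expr2 mulrA ler_wpM2r ?rnorm_ge0 //.
  by apply: le_trans (hK x) _; rewrite ler_wpM2r ?rnorm_ge0 // lerDl.
have [lT _] := bT.
pose X x := x - (M^-1)%:C *: T x.
have lX : linear X.
  move=> c x y; rewrite /X lT scalerDr opprD addrACA; congr (_ + _).
  by rewrite scalerBr !scalerA (mulrC c).
have sX : symmetric_op X by move=> x y; rewrite /X !rdotE sT.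
have pX x : 0 <= rdot (X x) x.
  by rewrite /X !rdotE subr_ge0 ler_pdivrMl.
have X1 x : rnorm (X x) <= rnorm x.
  rewrite -[leRHS]mul1r; apply: positive_norm_le => // y.
  by rewrite /X !rdotE mul1r lerBlDr lerDl mulr_ge0 // invr_ge0 ltW.
have [Y [lY sY Y1 eY cY]] := root_fixpoint lX sX X1.
pose s := Num.sqrt M; have s2 : s * s = M by rewrite -expr2 sqr_sqrtr // ltW.
have s0 : 0 <= s by apply: sqrtr_ge0.
pose S x := s%:C *: (x - Y x).
have pY x : 0 <= rdot (x - Y x) x.
  rewrite !rdotE subr_ge0; apply: le_trans (ler_norm _) _.
  apply: le_trans (cauchy_schwarz _ _) _; rewrite -rnormE2 expr2.
  by rewrite ler_wpM2r ?rnorm_ge0.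
exists S; split.
- apply/positive_opP; split=> [|x y|x].
  + apply/bounded_opP; split=> [c x y|].
      rewrite /S lY opprD addrACA scalerDr; congr (_ + _).
      have -> : c *: x - c *: Y x = c *: (x - Y x) by rewrite scalerBr.
      by rewrite !scalerA mulrC.
    exists (s * 2) => [|x]; first by rewrite mulr_ge0.
    rewrite rnormZ ger0_norm // -mulrA ler_wpM2l //.
    by apply: le_trans (rnormD _ _) _; rewrite rnormN; have := Y1 x; lra.
  + by rewrite /S !rdotE sY.
  + by rewrite rdotZl mulr_ge0.
- apply/funext => x /=; rewrite /S (linZ lY) -scalerBr (linB lY) scalerA -rmorphM s2.
  have -> : x - Y x - (Y x - Y (Y x)) = x - (2 : R)%:C *: Y x + Y (Y x).
    by rewrite (rmorphD (real_complex R)) /= scalerDl scale1r !opprD opprK !addrA.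
  rewrite eY opprD addrA subrK /X opprB addrC subrK scalerA -rmorphM mulfV ?gt_eqF //.
  by rewrite scale1r.
- move=> Q bQ cQ; apply/funext => x /=; have [lQ _] := bQ.
  rewrite /S (linZ lQ) (linB lQ) cY // => y; rewrite /X (linB lQ) (linZ lQ).
  by have /= -> := congr1 (fun f => f y) cQ.
Qed.

(** [1 + T] is bounded below by 1 and symmetric, so it is injective with closed
    and dense range. *)
Lemma positive_resolvent T : positive_op T ->
  exists G, [/\ bounded_op G, symmetric_op G, forall x, G x + T (G x) = x &
    forall Q, bounded_op Q -> Q \o T = T \o Q -> Q \o G = G \o Q].
Proof.
move=> /positive_opP[bT sT pT]; have [lT _] := bT.
pose K := range (fun x => x + T x).
have low x : rnorm x <= rnorm (x + T x).
  have [n0|n0] := eqVneq (rnorm x) 0; first by rewrite n0 rnorm_ge0.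
  have np : 0 < rnorm x by rewrite lt_neqAle eq_sym n0 rnorm_ge0.
  rewrite -(ler_pM2r np) -expr2 rnormE2; apply: le_trans (cauchy_schwarz _ _).
  by apply: le_trans (ler_norm _); rewrite rdotDl lerDl.
have inj x y : x + T x = y + T y -> x = y.
  move=> e; apply/eqP; rewrite -subr_eq0; apply/eqP/rnorm0_eq0.
  apply/eqP; rewrite eq_le rnorm_ge0 andbT; apply: le_trans (low _) _.
  by rewrite linB // addrACA -opprD e subrr rnorm0.
have cK : closed_subspace K.
  split; first split.
  - by exists 0 => //; rewrite lin0 // addr0.
  - move=> c _ _ [x _ <-] [y _ <-]; exists (c *: x + y) => //.
    by rewrite lT scalerDr addrACA.
  move=> y /closure_seq[u hu uy].
  have /choice[v hv] : forall n, exists x, x + T x = u n.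
    by move=> n; have [x _ <-] := hu n; exists x.
  have [x vx] : exists x, v @ \oo --> x.
    apply: hilbert_complete => e e0; have /cvgHP/(_ (e / 2))[|N hN] := uy.
      by rewrite divr_gt0.
    exists N => n m /hN hn /hN hm; apply: le_lt_trans (low _) _.
    rewrite linB // addrACA -opprD !hv; apply: le_lt_trans (rnormBD _ y _) _.
    by rewrite (rnormB y) [e]splitr ltrD.
  exists x => //; apply: limH_unique _ uy.
  rewrite (_ : u = fun n => v n + T (v n)); last by apply/funext => n; rewrite hv.
  by apply: cvgD => //; apply: cvg_op.
have surj y : exists x, x + T x = y.
  suff [x _ <-] : K y by exists x.
  apply: closed_subspace_total => // x hx; apply: rdot_eq0.
  have := hx (x + T x) (ex_intro2 _ _ x I erefl); rewrite rdotDr => h.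
  have := pT x; have := rdot_ge0 x; rewrite (rdotC (T x)) => h1 h2.
  by apply/eqP; rewrite eq_le h1 andbT; lra.
have /choice[G hG] := surj.
have G1 x : rnorm (G x) <= rnorm x by apply: le_trans (low _) _; rewrite hG.
have bG : bounded_op G.
  apply/bounded_opP; split.
    move=> c x y; apply: inj; rewrite hG lT addrACA -scalerDr !hG //.
  by exists 1 => // x; rewrite mul1r.
exists G; split=> // [x y|Q bQ cQ].
  by rewrite -{2}(hG x) -{1}(hG y) !rdotE sT.
apply/funext => x /=; apply: inj; have [lQ _] := bQ.
by rewrite hG; have /= <- := congr1 (fun f => f (G x)) cQ; rewrite -linD // hG.
Qed.
End SquareRootLimit.

(** * Uniform boundedness, strong closures, von Neumann algebras *)

Section UniformBoundedness.
Context {R : realType} {H : hilbertType R}.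
Implicit Types (x y z w : H) (T : nat -> H -> H).

(** A large value of [T] at a vector [h] forces a large value at [x + h] or at
    [x - h], since these differ by [2 h]. *)
Lemma large_value_near (T : H -> H) x (r K : R) z : linear T -> 0 < r -> K * rnorm z < rnorm (T z) ->
  exists2 y, rnorm (y - x) <= r & K * r <= rnorm (T y).
Proof.
move=> lT r0 hz; have z0 : rnorm z != 0.
  by apply/eqP => /rnorm0_eq0 h; move: hz; rewrite h lin0 // rnorm0 mulr0 ltxx.
have zp : 0 < rnorm z by rewrite lt_neqAle eq_sym z0 rnorm_ge0.
pose h := (r / rnorm z)%:C *: z.
have hr : rnorm h = r by rewrite rnormZ ger0_norm ?divr_ge0 ?rnorm_ge0 ?ltW // divfK.
have Th : K * r <= rnorm (T h).
  rewrite (linZ lT) rnormZ ger0_norm ?divr_ge0 ?rnorm_ge0 ?(ltW r0) //.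
  by rewrite mulrAC ler_pdivlMr // (mulrC K) -mulrA ler_wpM2l // ltW.
have [hp|hp] := leP (K * r) (rnorm (T (x + h))).
  by exists (x + h) => //; rewrite addrC addKr hr.
exists (x - h); first by rewrite addrC addKr rnormN hr.
have := rnormD (T (x + h)) (- T (x - h)); rewrite rnormN -(linB lT).
rewrite opprB addrC addrA subrK (linD lT h h).
have -> : T h + T h = (2 : R)%:C *: T h by rewrite (rmorphD (real_complex R)) /= scalerDl scale1r.
by rewrite rnormZ ger0_norm //; lra.
Qed.

(** If no uniform bound exists, nested balls can be chosen on the k-th of which
    some [T n] is at least [k]; their common point contradicts pointwise
    boundedness. *)
Lemma uniform_boundedness T : (forall n, bounded_op (T n)) ->
  (forall x, exists M, forall n, rnorm (T n x) <= M) ->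
  exists2 K, 0 <= K & forall n x, rnorm (T n x) <= K * rnorm x.
Proof.
move=> bT pT; apply: contrapT => nK.
have unb (K : R) : 0 <= K -> exists n z, K * rnorm z < rnorm (T n z).
  move=> K0; apply: contrapT => h; apply: nK; exists K => // n x.
  by rewrite leNgt; apply/negP => h'; apply: h; exists n, x.
have step (kp : nat * (H * R)) : exists q : H * R, 0 < kp.2.2 ->
    [/\ 0 < q.2, q.2 <= kp.2.2 / 2, rnorm (q.1 - kp.2.1) <= kp.2.2 / 2 &
        exists n, forall w, rnorm (w - q.1) <= q.2 -> kp.1%:R <= rnorm (T n w)].
  case: kp => k [x r] /=; have [r0|r0] := ltP 0 r; last by exists (0, 0).
  have [|n [z hz]] := unb ((k%:R + 1) / (r / 2)).
    by rewrite divr_ge0 ?addr_ge0 // divr_ge0 // ltW.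
  have [lT _] := bT n; have r2 : 0 < r / 2 by rewrite divr_gt0.
  have [y yx] := large_value_near x lT r2 hz; rewrite divfK ?gt_eqF // => hy.
  have [K K0 hK] := bop_bound (bT n).
  have K1 : 0 < K + 1 by rewrite ltr_wpDl.
  exists (y, Num.min (r / 2) (K + 1)^-1) => _ /=; split=> //.
  - by rewrite lt_min r2 invr_gt0.
  - by rewrite ge_min lexx.
  exists n => w; rewrite le_min => /andP[_ hw].
  have := rnormD (T n w) (T n (y - w)); rewrite -(linD lT) [w + _]addrC subrK.
  have := hK (y - w); rewrite (rnormB y) => h1 h2.
  have h3 : K * rnorm (w - y) <= 1.
    apply: le_trans (_ : (K + 1) * (K + 1)^-1 <= 1); last by rewrite mulfV // gt_eqF.
    by apply: ler_pM => //; rewrite ?rnorm_ge0 ?lerDl.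
  lra.
have /choice[f hf] := step.
pose p := fix p k := if k is j.+1 then f (j, p j) else (0 : H, 1 : R).
have p0 k : 0 < (p k).2.
  by elim: k => [|k h] //=; have [] := hf (k, p k) h.
have pr k : (p k.+1).2 <= (p k).2 / 2 by have [] := hf (k, p k) (p0 k).
have px k : rnorm ((p k.+1).1 - (p k).1) <= (p k).2 / 2 by have [] := hf (k, p k) (p0 k).
have pd k m : rnorm ((p (k + m)%N).1 - (p k).1) <= (p k).2 - (p (k + m)%N).2.
  elim: m => [|m h]; first by rewrite addn0 !subrr rnorm0.
  rewrite addnS; apply: le_trans (rnormBD _ (p (k + m)%N).1 _) _.
  by move: (px (k + m)%N) (pr (k + m)%N) h; lra.
have pS k : (p k).2 <= k.+1%:R^-1.
  elim: k => [|k h]; first by rewrite invr1.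
  apply: le_trans (pr k) _; rewrite ler_pdivrMr //; apply: le_trans h _.
  rewrite mulrC ler_pdivlMr // mulrC ler_pdivrMr // -natrM ler_nat mul2n -addnn.
  by rewrite !addSn !addnS !ltnS leq_addl.
have [w hw] : exists w, (fun k => (p k).1) @ \oo --> w.
  apply: hilbert_complete => e e0; have [|N hN] := @harmonic_lt R (e / 2).
    by rewrite divr_gt0.
  have hb n : (N <= n)%N -> rnorm ((p n).1 - (p N).1) < e / 2.
    move=> /subnKC <-; apply: le_lt_trans (pd _ _) _.
    apply: le_lt_trans (hN N (leqnn N)); apply: le_trans (pS N).
    by rewrite lerBlDr lerDl ltW.
  exists N => n m /hb hn /hb hm; apply: le_lt_trans (rnormBD _ (p N).1 _) _.
  by rewrite (rnormB (p N).1) [e]splitr ltrD.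
have wp k : rnorm (w - (p k).1) <= (p k).2.
  have h : (fun m => (p (m + k)%N).1 - (p k).1) @ \oo --> w - (p k).1.
    by apply: cvgB; [move: hw; rewrite -(cvg_shiftn k)|apply: cvg_cst].
  apply: (limit_le (cvg_rnorm h)) => m.
  rewrite addnC; apply: le_trans (pd k m) _.
  by rewrite lerBlDr lerDl ltW.
have [M hM] := pT w.
have M0 : 0 <= M by apply: le_trans (hM 0%N); apply: rnorm_ge0.
have [k hk] : exists k : nat, M < k%:R by exists (Num.bound M); rewrite archi_boundP.
have [_ _ _ [n hn]] := hf (k, p k) (p0 k).
by have := hn w (wp k.+1); have := hM n => /= h1 /(lt_le_trans hk); rewrite ltNge h1.
Qed.
End UniformBoundedness.

Section StrongClosure.
Context {R : realType} {H : hilbertType R}.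
Implicit Types (x y z : H) (S T : H -> H) (M : set (H -> H)).

(** The topology of pointwise convergence has the sets of functions close to [T]
    at finitely many points as a base of neighbourhoods. *)
Lemma sot_closureP M T : sot_closure M T <-> bounded_op T /\
  forall (s : seq H) (e : R), 0 < e ->
    exists2 S, M S & forall x, x \in s -> rnorm (S x - T x) < e.
Proof.
split=> [[bT cT]|[bT h]].
  split=> // s e e0.
  have [|S [MS hS]] := cT [set S | forall x, x \in s -> rnorm (S x - T x) < e].
    elim: s => [|a s IH]; first by apply: filterE.
    have ha : nbhs (T : {ptws H -> H}) [set S | rnorm (S a - T a) < e].
      have /pointwise_cvgP/(_ a) : {ptws, nbhs (T : {ptws H -> H}) --> T} by [].
      move=> /(_ [set y | rnorm (y - T a) < e]); apply.
      by apply/nbhsHP; exists e.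
    apply: (@filterS _ (nbhs (T : {ptws H -> H})) _ _ _ _
      (@filterI _ (nbhs (T : {ptws H -> H})) _ _ _ ha IH)).
    by move=> S [h1 h2] x; rewrite in_cons => /orP[/eqP ->|/h2].
  by exists S.
split=> // B nB.
(* The filter generated by the finite approximations of T from M. *)
pose F : set_system {ptws H -> H} := fun A => exists (s : seq H) (e : R), 0 < e /\
   [set S | M S /\ forall x, x \in s -> rnorm (S x - T x) < e] `<=` A.
have FF : Filter F.
  split.
  - by exists [::], 1; split.
  - move=> P Q [s [e [e0 hP]]] [s' [e' [e'0 hQ]]].
    exists (s ++ s'), (Num.min e e'); split; first by rewrite lt_min e0.
    move=> S [MS hS]; split; [apply: hP|apply: hQ]; split=> // x xs.
      by have := hS x; rewrite mem_cat xs lt_min => /(_ isT)/andP[].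
    by have := hS x; rewrite mem_cat xs orbT lt_min => /(_ isT)/andP[].
  - by move=> P Q PQ [s [e [e0 hP]]]; exists s, e; split=> // S /hP /PQ.
have : {ptws, F --> T}.
  apply/pointwise_cvgP => x A /nbhsHP[e e0 eA]; exists [:: x], e; split=> // S [_ hS].
  by apply: eA; apply: hS; rewrite mem_seq1.
move=> /(_ B nB)[s [e [e0 hB]]].
have [S MS hS] := h s e e0; exists S; split=> //; exact: hB.
Qed.
End StrongClosure.

Section VonNeumann.
Context {R : realType} {H : hilbertType R}.
Implicit Types (x y z : H) (S T Q : H -> H) (M : set (H -> H)).

Lemma commutantE M T Q x : commutant M T -> M Q -> T (Q x) = Q (T x).
Proof. by move=> [_ h] /h e; exact: (congr1 (fun f => f x) e). Qed.

Lemma commutant_intro M T : bounded_op T -> (forall Q x, M Q -> T (Q x) = Q (T x)) ->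
  commutant M T.
Proof. by move=> bT h; split=> // Q MQ; apply/funext => x /=; apply: h. Qed.

Lemma commutant_bounded M T : commutant M T -> bounded_op T.
Proof. by case. Qed.

Variable M : set (H -> H).
Hypothesis vM : von_neumann M.

Lemma vn_bounded T : M T -> bounded_op T.
Proof. by case: vM => h _ _ /h. Qed.

Lemma vn_adjoint T : M T -> M (adjoint T).
Proof. by case: vM => _ h _ /h. Qed.

Lemma vn_intro T : bounded_op T ->
  (forall Q x, commutant M Q -> T (Q x) = Q (T x)) -> M T.
Proof.
move=> bT h; have [_ _ <-] := vM.
exact: commutant_intro.
Qed.

Lemma vn_comm T Q x : M T -> commutant M Q -> T (Q x) = Q (T x).
Proof. by move=> MT cQ; rewrite (commutantE x cQ MT). Qed.

Lemma vn_id : M idfun.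
Proof. by apply: vn_intro => //; apply: bounded_id. Qed.

Lemma vn_comp S T : M S -> M T -> M (S \o T).
Proof.
move=> MS MT; apply: vn_intro => [|Q x cQ /=].
  by apply: bounded_comp; apply: vn_bounded.
by rewrite (vn_comm _ MT) // (vn_comm _ MS).
Qed.

Lemma vn_lin (c : R[i]) S T : M S -> M T -> M (fun x => c *: S x + T x).
Proof.
move=> MS MT; apply: vn_intro => [|Q x cQ /=].
  by apply: bounded_lin; apply: vn_bounded.
have [lQ _] := commutant_bounded cQ.
by rewrite lQ (vn_comm _ MT) // (vn_comm _ MS).
Qed.

Lemma vn_commutant_adjoint Q : commutant M Q -> commutant M (adjoint Q).
Proof.
move=> cQ; have bQ := commutant_bounded cQ; apply: commutant_intro.
  exact: adjoint_bounded.
move=> S x MS; have bS := vn_bounded MS; apply: rdot_inj => z.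
have MS' := vn_adjoint MS.
rewrite rdotC -(adjP _ _ bQ) (adjPl _ _ bS) [RHS]rdotC (adjPl _ _ bS) -(adjP _ _ bQ).
by rewrite (commutantE _ cQ MS').
Qed.

Lemma vn_sub S T : M S -> M T -> M (S \- T).
Proof.
move=> MS MT; rewrite (_ : S \- T = fun x => (-1) *: T x + S x); first exact: vn_lin.
by apply/funext => x; rewrite scaleN1r addrC.
Qed.
End VonNeumann.

(** * GNS projections and conditional expectations *)

Section GnsSubspace.
Context {R : realType} {H : hilbertType R}.
Implicit Types (x y z : H) (S T Q : H -> H) (M : set (H -> H)).

Lemma bop_eq_closure S T (D : set H) : bounded_op S -> bounded_op T ->
  (forall x, D x -> S x = T x) -> forall x, closure D x -> S x = T x.
Proof.
move=> bS bT h x /closure_seq[u Du ux].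
apply: limH_unique (cvg_op bS ux) _.
rewrite (_ : (fun _ => _) = fun n => T (u n)); first exact: cvg_op.
by apply/funext => n; rewrite h.
Qed.

Lemma rdot_eq_closure x y (D : set H) : (forall z, D z -> rdot x z = rdot y z) ->
  forall z, closure D z -> rdot x z = rdot y z.
Proof.
move=> h z /closure_seq[u Du uz].
apply: limr_unique (cvg_rdot (cvg_cst x) uz) _.
rewrite (_ : (fun _ => _) = fun n => rdot y (u n)).
  by apply: cvg_rdot => //; apply: cvg_cst.
by apply/funext => n; rewrite h.
Qed.

Variables (M : set (H -> H)) (Omega : H).
Hypothesis vM : von_neumann M.

Lemma gns_mem T : M T -> gns_subspace Omega M (T Omega).
Proof. by move=> MT; apply: subset_closure; exists T. Qed.

Lemma gns_Omega : gns_subspace Omega M Omega.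
Proof. exact: (gns_mem (vn_id vM)). Qed.

Lemma gns_closed : closed_subspace (gns_subspace Omega M).
Proof.
apply: closure_subspace; split.
  exists (idfun \- idfun); first by apply: vn_sub => //; apply: vn_id.
  by rewrite /= subrr.
move=> c _ _ [S MS <-] [T MT <-].
by exists (fun x => c *: S x + T x) => //; apply: vn_lin.
Qed.

Lemma gns_invariant T x : M T -> gns_subspace Omega M x -> gns_subspace Omega M (T x).
Proof.
move=> MT /closure_seq[u hu ux]; apply/closure_seq; exists (fun n => T (u n)).
  move=> n; have [S MS <-] := hu n; exists (T \o S) => //; exact: vn_comp.
by apply: cvg_op => //; apply: vn_bounded MT.
Qed.

Lemma ebar_in x : gns_subspace Omega M (ebar Omega M x).
Proof. exact: oproj_in gns_closed. Qed.

Lemma ebar_bounded : bounded_op (ebar Omega M).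
Proof. exact: oproj_bounded gns_closed. Qed.

Lemma ebar_id x : gns_subspace Omega M x -> ebar Omega M x = x.
Proof. exact: oproj_id gns_closed. Qed.

Lemma ebar_idem x : ebar Omega M (ebar Omega M x) = ebar Omega M x.
Proof. by rewrite ebar_id //; apply: ebar_in. Qed.

Lemma ebar_sym : symmetric_op (ebar Omega M).
Proof. by move=> x y; apply: oproj_sym gns_closed. Qed.

Lemma ebar_Omega : ebar Omega M Omega = Omega.
Proof. exact: ebar_id gns_Omega. Qed.

Lemma ebar_comm T x : M T -> ebar Omega M (T x) = T (ebar Omega M x).
Proof.
move=> MT; have bT := vn_bounded vM MT; apply: oproj_unique.
- exact: gns_closed.
- by apply: gns_invariant => //; apply: ebar_in.
move=> z Kz; rewrite (adjP _ _ bT) (adjP _ _ bT) ebar_sym ebar_id //.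
by apply: gns_invariant => //; apply: vn_adjoint.
Qed.

End GnsSubspace.

Section Expectation.
Context {R : realType} {H : hilbertType R}.
Variables (A : set (H -> H)) (psi : (H -> H) -> R[i]) (Omega : H).
Hypotheses (hA : probability_space A psi) (hOmega : is_gns A psi Omega).
Implicit Types (x y z : H) (a b : H -> H) (B : set (H -> H)) (E : (H -> H) -> H -> H).

Lemma algebra_vn : von_neumann A.
Proof. by case: hA. Qed.

Lemma stateE a : A a -> complex.Re (psi a) = rdot (a Omega) Omega.
Proof. by move=> Aa; case: hOmega => -> . Qed.

Lemma adj_comp_positive a : bounded_op a -> positive_op (adjoint a \o a).
Proof.
move=> ba; have bs := adjoint_bounded ba; apply/positive_opP; split.
- exact: bounded_comp.
- by move=> x y /=; rewrite -(adjPl _ _ ba) -(adjP _ _ ba).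
by move=> x /=; rewrite -(adjPl _ _ ba) rdot_ge0.
Qed.

(** Apply faithfulness to [a^* a], whose state is the squared norm of [a Omega]. *)
Lemma separating a : A a -> a Omega = 0 -> forall x, a x = 0.
Proof.
move=> Aa aO; have vA := algebra_vn; have ba := vn_bounded vA Aa.
case: hA => _ _ [_ _ _ faithful].
have Ap : A (adjoint a \o a) by apply: vn_comp => //; apply: vn_adjoint.
have : adjoint a \o a = fun=> 0.
  apply: faithful => //; first exact: adj_comp_positive.
  case: hOmega => -> // _; rewrite /= aO.
  by rewrite bop0 ?linear0l //; apply: adjoint_bounded.
move=> h x; apply: rdot_eq0.
by rewrite (adjP _ _ ba); have /= -> := congr1 (fun f => f x) h; rewrite rdot0r.
Qed.

Lemma separating_eq a b : A a -> A b -> a Omega = b Omega -> a = b.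
Proof.
move=> Aa Ab e; apply/funext => x; apply/eqP; rewrite -subr_eq0; apply/eqP.
apply: (@separating (a \- b)); last by rewrite /= e subrr.
by apply: vn_sub => //; apply: algebra_vn.
Qed.

Section OneExpectation.
Variables (B : set (H -> H)) (E : (H -> H) -> H -> H).
Hypothesis hB : expected_subalgebra A psi B E.

Lemma sub_vn : von_neumann B.
Proof. by case: hB. Qed.

Lemma sub_incl b : B b -> A b.
Proof. by case: hB => _ h _; apply: h. Qed.

Lemma expect_range a : A a -> B (E a).
Proof. by case: hB => _ _ /ce_range; apply. Qed.

Lemma expect_modl b a : B b -> A a -> E (b \o a) = b \o E a.
Proof.
move=> Bb Aa; case: hB => _ _ /ce_module /(_ b a idfun Bb Aa); apply.
exact: vn_id sub_vn.
Qed.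

Lemma expect_modr b a : B b -> A a -> E (a \o b) = E a \o b.
Proof.
move=> Bb Aa; case: hB => _ _ /ce_module /(_ idfun a b _ Aa Bb); apply.
exact: vn_id sub_vn.
Qed.

Lemma expect_state a : A a -> psi (E a) = psi a.
Proof. by case: hB => _ _ /ce_preserves; apply. Qed.

(** A state-preserving expectation is, on the GNS vectors, the orthogonal
    projection: pairing with [b Omega] turns into the state of [b^* a]. *)
Lemma expect_Omega a : A a -> E a Omega = ebar Omega B (a Omega).
Proof.
move=> Aa; apply/esym/oproj_unique; first exact: gns_closed sub_vn.
  by apply: gns_mem; apply: expect_range.
apply: rdot_eq_closure => _ [b Bb <-].
have bb := vn_bounded sub_vn Bb; have Bs := vn_adjoint sub_vn Bb.
rewrite !(adjPl _ _ bb).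
have ABs := sub_incl Bs.
have Aba : A (adjoint b \o a) by apply: vn_comp => //; apply: algebra_vn.
rewrite -(stateE Aba) -(expect_state Aba) expect_modl // stateE //.
by apply: sub_incl; apply: vn_comp sub_vn _ _ _ _ => //; apply: expect_range.
Qed.

Lemma expect_gns a x : A a -> gns_subspace Omega B x -> E a x = ebar Omega B (a x).
Proof.
move=> Aa; have vB := sub_vn; have Ba := expect_range Aa.
apply: (@bop_eq_closure _ _ (E a) (ebar Omega B \o a)).
- exact: vn_bounded Ba.
- by apply: bounded_comp; [apply: ebar_bounded|apply: vn_bounded algebra_vn _ Aa].
move=> _ [b Bb <-]; have Aab : A (a \o b).
  by apply: vn_comp algebra_vn _ _ Aa _; apply: sub_incl.
by have := expect_Omega Aab; rewrite expect_modr.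
Qed.

Lemma expect_ebar a x : A a -> E a (ebar Omega B x) = ebar Omega B (a (ebar Omega B x)).
Proof. by move=> Aa; apply: expect_gns => //; exact: (ebar_in sub_vn). Qed.
End OneExpectation.
End Expectation.

(** * Vector states of the small algebra come from its own GNS space *)

Section Transfer.
Context {R : realType} {H : hilbertType R}.
Variables (A A0 : set (H -> H)) (psi : (H -> H) -> R[i]) (Omega : H)
  (E0 : (H -> H) -> (H -> H)).
Hypotheses (hA : probability_space A psi) (hOmega : is_gns A psi Omega)
  (hA0 : expected_subalgebra A psi A0 E0).
Implicit Types (x y z : H) (a b : H -> H).

Let e0 := ebar Omega A0.
Let H0 := gns_subspace Omega A0.
Let vA0 : von_neumann A0 := sub_vn hA0.

Lemma commutant_vn : von_neumann (commutant A0).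
Proof.
split=> [T /commutant_bounded //|T|]; first exact: vn_commutant_adjoint.
by have [_ _ ->] := vA0.
Qed.

(** The projection onto the closure of [A0' Omega] lies in [A0] and fixes
    [Omega], which separates [A0]; hence it is the identity. *)
Lemma commutant_cyclic x : closure [set b Omega | b in commutant A0] x.
Proof.
have vC := commutant_vn; rewrite -/(gns_subspace Omega (commutant A0)).
have Ap : A0 (ebar Omega (commutant A0)).
  apply: vn_intro => // [|Q y cQ]; first exact: ebar_bounded.
  exact: ebar_comm.
suff -> : x = ebar Omega (commutant A0) x by apply: ebar_in.
have Ai : A idfun := vn_id (algebra_vn hA).
have -> // : ebar Omega (commutant A0) = idfun.
apply: (separating_eq hA hOmega) => //; first exact: (sub_incl hA0).
exact: ebar_Omega.
Qed.

Definition compression b := e0 \o (adjoint b \o (b \o e0)).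

Let e0b : bounded_op e0 := ebar_bounded Omega vA0.

Lemma compression_sqrt b : commutant A0 b -> exists S,
  [/\ positive_op S, forall x, S (S x) = e0 (adjoint b (b (e0 x))) &
      forall Q, bounded_op Q -> (forall x, Q (compression b x) = compression b (Q x)) ->
        forall x, Q (S x) = S (Q x)].
Proof.
move=> cb; have bb := commutant_bounded cb; have bs := adjoint_bounded bb.
have pc : positive_op (compression b).
  apply/positive_opP; split.
  - by apply: bounded_comp e0b _; apply: bounded_comp bs _; apply: bounded_comp.
  - move=> x y; rewrite /compression /= (ebar_sym Omega vA0) -(adjPl _ _ bb).
    by rewrite -[in RHS](ebar_sym Omega vA0) -[in RHS](adjP _ _ bb).
  by move=> x; rewrite /compression /= (ebar_sym Omega vA0) -(adjPl _ _ bb) rdot_ge0.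
have [S [pS SS cS]] := positive_sqrt pc; exists S; split=> //.
  by move=> x; exact: (congr1 (fun f => f x) SS).
move=> Q bQ cQ x; have cQ' : Q \o compression b = compression b \o Q by exact/funext.
exact: (congr1 (fun f => f x) (cS Q bQ cQ')).
Qed.

Lemma alg_compression a b x : A0 a -> commutant A0 b ->
  a (compression b x) = compression b (a x).
Proof.
move=> Aa cb; have cbs := vn_commutant_adjoint vA0 cb; rewrite /compression /=.
rewrite -(ebar_comm Omega vA0 _ Aa) (vn_comm _ Aa cbs) (vn_comm _ Aa cb).
by rewrite /e0 (ebar_comm Omega vA0 _ Aa).
Qed.

(** Every vector state of [A0] is approximated by vector states coming from
    [H0]: near [x] there is [b Omega] with [b] in the commutant, and the square
    root [S] of [e0 b^* b e0], which commutes with [A0], moves it to [S Omega]. *)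
Lemma transfer x (e : R) : 0 < e -> exists y z, [/\ rnorm (y - x) < e, H0 z &
  forall a, A0 a -> rdot (a y) y = rdot (a z) z].
Proof.
move=> epos; have /closureP/(_ e epos) := @commutant_cyclic x.
move=> [_ [b cb <-] bx]; have bb := commutant_bounded cb.
have [S [/positive_opP[bS sS _] SS cS]] := compression_sqrt cb.
exists (b Omega), (S Omega); split=> //.
  suff -> : S Omega = e0 (S Omega) by apply: ebar_in.
  rewrite (cS e0 e0b) ?[e0 Omega](ebar_Omega Omega vA0) // => y.
  by rewrite /compression /= /e0 !(ebar_idem _ vA0).
move=> a Aa; have ba := vn_bounded vA0 Aa.
rewrite (cS a ba); last by move=> y; apply: alg_compression.
rewrite -sS SS /e0 (ebar_sym Omega vA0) (ebar_Omega Omega vA0) -(adjPl _ _ bb).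
by rewrite (ebar_comm Omega vA0 _ Aa) (ebar_Omega Omega vA0) (vn_comm _ Aa cb).
Qed.

Lemma transfer_ge0 a : A0 a -> (forall x, H0 x -> 0 <= rdot (a x) x) ->
  forall x, 0 <= rdot (a x) x.
Proof.
move=> Aa h x; have ba := vn_bounded vA0 Aa.
have /choice[y hy] : forall n, exists y, rnorm (y - x) < n.+1%:R^-1 /\ 0 <= rdot (a y) y.
  move=> n; have [|y [z [yx Hz e]]] := @transfer x n.+1%:R^-1; first by rewrite invr_gt0.
  by exists y; rewrite e //; split=> //; apply: h.
have yx : y @ \oo --> x.
  apply/cvgHP => e /harmonic_lt[N hN]; exists N => n Nn.
  by have [hn _] := hy n; apply: lt_trans hn (hN n Nn).
rewrite -oppr_le0; apply: limit_le (cvgN (cvg_rdot (cvg_op ba yx) yx)) _ => n.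
by rewrite oppr_le0; have [] := hy n.
Qed.

Lemma transfer_mono a b : A0 a -> A0 b ->
  (forall x, H0 x -> rdot (a x) x <= rdot (b x) x) -> forall x, rdot (a x) x <= rdot (b x) x.
Proof.
move=> Aa Ab h x; have key y : rdot ((b \- a) y) y = rdot (b y) y - rdot (a y) y.
  by rewrite /= !rdotE.
rewrite -subr_ge0 -key; apply: transfer_ge0; first exact: vn_sub.
by move=> y Hy; rewrite key subr_ge0; apply: h.
Qed.

Lemma transfer_le a (M : R) : A0 a -> (forall x, H0 x -> rdot (a x) x <= M * rdot x x) ->
  forall x, rdot (a x) x <= M * rdot x x.
Proof.
move=> Aa h x.
pose b z := (M - 1)%:C *: idfun z + idfun z.
have Ab : A0 b by apply: vn_lin => //; apply: vn_id.
have key y : rdot (b y) y = M * rdot y y by rewrite /b !rdotE; ring.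
by rewrite -key; apply: (transfer_mono Aa Ab) => y Hy; rewrite key; apply: h.
Qed.

End Transfer.

(** * Operators on the small GNS space commuting with compressions *)

Section Reduction.
Context {R : realType} {H : hilbertType R}.
Variables (A A0 : set (H -> H)) (psi : (H -> H) -> R[i]) (Omega : H)
  (E0 : (H -> H) -> (H -> H)).
Hypotheses (hA : probability_space A psi) (hOmega : is_gns A psi Omega)
  (hA0 : expected_subalgebra A psi A0 E0).
Implicit Types (x y z : H) (a b : H -> H).

Let e0 := ebar Omega A0.
Let vA0 : von_neumann A0 := sub_vn hA0.
Let vC : von_neumann (commutant A0) := commutant_vn hA0.

(** With [S] the square root of the compression of [b], which commutes with [T]:
    [|b T Omega| = |S T Omega| = |T S Omega| <= K |S Omega| = K |b Omega|]. *)
Lemma amplification_bound (T : H -> H) (K : R) b : bounded_op T -> 0 <= K ->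
  (forall x, rnorm (T x) <= K * rnorm x) -> (forall x, e0 (T x) = T x) ->
  (forall b x, commutant A0 b -> T (e0 (b (e0 x))) = e0 (b (e0 (T x)))) ->
  commutant A0 b -> rnorm (b (T Omega)) <= K * rnorm (b Omega).
Proof.
move=> bT K0 hK eT cT cb; have bb := commutant_bounded cb.
have cbb : commutant A0 (adjoint b \o b).
  by apply: (vn_comp vC) => //; apply: (vn_commutant_adjoint vA0).
have [S [/positive_opP[bS sS _] SS cS]] := compression_sqrt Omega hA0 cb.
have nS x : rdot (S x) (S x) = rdot (b (e0 x)) (b (e0 x)).
  by rewrite -sS SS (ebar_sym Omega vA0) -(adjPl _ _ bb).
have TS : T (S Omega) = S (T Omega).
  by apply: cS => // x; exact: (cT _ x cbb).
apply: rnorm_le; first by rewrite mulr_ge0 ?rnorm_ge0.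
rewrite -(eT Omega) -nS -TS exprMn -rnormE2.
have -> : rnorm (b Omega) ^+ 2 = rnorm (S Omega) ^+ 2.
  by rewrite !rnormE2 nS [e0 Omega](ebar_Omega Omega vA0).
by rewrite -exprMn ler_pXn2r ?nnegrE ?mulr_ge0 ?rnorm_ge0.
Qed.

(** Put [a (b Omega) := b (T Omega)] for [b] in the commutant of [A0]. This is
    well defined and bounded by [amplification_bound], and it commutes with the
    commutant, so it lies in [A0]. On [H0] it agrees with [T] because [T] commutes with [e0 b e0]. *)
Lemma reduction (T : H -> H) : bounded_op T ->
  (forall x, T (e0 x) = T x) -> (forall x, e0 (T x) = T x) ->
  (forall b x, commutant A0 b -> T (e0 (b (e0 x))) = e0 (b (e0 (T x)))) ->
  exists2 a, A0 a & a \o e0 = T.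
Proof.
move=> bT Te eT cT; have [K K0 hK] := bop_bound bT.
have bound b := @amplification_bound T K b bT K0 hK eT cT.
(* G is the closure of the graph of b Omega |-> b T Omega. *)
pose G x y := exists b : nat -> H -> H, [/\ forall n, commutant A0 (b n),
  (fun n => b n Omega) @ \oo --> x & (fun n => b n (T Omega)) @ \oo --> y].
have GB x y : G x y -> rnorm y <= K * rnorm x.
  move=> [b [cb bx by_]]; rewrite -subr_le0.
  have h : (fun n => rnorm (b n (T Omega)) - K * rnorm (b n Omega)) @ \oo -->
      rnorm y - K * rnorm x.
    apply: cvgB; first exact: cvg_rnorm.
    by apply: cvgMl_tmp; apply: cvg_rnorm.
  by apply: (limit_le h) => n; rewrite subr_le0; apply: bound.
have GL (c : R[i]) x y x' y' : G x y -> G x' y' -> G (c *: x + x') (c *: y + y').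
  move=> [b [cb bx by_]] [b' [cb' bx' by']].
  exists (fun n x => c *: b n x + b' n x); split.
  - by move=> n; apply: vn_lin.
  - by apply: cvgD => //; apply: cvgZl_tmp.
  - by apply: cvgD => //; apply: cvgZl_tmp.
have GU x y y' : G x y -> G x y' -> y = y'.
  move=> g g'; have /GB := GL (-1) _ _ _ _ g g'.
  rewrite !scaleN1r addNr rnorm0 mulr0 => h; apply/esym/eqP.
  rewrite -subr_eq0 addrC; apply/eqP/rnorm0_eq0/eqP.
  by rewrite eq_le h rnorm_ge0.
have Gex x : exists y, G x y.
  have /closure_seq[u hu ux] := @commutant_cyclic _ _ _ _ _ _ _ hA hOmega hA0 x.
  have /choice[b hb] : forall n, exists b, commutant A0 b /\ b Omega = u n.
    by move=> n; have [b cb e] := hu n; exists b.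
  have cb n : commutant A0 (b n) by have [] := hb n.
  have bu n : b n Omega = u n by have [] := hb n.
  have [y hy] : exists y, (fun n => b n (T Omega)) @ \oo --> y.
    apply: hilbert_complete => e e0'; have K1 : 0 < K + 1 by rewrite ltr_wpDl.
    have /cvgHP/(_ (e / 2 / (K + 1)))[|N hN] := ux; first by rewrite !divr_gt0.
    exists N => n m /hN hn /hN hm.
    have cnm : commutant A0 (b n \- b m) by apply: vn_sub.
    apply: le_lt_trans (bound _ cnm) _; rewrite /= !bu.
    apply: (@le_lt_trans _ _ ((K + 1) * rnorm (u n - u m))).
      by rewrite ler_wpM2r ?rnorm_ge0 // lerDl.
    rewrite mulrC -ltr_pdivlMr //; apply: le_lt_trans (rnormBD _ x _) _.
    by rewrite (rnormB x) [ltRHS](_ : _ = e / 2 / (K + 1) + e / 2 / (K + 1)) ?ltrD // -mulrDl -splitr.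
  exists y, b; split=> //.
  by rewrite (_ : (fun _ => _) = u) //; apply/funext.
have /choice[a ha] := Gex.
have ba : bounded_op a.
  apply/bounded_opP; split; last by exists K => // x; apply: GB.
  by move=> c x y; apply: (GU (c *: x + y)) => //; apply: GL.
have Aa : A0 a.
  apply: vn_intro => // Q x cQ; apply: (GU (Q x)) => //.
  have [b [cb bx by_]] := ha x; have bQ := commutant_bounded cQ.
  exists (fun n => Q \o b n); split.
  - by move=> n; apply: vn_comp.
  - exact: (cvg_op bQ bx).
  - exact: (cvg_op bQ by_).
exists a => //; apply/funext => x /=.
have bE := ebar_bounded Omega vA0.
have [b [cb bx by_]] := ha (e0 x).
have -> : a (e0 x) = e0 (a (e0 x)).
  by rewrite /e0 (ebar_comm Omega vA0 _ Aa) (ebar_idem Omega vA0).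
apply: limH_unique (cvg_op bE by_) _.
rewrite (_ : (fun _ => _) = fun n => T (b n Omega)).
  by rewrite -(Te x); apply: (cvg_op bT bx).
apply/funext => n; rewrite -(Te (b n Omega)) -{1}(eT Omega).
by have := cT _ Omega (cb n); rewrite [e0 Omega](ebar_Omega Omega vA0).
Qed.
End Reduction.

(** * The Hilbert module and its inner product *)

Section Module.
Context {R : realType} {H : hilbertType R}.
Variables (A0 : set (H -> H)) (Omega : H).
Hypothesis vA0 : von_neumann A0.
Implicit Types (v w z : H) (b c x y : H -> H) (B C D : set (H -> H)).

Let e0 := ebar Omega A0.
Let e0b : bounded_op e0 := ebar_bounded Omega vA0.
Local Notation E_ := (hmod A0 Omega).

Lemma hmod_bounded B x : E_ B x -> bounded_op x.
Proof. by case. Qed.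

Lemma hmod_intro B x : bounded_op x ->
  (forall (s : seq H) (e : R), 0 < e ->
    exists2 b, B b & forall v, v \in s -> rnorm (b (e0 v) - x v) < e) -> E_ B x.
Proof.
move=> bx h; apply/sot_closureP; split=> // s e /(h s)[b Bb hb].
by exists (b \o e0) => //; exists b.
Qed.

Lemma hmod_approx B x : E_ B x -> forall (s : seq H) (e : R), 0 < e ->
  exists2 b, B b & forall v, v \in s -> rnorm (b (e0 v) - x v) < e.
Proof.
move=> /sot_closureP[_ h] s e /(h s)[_ [b Bb <-] hb].
by exists b.
Qed.

Lemma hmod_seq B x (s : seq H) : E_ B x ->
  exists2 u, forall n, B (u n) & forall v, v \in s -> (fun n => u n (e0 v)) @ \oo --> x v.
Proof.
move=> Bx; have /choice[u hu] : forall n, exists b, B b /\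
    forall v, v \in s -> rnorm (b (e0 v) - x v) < n.+1%:R^-1.
  by move=> n; have [|b Bb hb] := hmod_approx Bx s (e := n.+1%:R^-1); [rewrite invr_gt0|exists b].
exists u => [n|v vs]; first by have [] := hu n.
apply/cvgHP => e /harmonic_lt[N hN]; exists N => n Nn.
by have [_ hn] := hu n; apply: lt_trans (hn v vs) (hN n Nn).
Qed.

Lemma hmod_mono B C x : B `<=` C -> E_ B x -> E_ C x.
Proof.
move=> BC Bx; apply: hmod_intro; first exact: hmod_bounded Bx.
by move=> s e /(hmod_approx Bx s)[b /BC Cb hb]; exists b.
Qed.

Lemma hmod_embed B b : bounded_op b -> B b -> E_ B (b \o e0).
Proof.
move=> bb Bb; apply: hmod_intro; first exact: bounded_comp.
by move=> s e e0'; exists b => // v _; rewrite subrr rnorm0.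
Qed.

Lemma hmod_ebar B x v : E_ B x -> x (e0 v) = x v.
Proof.
move=> Bx; have [u _ hu] := hmod_seq [:: v; e0 v] Bx.
apply: limH_unique (hu (e0 v) _) _; first by rewrite !inE eqxx orbT.
by rewrite [e0 (e0 v)](ebar_idem Omega vA0); apply: hu; rewrite inE eqxx.
Qed.

Lemma hmod_lin B (k : R[i]) x y : von_neumann B -> E_ B x -> E_ B y ->
  E_ B (fun v => k *: x v + y v).
Proof.
move=> vB Bx By; apply: hmod_intro; first by apply: bounded_lin; apply: hmod_bounded; eassumption.
move=> s e e0'; pose K : R := `|complex.Re k| + `|complex.Im k|.
have K0 : 0 <= K by rewrite addr_ge0.
have K1 : 0 < K + 1 by rewrite ltr_wpDl.
have [|b Bb hb] := hmod_approx Bx s (e := e / 2 / (K + 1)); first by rewrite !divr_gt0.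
have [|c Bc hc] := hmod_approx By s (e := e / 2); first by rewrite divr_gt0.
exists (fun v => k *: b v + c v) => [|v vs]; first exact: vn_lin.
rewrite opprD addrACA -scalerBr; apply: le_lt_trans (rnormD _ _) _.
rewrite [e]splitr; apply: ler_ltD; last exact: hc.
apply: le_trans (rnormZC _ _) _; rewrite -/K; have := hb v vs.
rewrite ltr_pdivlMr // => h; apply/ltW; apply: le_lt_trans h; rewrite mulrC.
by rewrite ler_wpM2l ?rnorm_ge0 // lerDl.
Qed.

Lemma hmod_sub B x y : von_neumann B -> E_ B x -> E_ B y -> E_ B (x \- y).
Proof.
move=> vB Bx By; rewrite (_ : x \- y = fun v => (-1) *: y v + x v).
  exact: hmod_lin.
by apply/funext => v; rewrite scaleN1r addrC.
Qed.

Lemma hmod_lim B (u : nat -> H -> H) x : bounded_op x -> (forall n, E_ B (u n)) ->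
  (forall v, (fun n => u n v) @ \oo --> x v) -> E_ B x.
Proof.
move=> bx Bu ux; apply: hmod_intro => // s e e0'.
have e2 : 0 < e / 2 by rewrite divr_gt0.
have [n hn] : exists n, forall v, v \in s -> rnorm (u n v - x v) < e / 2.
  suff [N hN] : exists N, forall n, (N <= n)%N -> forall v, v \in s -> rnorm (u n v - x v) < e / 2.
    by exists N; apply: hN.
  elim: s => [|v s [N hN]]; first by exists 0%N.
  have /cvgHP/(_ _ e2)[N' hN'] := ux v.
  exists (maxn N N') => n; rewrite geq_max => /andP[h h'] w.
  by rewrite in_cons => /orP[/eqP ->|]; [apply: hN'|apply: hN].
have [b Bb hb] := hmod_approx (Bu n) s e2.
exists b => // v vs; apply: le_lt_trans (rnormBD _ (u n v) _) _.
by rewrite [e]splitr ltrD //; [apply: hb|apply: hn].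
Qed.

Lemma hmod_lmul C D b y : bounded_op b -> (forall c, C c -> D (b \o c)) ->
  E_ C y -> E_ D (b \o y).
Proof.
move=> bb CD Cy; apply: hmod_intro; first exact: bounded_comp (hmod_bounded Cy).
move=> s e epos; have [K K0 hK] := bop_bound bb.
have K1 : 0 < K + 1 by rewrite ltr_wpDl.
have [|c Cc hc] := hmod_approx Cy s (e := e / (K + 1)); first by rewrite divr_gt0.
exists (b \o c) => [|v vs]; first exact: CD.
rewrite /= -(bopB _ _ bb); apply: le_lt_trans (hK _) _; have := hc v vs.
rewrite ltr_pdivlMr // => h; apply: le_lt_trans h; rewrite mulrC.
by rewrite ler_wpM2l ?rnorm_ge0 // lerDl.
Qed.

Lemma gns_mono B C : B `<=` C -> gns_subspace Omega B `<=` gns_subspace Omega C.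
Proof. by move=> BC; apply: closureS => _ [b /BC Cb <-]; exists b. Qed.

Lemma hmod_range C y v : von_neumann C -> A0 `<=` C -> E_ C y -> gns_subspace Omega C (y v).
Proof.
move=> vC A0C Cy; have [u Cu uy] := hmod_seq [:: v] Cy.
have [_] := gns_closed Omega vC; apply.
apply/closure_seq; exists (fun n => u n (e0 v)); last by apply: uy; rewrite inE.
move=> n; apply: gns_invariant => //; apply: gns_mono A0C _ _.
exact: ebar_in.
Qed.
End Module.

Section ModuleInner.
Context {R : realType} {H : hilbertType R}.
Variables (A A0 : set (H -> H)) (psi : (H -> H) -> R[i]) (Omega : H)
  (E0 : (H -> H) -> (H -> H)).
Hypotheses (hA : probability_space A psi) (hOmega : is_gns A psi Omega)
  (hA0 : expected_subalgebra A psi A0 E0).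
Implicit Types (v w : H) (a b x y : H -> H).

Let e0 := ebar Omega A0.
Let vA0 : von_neumann A0 := sub_vn hA0.
Let vA : von_neumann A := algebra_vn hA.
Local Notation N := (hmod A0 Omega A).
Local Notation ip := (inner0 A0 Omega).

Lemma alg_ebar_inj a b : A0 a -> A0 b -> (forall v, a (e0 v) = b (e0 v)) -> a = b.
Proof.
move=> Aa Ab h; apply: (separating_eq hA hOmega); try exact: (sub_incl hA0).
by have := h Omega; rewrite [e0 Omega](ebar_Omega Omega vA0).
Qed.

Lemma hmod_adjoint_ebar x v : N x -> e0 (adjoint x v) = adjoint x v.
Proof.
move=> Nx; have bx := hmod_bounded Nx; apply: rdot_inj => w.
by rewrite (ebar_sym Omega vA0) rdotC -(adjP _ _ bx) (hmod_ebar vA0 _ Nx) (adjP _ _ bx) rdotC.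
Qed.

(** Approximating [x] and [y] by [a e0] and [a' e0] reduces this to the operator
    [e0 a^* a' e0 = E0(a^* a') e0], which commutes with [e0] and with [b]. *)
Lemma hmod_adjoint_comm x y b v : N x -> N y -> commutant A0 b ->
  adjoint x (y (e0 (b (e0 v)))) = e0 (b (e0 (adjoint x (y v)))).
Proof.
move=> Nx Ny cb; have bx := hmod_bounded Nx; have bb := commutant_bounded cb.
have bs := adjoint_bounded bb.
apply: rdot_inj => w.
rewrite -(adjPl _ _ bx) [RHS](ebar_sym Omega vA0) [RHS](adjP _ _ bb).
rewrite [RHS](ebar_sym Omega vA0) -(adjPl _ _ bx).
have [u Au hu] := hmod_seq [:: e0 (b (e0 v)); v] Ny.
have [u' Au' hu'] := hmod_seq [:: w; e0 (adjoint b (e0 w))] Nx.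
apply: limr_unique (cvg_rdot (hu _ _) (hu' _ _)) _; rewrite ?inE ?eqxx ?orbT //.
rewrite (_ : (fun _ => _) = fun n => rdot (u n (e0 v)) (u' n (e0 (e0 (adjoint b (e0 w)))))).
  by apply: cvg_rdot; [apply: hu|apply: hu']; rewrite !inE eqxx ?orbT.
apply/funext => n; have bu' := vn_bounded vA (Au' n).
have Auu : A (adjoint (u' n) \o u n) by apply: vn_comp => //; apply: vn_adjoint.
have key z z' : rdot (u n (e0 z)) (u' n (e0 z')) = rdot (E0 (adjoint (u' n) \o u n) (e0 z)) z'.
  by rewrite (adjPl _ _ bu') -(ebar_sym Omega vA0) (expect_ebar hA hOmega hA0).
have AE := expect_range hA0 Auu.
rewrite !key ![e0 (e0 _)](ebar_idem Omega vA0) -(ebar_sym Omega vA0) -(adjP _ _ bb).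
rewrite -(ebar_sym Omega vA0) !(ebar_comm Omega vA0 _ AE) -(vn_comm _ AE cb).
by rewrite (ebar_comm Omega vA0 _ AE) !(ebar_idem Omega vA0).
Qed.

Lemma inner0_spec x y : N x -> N y ->
  A0 (ip x y) /\ forall v, ip x y (e0 v) = adjoint x (y v).
Proof.
move=> Nx Ny; have bx := hmod_bounded Nx; have by_ := hmod_bounded Ny.
have [|v|v|b v cb|a Aa ae] := @reduction _ _ _ _ _ _ _ hA hOmega hA0 (adjoint x \o y).
- by apply: bounded_comp => //; apply: adjoint_bounded.
- by rewrite /= (hmod_ebar vA0 _ Ny).
- exact: (hmod_adjoint_ebar _ Nx).
- exact: (hmod_adjoint_comm _ Nx Ny cb).
have [Ai ie] : [set a | A0 a /\ a \o e0 = adjoint x \o y] (ip x y).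
  exact: (@getI _ [set a | A0 a /\ a \o e0 = adjoint x \o y] a).
by split=> // v; exact: (congr1 (fun f => f v) ie).
Qed.

Lemma inner0_in x y : N x -> N y -> A0 (ip x y).
Proof. by move=> Nx Ny; case: (inner0_spec Nx Ny). Qed.

Lemma inner0_dot x y v w : N x -> N y -> rdot (ip x y (e0 v)) w = rdot (y v) (x w).
Proof.
move=> Nx Ny; case: (inner0_spec Nx Ny) => _ ->.
by rewrite rdotC -(adjP _ _ (hmod_bounded Nx)) rdotC.
Qed.

Lemma inner0_ge0 x v : N x -> 0 <= rdot (ip x x v) v.
Proof.
move=> Nx; apply: (transfer_ge0 hA hOmega hA0); first exact: inner0_in.
by move=> w Hw; rewrite -{1}(ebar_id vA0 Hw) inner0_dot // rdot_ge0.
Qed.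

Lemma inner0_le x (M : R) : N x -> (forall v, rnorm (x v) <= M * rnorm v) ->
  forall v, rdot (ip x x v) v <= M ^+ 2 * rdot v v.
Proof.
move=> Nx hM; apply: (transfer_le hA hOmega hA0); first exact: inner0_in.
move=> w Hw; rewrite -{1}(ebar_id vA0 Hw) inner0_dot // -!rnormE2 -exprMn.
by rewrite ler_pXn2r ?nnegrE ?rnorm_ge0 // (le_trans _ (hM _)) ?rnorm_ge0.
Qed.

Lemma inner0_sym x : N x -> symmetric_op (ip x x).
Proof.
move=> Nx; have Ai := inner0_in Nx Nx; have bi := vn_bounded vA0 Ai.
suff e : adjoint (ip x x) = ip x x by move=> v w; rewrite (adjP _ _ bi) e.
apply: alg_ebar_inj => // [|v]; first exact: vn_adjoint.
apply: rdot_inj => w; rewrite inner0_dot // rdotC -(adjP _ _ bi).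
rewrite -(ebar_sym Omega vA0) (ebar_comm Omega vA0 _ Ai) inner0_dot //.
by rewrite rdotC.
Qed.

Lemma inner0_positive x : N x -> positive_op (ip x x).
Proof.
move=> Nx; apply/positive_opP; split; [|exact: inner0_sym|by move=> v; apply: inner0_ge0].
by apply: (vn_bounded vA0); apply: inner0_in.
Qed.

(** The square root of [<x|x>_0] enters only through its norms, so any choice of
    it will do. *)
Lemma abs0_spec x : N x ->
  bounded_op (abs0 A0 Omega x) /\
  forall v, rdot (abs0 A0 Omega x v) (abs0 A0 Omega x v) = rdot (ip x x v) v.
Proof.
move=> Nx; have [S [pS SS _]] := positive_sqrt (inner0_positive Nx).
have [/positive_opP[bT sT _] TT] :
    [set S | positive_op S /\ S \o S = ip x x] (abs0 A0 Omega x).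
  exact: (@getI _ [set S | positive_op S /\ S \o S = ip x x] S).
split=> // v; rewrite -sT; congr rdot; exact: (congr1 (fun f => f v) TT).
Qed.

Lemma abs0_norm x v : N x -> gns_subspace Omega A0 v ->
  rnorm (abs0 A0 Omega x v) = rnorm (x v).
Proof.
move=> Nx Hv; have [_ h] := abs0_spec Nx; apply/eqP.
rewrite -(@eqrXn2 _ 2) ?rnorm_ge0 // !rnormE2 h.
by rewrite -{1}(ebar_id vA0 Hv) inner0_dot.
Qed.

Lemma opnorm_ub (T : H -> H) v : bounded_op T -> rnorm (T v) <= opnorm T * rnorm v.
Proof.
move=> bT; have [K K0 hK] := bop_bound bT.
have hs : has_sup [set rnorm (T v) | v in [set v | rnorm v <= 1]].
  split; first by exists (rnorm (T 0)), 0 => //=; rewrite rnorm0.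
  by exists K => _ [w /= w1 <-]; apply: le_trans (hK w) _; rewrite ler_piMr.
have [n0|n0] := eqVneq (rnorm v) 0.
  by rewrite (rnorm0_eq0 n0) bop0 // rnorm0 mulr0.
have np : 0 < rnorm v by rewrite lt_neqAle eq_sym n0 rnorm_ge0.
rewrite -ler_pdivrMr //; apply: sup_upper_bound => //.
exists ((rnorm v)^-1%:C *: v); rewrite /= ?bopZ // rnormZ ger0_norm ?invr_ge0 ?rnorm_ge0 //.
  by rewrite mulVf.
by rewrite mulrC.
Qed.

Lemma opnorm_le (T : H -> H) (M : R) : (forall v, rnorm (T v) <= M * rnorm v) -> 0 <= M ->
  opnorm T <= M.
Proof.
move=> h M0; apply: ge_sup; first by exists (rnorm (T 0)), 0 => //=; rewrite rnorm0.
by move=> _ [w /= w1 <-]; apply: le_trans (h w) _; rewrite ler_piMr.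
Qed.

Lemma norm0_ge0 x : N x -> 0 <= norm0 A0 Omega x.
Proof.
move=> Nx; have [ba _] := abs0_spec Nx.
have [K K0 hK] := bop_bound ba; rewrite /norm0 /opnorm; apply: le_trans (rnorm_ge0 (abs0 A0 Omega x 0)) _.
apply: sup_upper_bound; last by exists 0 => //=; rewrite rnorm0.
split; first by exists (rnorm (abs0 A0 Omega x 0)), 0 => //=; rewrite rnorm0.
by exists K => _ [w /= w1 <-]; apply: le_trans (hK w) _; rewrite ler_piMr.
Qed.

Lemma norm0_ub x v : N x -> rnorm (x v) <= norm0 A0 Omega x * rnorm v.
Proof.
move=> Nx; have [ba _] := abs0_spec Nx.
have H0v : gns_subspace Omega A0 (e0 v) by apply: ebar_in.
rewrite -(hmod_ebar vA0 v Nx) -abs0_norm //; apply: le_trans (opnorm_ub _ ba) _.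
by apply: ler_wpM2l; [apply: norm0_ge0|apply: oproj_le; apply: gns_closed].
Qed.

Lemma norm0_le x (M : R) : N x -> 0 <= M -> (forall v, rnorm (x v) <= M * rnorm v) ->
  norm0 A0 Omega x <= M.
Proof.
move=> Nx M0 hM; have [ba ha] := abs0_spec Nx; apply: opnorm_le => // v.
apply: rnorm_le; first by rewrite mulr_ge0 ?rnorm_ge0.
by rewrite ha exprMn rnormE2; apply: inner0_le.
Qed.
End ModuleInner.

(** * Sequential approximation in the module *)

Section Sequences.
Context {R : realType} {H : hilbertType R}.
Variables (A A0 : set (H -> H)) (psi : (H -> H) -> R[i]) (Omega : H)
  (E0 : (H -> H) -> (H -> H)).
Hypotheses (hA : probability_space A psi) (hOmega : is_gns A psi Omega)
  (hA0 : expected_subalgebra A psi A0 E0).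
Implicit Types (v w : H) (a b x y : H -> H).

Let e0 := ebar Omega A0.
Let vA0 : von_neumann A0 := sub_vn hA0.
Let vA : von_neumann A := algebra_vn hA.
Local Notation N := (hmod A0 Omega A).
Local Notation ip := (inner0 A0 Omega).

Lemma stop_limitP (f : nat -> H -> H) z : (forall n, N (f n)) -> N z ->
  seq_limit (stop A0 Omega) f z <-> forall v, (fun n => f n v) @ \oo --> z v.
Proof.
move=> Nf Nz; have Nd n : N (f n \- z) by apply: hmod_sub.
split=> [h v|h _ [v Hv <-]].
  have Hv : gns_subspace Omega A0 (e0 v) by apply: ebar_in.
  apply/cvgHrP; have := h _ (ex_intro2 _ _ (e0 v) Hv erefl).
  rewrite (_ : (fun n => _) = fun n => rnorm (f n v - z v)) //.
  apply/funext => n /=; rewrite (abs0_norm hA hOmega hA0) //=.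
  by rewrite (hmod_ebar vA0 _ (Nf n)) (hmod_ebar vA0 _ Nz).
have /cvgHrP := h v; rewrite (_ : (fun n => rnorm (f n v - z v)) =
  fun n => rnorm (abs0 A0 Omega (f n \- z) v)) //.
by apply/funext => n; rewrite (abs0_norm hA hOmega hA0).
Qed.

Lemma series_single (r : R) : cvgn (series (fun k => if k is 0%N then r else 0)).
Proof.
apply/cvg_ex; exists r; rewrite -(cvg_shiftn 1).
rewrite (_ : [sequence _]_n = fun=> r); first exact: cvg_cst.
by apply/funext => n /=; rewrite addn1 /series /= big_nat_recl // big1 // addr0.
Qed.

Lemma vector_functional_normal (M : set (H -> H)) v w :
  normal_functional M (fun a => hdot (a v) w).
Proof.
exists (fun k => if k is 0%N then v else 0), (fun k => if k is 0%N then w else 0).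
split.
- rewrite (_ : (fun k => _) = fun k => if k is 0%N then rnorm v ^+ 2 else 0).
    exact: series_single.
  by apply/funext => -[|k] //; rewrite rnorm0 expr0n.
- rewrite (_ : (fun k => _) = fun k => if k is 0%N then rnorm w ^+ 2 else 0).
    exact: series_single.
  by apply/funext => -[|k] //; rewrite rnorm0 expr0n.
move=> a Ma; rewrite -(cvg_shiftn 1).
rewrite (_ : [sequence _]_n = fun=> hdot (a v) w); first exact: cvg_cst.
apply/funext => n /=; rewrite addn1 big_ord_recl big1 /= ?addr0 // => i _.
by rewrite linear0r.
Qed.

Lemma norm_complexE (z : R[i]) : `|z| = (complex.Re `|z|)%:C.
Proof. by rewrite normc_def. Qed.

(** Let [d n] be dense in the predual. For each [n] and [m] choose an element of the
    unit ball of [A] at which [d n] is at least [2 / (m + 1)], if there is one. A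
    vector [x] orthogonal to all the chosen elements times [Omega] is orthogonal to
    [A Omega]: some [d n] is within [1 / (m + 1)] of the functional [<a Omega, x>],
    hence small at the chosen element, hence small on the whole ball. *)
Lemma total_sequence : exists w : nat -> H, forall K : set H, closed_subspace K ->
  (forall n, K (w n)) -> forall v, K v.
Proof.
have [_ [d _ hd] _] := hA.
have /choice[f hf] : forall nm : nat * nat, exists a, A a /\
    ((exists b, [/\ A b, opnorm b <= 1 & 2 * nm.2.+1%:R^-1 <= complex.Re `|d nm.1 b|]) ->
     opnorm a <= 1 /\ 2 * nm.2.+1%:R^-1 <= complex.Re `|d nm.1 a|).
  move=> nm; have [[b [Ab b1 db]]|nb] := pselect (exists b,
    [/\ A b, opnorm b <= 1 & 2 * nm.2.+1%:R^-1 <= complex.Re `|d nm.1 b|]).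
    by exists b.
  by exists idfun; split=> //; apply: vn_id.
exists (fun k => if unpickle k is Some nm then f nm Omega else 0) => K cK hK.
apply: closed_subspace_total => // x hx.
have fx nm : hdot (f nm Omega) x = 0.
  rewrite hdotC hdot0 ?rmorph0 // => c; apply: hx.
  apply: subspaceZ; first by case: cK.
  by have := hK (pickle nm); rewrite pickleK.
have ball a : A a -> opnorm a <= 1 -> hdot (a Omega) x = 0.
  move=> Aa a1; apply/normr0_eq0; rewrite norm_complexE.
  suff -> : complex.Re `|hdot (a Omega) x| = 0 by [].
  apply/eqP; rewrite eq_le; apply/andP; split; last first.
    by rewrite -ler0c -norm_complexE normr_ge0.
  apply/ler_addgt0Pl => e e0'; rewrite addr0.
  have [|m hm] := @harmonic_lt R (e / 3); first by rewrite divr_gt0.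
  have {hm} := hm m (leqnn m).
  have [|n hn] := hd _ (vector_functional_normal A Omega x) m.+1%:R^-1; first by rewrite invr_gt0.
  have [Af hf1] := hf (n, m).
  have tri b : A b -> opnorm b <= 1 -> complex.Re `|hdot (b Omega) x - d n b| <= m.+1%:R^-1.
    move=> Ab b1; rewrite -lecR -norm_complexE; apply: le_trans (hn b Ab) _.
    by rewrite lecR ler_piMr // invr_ge0.
  have dn b : A b -> opnorm b <= 1 -> complex.Re `|d n b| < 2 * m.+1%:R^-1.
    move=> Ab b1; rewrite ltNge; apply/negP => h.
    have [f1 df] : opnorm (f (n, m)) <= 1 /\ 2 * m.+1%:R^-1 <= complex.Re `|d n (f (n, m))|.
      by apply: hf1; exists b.
    have := tri _ Af f1; rewrite fx sub0r normrN => /(le_trans df).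
    have : 0 < (m.+1%:R^-1 : R) by rewrite invr_gt0.
    by move: (m.+1%:R^-1) => t; lra.
  have : complex.Re `|hdot (a Omega) x| <= complex.Re `|hdot (a Omega) x - d n a| + complex.Re `|d n a|.
    rewrite -lecR -norm_complexE rmorphD /= -!norm_complexE.
    by rewrite -{1}(subrK (d n a) (hdot (a Omega) x)) ler_normD.
  move: (tri a Aa a1) (dn a Aa a1); move: (m.+1%:R^-1) => t; lra.
have orth a : A a -> hdot (a Omega) x = 0.
  move=> Aa; have [K' K0 hK'] := bop_bound (vn_bounded vA Aa).
  have K1 : 0 < K' + 1 by rewrite ltr_wpDl.
  have Aca : A (fun v => ((K' + 1)^-1)%:C *: a v + (a \- a) v).
    by apply: vn_lin => //; apply: vn_sub.
  have := ball _ Aca; rewrite /= subrr addr0 hdotZl => h.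
  have /eqP : ((K' + 1)^-1)%:C * hdot (a Omega) x = 0.
    apply: h; apply: opnorm_le => // v; rewrite /= subrr addr0 rnormZ mul1r.
    rewrite ger0_norm ?invr_ge0 ?(ltW K1) // ler_pdivrMl //.
    by apply: le_trans (hK' v) _; rewrite ler_wpM2r ?rnorm_ge0 // lerDl.
  rewrite mulf_eq0 => /orP[|/eqP //].
  by rewrite -(rmorph0 (real_complex R)) (inj_eq (@complexI R)) invr_eq0 gt_eqF.
have [_ cyc] := hOmega; apply: rdot_eq0.
have cx : closure [set a Omega | a in A] x by rewrite cyc.
rewrite -(rdot0l x); apply: rdot_eq_closure cx => _ [a Aa <-].
by rewrite rdotC rdot0l /rdot orth.
Qed.

(** Multiply [b] by [G = (1 + a)^-1], where [a = <D|D>_0] and [D = b e0 - x].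
    With [t = G e0 v] one has [t + a t = e0 v], and expanding [|D v|^2] and
    [|e0 v|^2] in terms of [t] bounds [D t] and [a t] by [|D v|], and [D t] and [t] by [|v|]. *)
Lemma bounded_correction B x b (K : R) : von_neumann B -> A0 `<=` B -> B `<=` A ->
  N x -> 0 <= K -> (forall v, rnorm (x v) <= K * rnorm v) -> B b ->
  exists2 b', B b' & forall v,
    rnorm (b' (e0 v) - x v) <= (K + 1) * rnorm (b (e0 v) - x v) /\
    rnorm (b' (e0 v)) <= (K + 1) * rnorm v.
Proof.
move=> vB A0B BA Nx K0 hK Bb; have bb := vn_bounded vB Bb; have bx := hmod_bounded Nx.
pose D := (b \o e0) \- x.
have ND : N D by apply: hmod_sub => //; apply: hmod_embed => //; apply: BA.
have bD := hmod_bounded ND.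
have pa := inner0_positive hA hOmega hA0 ND.
have Aa := inner0_in hA hOmega hA0 ND ND; set a := ip D D in pa Aa.
have [ba sa a0] := (positive_opP _).1 pa.
have [G [bG sG hG cG]] := positive_resolvent pa.
have AG : A0 G.
  apply: vn_intro => // Q v cQ; have bQ := commutant_bounded cQ.
  have e : Q \o a = a \o Q by apply/funext => u /=; rewrite (vn_comm _ Aa cQ).
  by have /(congr1 (fun f => f v)) := cG Q bQ e.
exists (b \o G) => [|v /=]; first by apply: vn_comp => //; apply: A0B.
set t := G (e0 v).
have et : e0 t = t by rewrite /t /e0 (ebar_comm Omega vA0 _ AG) (ebar_idem Omega vA0).
have hz : t + a t = ebar Omega A0 v by apply: hG.
have Dt : rdot (a t) t = rdot (D t) (D t).
  by rewrite -{1}et (inner0_dot hA hOmega hA0).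
have Dv : rdot (D v) (D v) = rdot (a t) t + 2 * rdot (a t) (a t) + rdot (a (a t)) (a t).
  rewrite -(hmod_ebar vA0 v ND) -(inner0_dot hA hOmega hA0 _ _ ND ND) -/a.
  rewrite (ebar_idem Omega vA0) -hz (bopD _ _ ba) !rdotE (sa (a t) t); ring.
have nv : rdot (e0 v) (e0 v) = rdot t t + 2 * rdot (a t) t + rdot (a t) (a t).
  by rewrite /e0 -hz !rdotE (rdotC t); ring.
have p1 := a0 t; have p2 := rdot_ge0 (a t); have p3 := a0 (a t); have p4 := rdot_ge0 t.
have le1 : rnorm (D t) <= rnorm (D v) by apply: rnorm_mono; rewrite -Dt Dv; lra.
have le2 : rnorm (a t) <= rnorm (D v) by apply: rnorm_mono; rewrite Dv; lra.
have ev : rnorm (e0 v) <= rnorm v by apply: oproj_le; apply: gns_closed.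
have le3 : rnorm (D t) <= rnorm v.
  by apply: le_trans ev; apply: rnorm_mono; rewrite -Dt nv; lra.
have le4 : rnorm t <= rnorm v.
  by apply: le_trans ev; apply: rnorm_mono; rewrite nv; lra.
have bt : b t = D t + x t by rewrite /D /= et subrK.
split.
  have -> : b t - x v = D t - x (a t).
    rewrite bt -(hmod_ebar vA0 v Nx) -hz (bopD _ _ bx).
    by rewrite opprD addrA addrK.
  apply: le_trans (rnormD _ _) _; rewrite rnormN mulrDl mul1r addrC.
  by apply: lerD => //; apply: le_trans (hK _) _; apply: ler_wpM2l.
rewrite bt; apply: le_trans (rnormD _ _) _; rewrite mulrDl mul1r addrC.
by apply: lerD => //; apply: le_trans (hK _) _; apply: ler_wpM2l.
Qed.

(** Uniformly bounded operators converge on a closed subspace; it is everything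
    as soon as it contains a total sequence. *)
Lemma bounded_sequence B x : von_neumann B -> A0 `<=` B -> B `<=` A -> hmod A0 Omega B x ->
  exists2 u, forall n, B (u n) & forall v, (fun n => u n (e0 v)) @ \oo --> x v.
Proof.
move=> vB A0B BA Bx; have Nx := hmod_mono BA Bx; have bx := hmod_bounded Bx.
have [K K0 hK] := bop_bound bx; have K1 : 0 < K + 1 by rewrite ltr_wpDl.
have [w hw] := total_sequence.
have /choice[u hu] : forall n, exists b, B b /\
   ((forall k, (k <= n)%N -> rnorm (b (e0 (w k)) - x (w k)) <= (K + 1) * n.+1%:R^-1) /\
    forall v, rnorm (b (e0 v)) <= (K + 1) * rnorm v).
  move=> n; have [|b Bb hb] := hmod_approx Bx [seq w k | k <- iota 0 n.+1] (e := n.+1%:R^-1).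
    by rewrite invr_gt0.
  have [b' Bb' hb'] := bounded_correction vB A0B BA Nx K0 hK Bb.
  exists b'; split=> //; split=> [k kn|v]; last by have [] := hb' v.
  have [h _] := hb' (w k); apply: le_trans h _; apply: ler_wpM2l; first exact: ltW.
  by apply/ltW/hb/map_f; rewrite mem_iota.
have Bu n : B (u n) by have [] := hu n.
exists u => //; apply: hw => [|k].
  have bue n : bounded_op (fun v => u n (e0 v)).
    by apply: bounded_comp; [apply: vn_bounded (Bu n)|apply: ebar_bounded].
  split; first split.
  - rewrite /= (bop0 bx) (_ : (fun _ => _) = fun=> 0); first exact: cvg_cst.
    by apply/funext => n; rewrite (bop0 (bue n)).
  - move=> c v v' /= hv hv'; have [lx _] := bx.
    rewrite lx (_ : (fun _ => _) = fun n => c *: u n (e0 v) + u n (e0 v')).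
      by apply: cvgD => //; apply: cvgZl_tmp.
    by apply/funext => n; have [l _] := bue n; exact: l.
  move=> v /closureP cl; apply/cvgHP => e epos.
  have [|v' hv' vv'] := cl (e / 3 / (K + 1)); first by rewrite !divr_gt0.
  have /cvgHP/(_ (e / 3))[|M hM] := hv'; first by rewrite divr_gt0.
  exists M => n /hM hn; move: vv'; rewrite ltr_pdivlMr // => vv'.
  have [_ [_ bd]] := hu n.
  have h1 : rnorm (u n (e0 v) - u n (e0 v')) <= (K + 1) * rnorm (v' - v).
    by rewrite (rnormB v') -[X in rnorm X <= _](bopB v v' (bue n)) bd.
  have h2 : rnorm (x v' - x v) <= (K + 1) * rnorm (v' - v).
    rewrite -(bopB _ _ bx); apply: le_trans (hK _) _.
    by apply: ler_wpM2r; [apply: rnorm_ge0|rewrite lerDl].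
  have := rnormBD (u n (e0 v)) (u n (e0 v')) (x v).
  have := rnormBD (u n (e0 v')) (x v') (x v).
  by move: h1 h2 vv' hn; rewrite mulrC; lra.
apply/cvgHP => e epos; have [|M hM] := @harmonic_lt R (e / (K + 1)); first by rewrite divr_gt0.
exists (maxn k M) => n; rewrite geq_max => /andP[kn /hM].
rewrite ltr_pdivlMr // mulrC; have [_ [h _]] := hu n; exact: le_lt_trans (h k kn).
Qed.

Lemma approximatesP B u x : B `<=` A -> hmod A0 Omega B x ->
  approximates A0 Omega B u x <->
  (forall n, B (u n)) /\ forall v, (fun n => u n (e0 v)) @ \oo --> x v.
Proof.
move=> BA Bx; have Nx := hmod_mono BA Bx.
have key : (forall n, B (u n)) -> forall n, N (u n \o e0).
  by move=> Bu n; have Au := BA _ (Bu n); apply: hmod_embed => //; apply: vn_bounded Au.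
split=> -[Bu h]; split=> //.
  by apply/(stop_limitP (key Bu) Nx).
by apply/(stop_limitP (key Bu) Nx).
Qed.
End Sequences.

(** * The commuting square and the existence of products *)

Section CommutingSquare.
Context {R : realType} {H : hilbertType R}.
Variables (A A0 B C : set (H -> H)) (psi : (H -> H) -> R[i]) (Omega : H)
  (E0 EB EC : (H -> H) -> (H -> H)).
Hypotheses (hA : probability_space A psi) (hOmega : is_gns A psi Omega)
  (hA0 : expected_subalgebra A psi A0 E0) (hB : expected_subalgebra A psi B EB)
  (hC : expected_subalgebra A psi C EC) (hBC : independent A0 E0 B C).
Implicit Types (v w : H) (a b c x y z : H -> H).

Let e0 := ebar Omega A0.
Let vA0 : von_neumann A0 := sub_vn hA0.
Let vA : von_neumann A := algebra_vn hA.
Let vB : von_neumann B := sub_vn hB.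
Let vC : von_neumann C := sub_vn hC.
Let BA : B `<=` A := sub_incl hB.
Let CA : C `<=` A := sub_incl hC.

Lemma indep_subl : A0 `<=` B.
Proof. by case: hBC => h _ a /h[]. Qed.

Lemma indep_subr : A0 `<=` C.
Proof. by case: hBC => h _ a /h[]. Qed.

Local Notation HC := (gns_subspace Omega C).

(** With [b1] the adjoint of [b], the equation [E0(b1 c) = E0(b1) E0(c)]
    says that [c Omega] and [E0(c) Omega] have the same scalar product with [b Omega]. *)
Lemma square_right v : HC v -> ebar Omega B v = e0 v.
Proof.
apply: bop_eq_closure; [exact: ebar_bounded|exact: ebar_bounded|].
move=> _ [c Cc <-]; have Ac := CA Cc; rewrite /e0 -(expect_Omega hA hOmega hA0 Ac).
have AE := expect_range hA0 Ac.
apply: oproj_unique; first exact: gns_closed.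
  by apply: gns_mem; apply: indep_subl.
apply: rdot_eq_closure => _ [b Bb <-].
have bb := vn_bounded vB Bb; have Bs := vn_adjoint vB Bb; have As := BA Bs.
have AAE := sub_incl hA0 AE.
have As1 : A (adjoint b \o E0 c) by apply: vn_comp.
have As2 : A (adjoint b \o c) by apply: vn_comp.
rewrite !(adjPl _ _ bb) -(stateE hOmega As1) -(stateE hOmega As2).
rewrite -(expect_state hA0 As1) -(expect_state hA0 As2).
by rewrite (expect_modr hA0 AE As); case: hBC => _ ->.
Qed.

(** The projections onto [HB] and [HC] multiply to [e0] in one order by
    [square_right], hence in the other by taking adjoints. *)
Lemma square_left v : gns_subspace Omega B v -> ebar Omega C v = e0 v.
Proof.
move=> Hv; apply: rdot_inj => w.
have H0C : HC (e0 v).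
  by apply: gns_mono indep_subr _ _; apply: ebar_in.
rewrite (ebar_sym Omega vC) -{1}(ebar_id vB Hv) (ebar_sym Omega vB).
rewrite square_right; last exact: ebar_in.
by rewrite -(ebar_sym Omega vA0) -(ebar_sym Omega vC) ebar_id.
Qed.

Lemma expect_square b : B b -> EC b = E0 b.
Proof.
move=> Bb; have Ab := BA Bb; apply: (separating_eq hA hOmega).
- by apply: CA; apply: expect_range hC _ Ab.
- by apply: (sub_incl hA0); apply: expect_range hA0 _ Ab.
rewrite (expect_Omega hA hOmega hC Ab) (expect_Omega hA hOmega hA0 Ab).
by apply: square_left; apply: gns_mem.
Qed.

Lemma expect_compress b v : B b -> HC v -> ebar Omega C (b v) = E0 b v.
Proof.
by move=> Bb Hv; rewrite -(expect_square Bb) (expect_gns hA hOmega hC) //; apply: BA.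
Qed.

Lemma gram b1 b2 v w : B b1 -> B b2 -> HC v -> HC w ->
  rdot (b1 v) (b2 w) = rdot (E0 (adjoint b2 \o b1) v) w.
Proof.
move=> B1 B2 Hv Hw; have bb2 := vn_bounded vB B2.
rewrite (adjPl _ _ bb2) -(@expect_compress (adjoint b2 \o b1)) //.
  by rewrite (ebar_sym Omega vC) ebar_id.
by apply: vn_comp => //; apply: vn_adjoint.
Qed.

Lemma H0_HC v : HC (e0 v).
Proof. by apply: gns_mono indep_subr _ _; apply: ebar_in. Qed.

Lemma gram_in b1 b2 : B b1 -> B b2 -> A0 (E0 (adjoint b2 \o b1)).
Proof.
move=> B1 B2; apply: (expect_range hA0); apply: vn_comp => //; last exact: BA.
by apply: vn_adjoint => //; apply: BA.
Qed.

Lemma gram_positive d : B d -> positive_op (E0 (adjoint d \o d)).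
Proof.
move=> Bd; have ad := gram_in Bd Bd; have bd := vn_bounded vB Bd.
case: hA0 => _ _ /ce_positive; apply; first by apply: vn_comp => //; [apply: vn_adjoint => //|]; apply: BA.
exact: adj_comp_positive.
Qed.

(** On [HC], [|d v|^2] is the vector state at [v] of [E0(d^* d)], an element of [A0]
    of norm at most [K^2]; by [transfer] this is almost a vector state at a vector
    [k] of [H0] that does not depend on [d]. *)
Lemma local_control (K : R) v (e : R) : 0 <= K -> HC v -> 0 < e -> exists k, forall d, B d ->
  (forall w, rnorm (d (e0 w)) <= K * rnorm w) -> rnorm (d v) <= rnorm (d (e0 k)) + e.
Proof.
move=> K0 Hv epos; have K1 : 0 < K + 1 by rewrite ltr_wpDl.
have [|y [k [yv Hk hyk]]] := transfer hA hOmega hA0 v (e := e / (K + 1)).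
  by rewrite divr_gt0.
exists k => d Bd hd; have AE := gram_in Bd Bd.
have [S [/positive_opP[bS sS _] SS _]] := positive_sqrt (gram_positive Bd).
have SE w : rdot (S w) (S w) = rdot (E0 (adjoint d \o d) w) w.
  by rewrite -SS /= [RHS]sS.
have dS w : HC w -> rnorm (d w) = rnorm (S w).
  move=> Hw; apply/eqP; rewrite -(@eqrXn2 _ 2) ?rnorm_ge0 // !rnormE2 SE.
  by rewrite gram.
have ek : e0 k = k by apply: ebar_id.
have SK w : rnorm (S w) <= K * rnorm w.
  apply: rnorm_le; first by rewrite mulr_ge0 ?rnorm_ge0.
  rewrite SE exprMn rnormE2; apply: (transfer_le hA hOmega hA0) => // w' Hw'.
  rewrite -SE -!rnormE2 -exprMn -(dS w') ?ler_pXn2r ?nnegrE ?mulr_ge0 ?rnorm_ge0 //.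
    by rewrite -{1}(ebar_id vA0 Hw').
  exact: gns_mono indep_subr _ Hw'.
rewrite (dS _ Hv) (dS _ (@H0_HC k)) ek.
have -> : rnorm (S k) = rnorm (S y).
  by apply/eqP; rewrite -(@eqrXn2 _ 2) ?rnorm_ge0 // !rnormE2 !SE hyk.
apply: le_trans (_ : rnorm (S y) + rnorm (S (v - y)) <= _).
  by rewrite (bopB _ _ bS) addrC; have := rnormD (S v - S y) (S y); rewrite subrK.
rewrite lerD2l; apply: le_trans (SK _) _; rewrite (rnormB v).
move: yv; rewrite ltr_pdivlMr // mulrC => /ltW; apply: le_trans.
by rewrite ler_wpM2r ?rnorm_ge0 // lerDl.
Qed.

Lemma pointwise_bounded_seq (u : nat -> H -> H) x : (forall n, bounded_op (u n)) ->
  (forall v, (fun n => u n v) @ \oo --> x v) ->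
  exists2 K, 0 <= K & forall n v, rnorm (u n v) <= K * rnorm v.
Proof.
move=> bu ux; apply: uniform_boundedness => // v.
have /cvgHP/(_ 1 ltr01)[M hM] := ux v.
exists (\sum_(i < M) rnorm (u i v) + (1 + rnorm (x v))) => n.
have s0 m : 0 <= \sum_(i < m) rnorm (u i v) by apply: sumr_ge0 => i _; apply: rnorm_ge0.
have [Mn|nM] := leqP M n.
  have := rnormD (u n v - x v) (x v); rewrite subrK.
  by move: (hM n Mn) (s0 M); lra.
rewrite (bigD1 (Ordinal nM)) //= -addrA lerDl addr_ge0 ?addr_ge0 ?rnorm_ge0 //.
by apply: sumr_ge0 => i _; apply: rnorm_ge0.
Qed.

(** [approximates] with its stop limit read as strong convergence; see
    [approximatesP]. *)
Definition approximant (u : nat -> H -> H) x :=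
  (forall n, B (u n)) /\ forall v, (fun n => u n (e0 v)) @ \oo --> x v.

Lemma approximant_bounded u x : approximant u x ->
  exists2 K, 0 <= K & forall n v, rnorm (u n (e0 v)) <= K * rnorm v.
Proof.
move=> [Bu ux]; apply: (@pointwise_bounded_seq (fun n v => u n (e0 v)) x) => // n.
by apply: bounded_comp; [apply: vn_bounded (Bu n)|apply: ebar_bounded].
Qed.

Lemma approximant_indep u u' x v : approximant u x -> approximant u' x -> HC v ->
  (fun n => rnorm (u n v - u' n v)) @ \oo --> (0 : R).
Proof.
move=> cu cu' Hv; have [K K0 hK] := approximant_bounded cu; have [K' K'0 hK'] := approximant_bounded cu'.
have [Bu ux] := cu; have [Bu' ux'] := cu'.
apply/cvg0P => [n|e epos]; first exact: rnorm_ge0.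
have e3 : 0 < e / 3 by rewrite divr_gt0.
have [k hk] := local_control (addr_ge0 K0 K'0) Hv e3.
have /cvgHP/(_ (e / 3))[|M hM] := ux k; first by rewrite divr_gt0.
have /cvgHP/(_ (e / 3))[|M' hM'] := ux' k; first by rewrite divr_gt0.
exists (maxn M M') => n; rewrite geq_max => /andP[/hM h /hM' h'].
have := hk (u n \- u' n) (vn_sub vB (Bu n) (Bu' n)).
move=> /(_ _)/le_lt_trans; apply => [w|/=].
  apply: le_trans (rnormD _ _) _; rewrite rnormN mulrDl.
  by apply: lerD; [apply: hK|apply: hK'].
have := rnormBD (u n (e0 k)) (x k) (u' n (e0 k)); rewrite (rnormB (x k)).
by move: h h'; lra.
Qed.

Lemma product_limit u x y : approximant u x -> hmod A0 Omega C y ->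
  exists2 z, bounded_op z & forall v, (fun n => u n (y v)) @ \oo --> z v.
Proof.
move=> cu Cy; have [K K0 hK] := approximant_bounded cu; have [Bu ux] := cu.
have by_ := hmod_bounded Cy.
have Hy v : HC (y v) by apply: hmod_range Cy => //; apply: indep_subr.
have /choice[z hz] : forall v, exists z : H, (fun n => u n (y v)) @ \oo --> z.
  move=> v; apply: hilbert_complete => e epos.
  have e3 : 0 < e / 3 by rewrite divr_gt0.
  have [k hk] := local_control (addr_ge0 K0 K0) (Hy v) e3.
  have /cvgHP/(_ (e / 3))[|M hM] := ux k; first by rewrite divr_gt0.
  exists M => n m /hM h /hM h'.
  have := hk (u n \- u m) (vn_sub vB (Bu n) (Bu m)).
  move=> /(_ _)/le_lt_trans; apply => [w|/=].
    apply: le_trans (rnormD _ _) _; rewrite rnormN mulrDl.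
    by apply: lerD; apply: hK.
  have := rnormBD (u n (e0 k)) (x k) (u m (e0 k)); rewrite (rnormB (x k)).
  by move: h h'; lra.
have bue n : bounded_op (u n \o y) by apply: bounded_comp => //; apply: vn_bounded (Bu n).
have [K' K'0 hK'] := pointwise_bounded_seq bue hz.
exists z => //; apply/bounded_opP; split.
  move=> c v w; apply: limH_unique (hz _) _.
  rewrite (_ : (fun n => _) = fun n => c *: u n (y v) + u n (y w)).
    by apply: cvgD => //; apply: cvgZl_tmp.
  by apply/funext => n; have [l _] := bue n; exact: l.
by exists K' => // v; apply: limit_le (cvg_rnorm (hz v)) _ => n; apply: hK'.
Qed.
End CommutingSquare.

(** * The product and its algebra *)

Section WeakConvergence.
Context {R : realType} {H : hilbertType R}.
Variables (A A0 : set (H -> H)) (psi : (H -> H) -> R[i]) (Omega : H)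
  (E0 : (H -> H) -> (H -> H)).
Hypotheses (hA : probability_space A psi) (hOmega : is_gns A psi Omega)
  (hA0 : expected_subalgebra A psi A0 E0).
Implicit Types (v w : H) (a b x y : H -> H).

Let e0 := ebar Omega A0.
Let vA0 : von_neumann A0 := sub_vn hA0.

Lemma null_dense (f : nat -> H -> R) (L : R) (D : set H) : 0 <= L ->
  (forall n v w, `|f n v - f n w| <= L * rnorm (v - w)) ->
  (forall v, D v -> (fun n => f n v) @ \oo --> (0 : R)) ->
  forall v, closure D v -> (fun n => f n v) @ \oo --> (0 : R).
Proof.
move=> L0 fL fD v /closureP cl; apply/cvgr0Pnorm_lt => e epos.
have L1 : 0 < L + 1 by rewrite ltr_wpDl.
have [|w Dw wv] := cl (e / 2 / (L + 1)); first by rewrite !divr_gt0.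
have e2 : 0 < e / 2 by rewrite divr_gt0.
have /cvgr0Pnorm_lt/(_ _ e2) := fD w Dw; apply: filterS => n hn.
have h : L * rnorm (v - w) <= (L + 1) * rnorm (w - v).
  by rewrite (rnormB v) ler_wpM2r ?rnorm_ge0 // lerDl.
move: wv; rewrite ltr_pdivlMr // mulrC => wv.
have := ler_normD (f n v - f n w) (f n w); rewrite subrK.
by move: (fL n v w) hn; lra.
Qed.

(** The bound concerns the element [a^* a] of [A0], so [transfer_le] applies. *)
Lemma alg_bound a (M : R) : 0 <= M -> A0 a -> (forall v, rnorm (a (e0 v)) <= M * rnorm v) ->
  forall v, rnorm (a v) <= M * rnorm v.
Proof.
move=> M0 Aa h v; have ba := vn_bounded vA0 Aa.
apply: rnorm_le; first by rewrite mulr_ge0 ?rnorm_ge0.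
have Aaa : A0 (adjoint a \o a) by apply: vn_comp => //; apply: vn_adjoint.
rewrite (adjP _ _ ba) rdotC exprMn rnormE2.
apply: (transfer_le hA hOmega hA0 Aaa) => w Hw /=.
rewrite -(adjPl _ _ ba) -!rnormE2 -exprMn ler_pXn2r ?nnegrE ?mulr_ge0 ?rnorm_ge0 //.
by rewrite -{1}(ebar_id vA0 Hw).
Qed.

(** At the dense vectors [b Omega], with [b] in the commutant, one has
    [<a (b Omega), w> = <a Omega, b^* w>], a coefficient of [a e0]; the uniform
    bound extends the convergence to all vectors. *)
Lemma weak_spread (a : nat -> H -> H) (M : R) : 0 <= M -> (forall n, A0 (a n)) ->
  (forall n v, rnorm (a n (e0 v)) <= M * rnorm v) ->
  (forall v w, (fun n => rdot (a n (e0 v)) w) @ \oo --> (0 : R)) ->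
  forall v w, (fun n => rdot (a n v) w) @ \oo --> (0 : R).
Proof.
move=> M0 Aa aM a0 v w; have ba n := vn_bounded vA0 (Aa n).
have bM n := alg_bound M0 (Aa n) (aM n).
have dense := @commutant_cyclic _ _ _ _ _ _ _ hA hOmega hA0.
apply: (@null_dense (fun n v => rdot (a n v) w) (M * rnorm w) [set b Omega | b in commutant A0]).
- by rewrite mulr_ge0 ?rnorm_ge0.
- move=> n v' w'; rewrite -rdotNl -rdotDl -(bopB _ _ (ba n)).
  apply: le_trans (cauchy_schwarz _ _) _; rewrite mulrAC.
  by rewrite ler_wpM2r ?rnorm_ge0.
- move=> _ [b cb <-].
  have bb := commutant_bounded cb.
  rewrite (_ : (fun n => _) = fun n => rdot (a n (e0 Omega)) (adjoint b w)).
    exact: a0.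
  apply/funext => n; rewrite [e0 Omega](ebar_Omega Omega vA0) -(adjP _ _ bb).
  by rewrite (vn_comm _ (Aa n) cb).
exact: dense.
Qed.
End WeakConvergence.

Section Product.
Context {R : realType} {H : hilbertType R}.
Variables (A A0 B C : set (H -> H)) (psi : (H -> H) -> R[i]) (Omega : H)
  (E0 EB EC : (H -> H) -> (H -> H)).
Hypotheses (hA : probability_space A psi) (hOmega : is_gns A psi Omega)
  (hA0 : expected_subalgebra A psi A0 E0) (hB : expected_subalgebra A psi B EB)
  (hC : expected_subalgebra A psi C EC) (hBC : independent A0 E0 B C).
Implicit Types (v w : H) (a b c x y z : H -> H).

Let e0 := ebar Omega A0.
Let vA0 : von_neumann A0 := sub_vn hA0.
Let vA : von_neumann A := algebra_vn hA.
Let vB : von_neumann B := sub_vn hB.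
Let vC : von_neumann C := sub_vn hC.
Let BA : B `<=` A := sub_incl hB.
Let CA : C `<=` A := sub_incl hC.
Local Notation E_ := (hmod A0 Omega).
Local Notation N := (hmod A0 Omega A).
Local Notation ip := (inner0 A0 Omega).
Local Notation mul := (mprod A A0 Omega B).
Local Notation conv := (approximant A0 B Omega).
Let A0B : A0 `<=` B := indep_subl hBC.
Let A0C : A0 `<=` C := indep_subr hBC.

Lemma join_vn_sub : vn_join B C `<=` A.
Proof. by move=> a; apply; split=> // b [/BA|/CA]. Qed.

Lemma join_comp b c : B b -> C c -> vn_join B C (b \o c).
Proof. by move=> Bb Cc M [vM BCM]; apply: vn_comp => //; apply: BCM; [left|right]. Qed.

Lemma hmod_left x : E_ B x -> N x. Proof. exact: hmod_mono. Qed.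
Lemma hmod_right y : E_ C y -> N y. Proof. exact: hmod_mono. Qed.

Lemma lmul_join b y : B b -> E_ C y -> E_ (vn_join B C) (b \o y).
Proof.
move=> Bb Cy; apply: hmod_lmul Cy; first exact: (vn_bounded vB Bb).
by move=> c; apply: join_comp.
Qed.

Lemma lmul_N b y : B b -> E_ C y -> N (b \o y).
Proof. by move=> Bb Cy; apply: hmod_mono join_vn_sub _; apply: lmul_join. Qed.

Lemma range_HC y v : E_ C y -> gns_subspace Omega C (y v).
Proof. by move=> Cy; apply: (hmod_range vA0). Qed.

Lemma approximant_exists x : E_ B x -> exists u, conv u x.
Proof.
by move=> Bx; have [u Bu ux] := bounded_sequence hA hOmega hA0 vB A0B BA Bx; exists u.
Qed.

(** Products exist by [product_limit] and do not depend on the approximating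
    sequence by [approximant_indep]; this identifies the chosen [mprod]. *)
Lemma mprod_spec x y : E_ B x -> E_ C y -> E_ (vn_join B C) (mul x y) /\
  forall u, conv u x -> forall v, (fun n => u n (y v)) @ \oo --> mul x y v.
Proof.
move=> Bx Cy.
have lim_of z u : N z -> conv u x -> seq_limit (stop A0 Omega) (fun n => u n \o y) z <->
    forall v, (fun n => u n (y v)) @ \oo --> z v.
  by move=> Nz [Bu _]; apply: (stop_limitP hA hOmega hA0) => // n; apply: lmul_N.
have [Nm [u0 ap lm]] : [set z | N z /\ exists2 u, approximates A0 Omega B u x &
    seq_limit (stop A0 Omega) (fun n => u n \o y) z] (mul x y).
  have [u cu] := approximant_exists Bx; have [z bz uz] := product_limit hA hOmega hA0 hB hC hBC cu Cy.
  have Nz : N z by apply: hmod_lim bz _ uz => // n; apply: lmul_N => //; case: cu.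
  apply: (@getI _ _ z); split=> //; exists u.
    exact/(approximatesP hA hOmega hA0 _ BA Bx).
  exact/lim_of.
have cu0 : conv u0 x by apply/(approximatesP hA hOmega hA0 _ BA Bx).
have {}lm := (lim_of _ _ Nm cu0).1 lm.
have lim u : conv u x -> forall v, (fun n => u n (y v)) @ \oo --> mul x y v.
  move=> cu v.
  have d := approximant_indep hA hOmega hA0 hB hC hBC cu cu0 (range_HC Cy).
  apply: (@null_squeezeH _ _ _ (fun n => rnorm (u n (y v) - u0 n (y v)) +
     rnorm (u0 n (y v) - mul x y v))) => [n|]; first exact: rnormBD.
  by rewrite -[0]addr0; apply: cvgD => //; apply: cvgr_rnormB.
split=> //; apply: hmod_lim (hmod_bounded Nm) _ lm.
by move=> n; apply: lmul_join => //; case: cu0.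
Qed.

Lemma mul_N x y : E_ B x -> E_ C y -> N (mul x y).
Proof. by move=> Bx Cy; apply: hmod_mono join_vn_sub _; case: (mprod_spec Bx Cy). Qed.

Lemma mul_lim x y u v : E_ B x -> E_ C y -> conv u x ->
  (fun n => u n (y v)) @ \oo --> mul x y v.
Proof. by move=> Bx Cy cu; case: (mprod_spec Bx Cy) => _; apply. Qed.

Lemma mul_unique x y u z : E_ B x -> E_ C y -> conv u x ->
  (forall v, (fun n => u n (y v)) @ \oo --> z v) -> mul x y = z.
Proof.
move=> Bx Cy cu uz; apply/funext => v; apply: limH_unique (uz v).
exact: mul_lim.
Qed.

Lemma mul_embed b y : B b -> E_ C y -> mul (b \o e0) y = b \o y.
Proof.
move=> Bb Cy; apply: (@mul_unique _ _ (fun=> b)) => //.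
- by apply: hmod_embed => //; apply: (vn_bounded vB Bb).
- by split=> // v; apply: cvg_cst.
by move=> v; apply: cvg_cst.
Qed.

(** The limit of [gram]: the elements [E0(u2^* u1)] of [A0] are bounded and converge
    to [<x2|x1>_0] weakly on [H0], hence, by [weak_spread], also at vectors of [HC]. *)
Lemma mul_dot x1 x2 y1 y2 v w : E_ B x1 -> E_ B x2 -> E_ C y1 -> E_ C y2 ->
  rdot (mul x1 y1 v) (mul x2 y2 w) = rdot (ip x2 x1 (y1 v)) (y2 w).
Proof.
move=> B1 B2 C1 C2; have [u1 c1] := approximant_exists B1; have [u2 c2] := approximant_exists B2.
have [K1 K10 hK1] := approximant_bounded hA0 hB c1.
have [K2 K20 hK2] := approximant_bounded hA0 hB c2.
have [Bu1 ux1] := c1; have [Bu2 ux2] := c2.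
have N1 := hmod_left B1; have N2 := hmod_left B2.
have Ai := inner0_in hA hOmega hA0 N2 N1; have bi := vn_bounded vA0 Ai.
have [L L0 hL] := bop_bound bi.
have h0 := cvg_rdot (@mul_lim _ _ _ v B1 C1 c1) (@mul_lim _ _ _ w B2 C2 c2).
apply: (limr_unique h0).
pose a n := E0 (adjoint (u2 n) \o u1 n).
have Aa n : A0 (a n) := gram_in hA hA0 hB (Bu1 n) (Bu2 n).
have ae n v' w' : rdot (a n (e0 v')) w' = rdot (u1 n (e0 v')) (u2 n (e0 w')).
  have H0C' := @H0_HC _ _ _ _ _ _ _ _ _ hA0 hBC.
  rewrite (gram hA hOmega hA0 hB hC hBC) -/(a n) //.
  by rewrite -(ebar_sym Omega vA0) (ebar_comm Omega vA0 _ (Aa n)) (ebar_idem Omega vA0).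
have h : (fun n => rdot ((a n \- ip x2 x1) (y1 v)) (y2 w)) @ \oo --> (0 : R).
  apply: (@weak_spread _ _ _ _ _ _ _ hA hOmega hA0 (fun n => a n \- ip x2 x1) (K1 * K2 + L)).
  - by rewrite addr_ge0 ?mulr_ge0.
  - by move=> n; apply: vn_sub.
  - move=> n v' /=; apply: le_trans (rnormD _ _) _; rewrite rnormN mulrDl; apply: lerD.
      set t := a n _; have [t0|t0] := eqVneq (rnorm t) 0.
        by rewrite t0 !mulr_ge0 ?rnorm_ge0.
      have tp : 0 < rnorm t by rewrite lt_neqAle eq_sym t0 rnorm_ge0.
      rewrite -(ler_pM2r tp) -expr2 rnormE2 {1}/t ae.
      apply: le_trans (ler_norm _) _; apply: le_trans (cauchy_schwarz _ _) _.
      apply: le_trans (ler_pM (rnorm_ge0 _) (rnorm_ge0 _) (hK1 n v') (hK2 n t)) _.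
      by rewrite mulrACA mulrA.
    apply: le_trans (hL _) _; apply: ler_wpM2l => //.
    by apply: oproj_le; apply: gns_closed.
  - move=> v' w'; rewrite /= (_ : (fun n => _) = fun n =>
      rdot (u1 n (e0 v')) (u2 n (e0 w')) - rdot (x1 v') (x2 w')).
      rewrite -(subrr (rdot (x1 v') (x2 w'))); apply: cvgB; last exact: cvg_cst.
      exact: cvg_rdot.
    apply/funext => n /=; rewrite rdotDl rdotNl ae.
    by rewrite (inner0_dot hA hOmega hA0 _ _ N2 N1).
have {}h : (fun n => rdot ((a n \- ip x2 x1) (y1 v)) (y2 w) + rdot (ip x2 x1 (y1 v)) (y2 w)) @ \oo
   --> rdot (ip x2 x1 (y1 v)) (y2 w).
  by rewrite -[X in _ --> X]add0r; apply: cvgD => //; apply: cvg_cst.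
have e : (fun n => rdot ((a n \- ip x2 x1) (y1 v)) (y2 w) + rdot (ip x2 x1 (y1 v)) (y2 w)) =
    fun n => rdot (u1 n (y1 v)) (u2 n (y2 w)).
  apply/funext => n /=; rewrite -rdotDl subrK; apply/esym.
  by apply: (gram hA hOmega hA0 hB hC hBC) => //; exact: range_HC.
by move: h; rewrite e.
Qed.

(** Both sides are the element of [A0] attached to the same operator on [H0]. *)
Lemma mul_inner x1 x2 y1 y2 : E_ B x1 -> E_ B x2 -> E_ C y1 -> E_ C y2 ->
  ip (mul x1 y1) (mul x2 y2) = ip y1 (ip x1 x2 \o y2).
Proof.
move=> B1 B2 C1 C2; rewrite /inner0.
suff -> : adjoint (mul x1 y1) \o mul x2 y2 = adjoint y1 \o (inner0 A0 Omega x1 x2 \o y2) by [].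
have bm := hmod_bounded (mul_N B1 C1); have by1 := hmod_bounded C1.
apply/funext => v /=; apply: rdot_inj => w.
by rewrite -(adjPl _ _ bm) -(adjPl _ _ by1) mul_dot.
Qed.

Lemma mul_sub_l x x' y v : E_ B x -> E_ B x' -> E_ C y ->
  mul (x \- x') y v = mul x y v - mul x' y v.
Proof.
move=> Bx Bx' Cy; have [u cu] := approximant_exists Bx; have [u' cu'] := approximant_exists Bx'.
have [Bu ux] := cu; have [Bu' ux'] := cu'.
rewrite (@mul_unique (x \- x') y (fun n => u n \- u' n) (mul x y \- mul x' y)) //.
- exact: hmod_sub.
- by split=> [n|w]; [apply: vn_sub|apply: cvgB].
by move=> w; apply: cvgB; apply: mul_lim.
Qed.

Lemma mul_sub_r x y y' v : E_ B x -> E_ C y -> E_ C y' ->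
  mul x (y \- y') v = mul x y v - mul x y' v.
Proof.
move=> Bx Cy Cy'; have [u cu] := approximant_exists Bx; have [Bu ux] := cu.
rewrite (@mul_unique x (y \- y') u (mul x y \- mul x y')) //.
- exact: hmod_sub.
move=> w; rewrite (_ : (fun n => _) = fun n => u n (y w) - u n (y' w)).
  by apply: cvgB; apply: mul_lim.
by apply/funext => n; rewrite /= (bopB _ _ (vn_bounded vB (Bu n))).
Qed.

Lemma mul_norm_le x y (K : R) v : E_ B x -> E_ C y -> 0 <= K ->
  (forall w, rnorm (x w) <= K * rnorm w) -> rnorm (mul x y v) <= K * rnorm (y v).
Proof.
move=> Bx Cy K0 hK; apply: rnorm_le; first by rewrite mulr_ge0 ?rnorm_ge0.
rewrite mul_dot // exprMn rnormE2.
by apply: (inner0_le hA hOmega hA0) => //; apply: hmod_left.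
Qed.

Lemma hmod_ebar_comp x : N x -> E_ A0 (e0 \o x).
Proof.
move=> Nx; have bx := hmod_bounded Nx; have be := ebar_bounded Omega vA0.
apply: hmod_intro; first exact: bounded_comp.
move=> s e epos; have [a Aa ha] := hmod_approx Nx s epos.
exists (E0 a); first exact: expect_range hA0 _ Aa.
move=> v vs; rewrite (expect_ebar hA hOmega hA0) // /= -(bopB _ _ be).
by apply: le_lt_trans (ha v vs); apply: oproj_le; apply: gns_closed.
Qed.

Lemma mul_expect_left x y : E_ B x -> E_ C y ->
  ext_ce Omega B (mul x y) = mul x (ext_ce Omega A0 y).
Proof.
move=> Bx Cy; have [u cu] := approximant_exists Bx; have [Bu ux] := cu.
have be := ebar_bounded Omega vB.
apply/esym; apply: (mul_unique _ _ cu) => //.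
  by apply: hmod_mono A0C _; apply: hmod_ebar_comp; apply: hmod_right.
move=> v; rewrite /ext_ce /=.
rewrite (_ : (fun n => _) = fun n => ebar Omega B (u n (y v))).
  by apply: cvg_op => //; apply: mul_lim.
apply/funext => n; rewrite (ebar_comm Omega vB _ (Bu n)).
by rewrite (square_right hA hOmega hA0 hB hC hBC (range_HC Cy)).
Qed.

Lemma mul_expect_right x y : E_ B x -> E_ C y ->
  ext_ce Omega C (mul x y) = mul (ext_ce Omega A0 x) y.
Proof.
move=> Bx Cy; have [u cu] := approximant_exists Bx; have [Bu ux] := cu.
have be := ebar_bounded Omega vC; have be0 := ebar_bounded Omega vA0.
have EA n : A0 (E0 (u n)) by apply: (expect_range hA0); apply: BA.
apply/esym; apply: (@mul_unique _ _ (fun n => E0 (u n))) => //.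
- by apply: hmod_mono A0B _; apply: hmod_ebar_comp; apply: hmod_left.
- split=> [n|v]; first exact: A0B.
  rewrite (_ : (fun n => _) = fun n => ebar Omega A0 (u n (e0 v))).
    exact: cvg_op.
  by apply/funext => n; rewrite (expect_ebar hA hOmega hA0) //; apply: BA.
move=> v; rewrite /ext_ce /=.
rewrite (_ : (fun n => _) = fun n => ebar Omega C (u n (y v))).
  by apply: cvg_op => //; apply: mul_lim.
by apply/funext => n; rewrite (expect_compress hA hOmega hA0 hB hC hBC (Bu n) (range_HC Cy)).
Qed.
End Product.

(** * Normal functionals on the small algebra *)

Section NormalFunctionals.
Context {R : realType} {H : hilbertType R}.
Variables (A A0 : set (H -> H)) (psi : (H -> H) -> R[i]) (Omega : H)
  (E0 : (H -> H) -> (H -> H)).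
Hypotheses (hA : probability_space A psi) (hOmega : is_gns A psi Omega)
  (hA0 : expected_subalgebra A psi A0 E0).
Implicit Types (v w : H) (a b c d x y : H -> H) (phi : (H -> H) -> R[i]).

Let vA0 : von_neumann A0 := sub_vn hA0.
Local Notation N := (hmod A0 Omega A).
Local Notation ip := (inner0 A0 Omega).

Lemma Re_le_norm (z : R[i]) : `|complex.Re z| <= complex.Re `|z|.
Proof.
rewrite normc_def /= -sqrtr_sqr ler_sqrt ?lerDl ?sqr_ge0 //.
by rewrite addr_ge0 ?sqr_ge0.
Qed.

Lemma cvg_Re (f : nat -> R[i]) (l : R[i]) : f @ \oo --> (l : R[i]^o) ->
  (fun n => complex.Re (f n)) @ \oo --> complex.Re l.
Proof.
move=> h; apply/cvgrPdist_lt => e epos.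
have ec : 0 < e%:C :> R[i] by rewrite ltcR.
have hF := @cvgr_dist_lt R[i] (R[i]^o) _ _ _ f l h _ ec.
apply: filterS (hF _) => n /=; rewrite -[`|_|]/(`|l - f n|) norm_complexE ltcR -raddfB.
exact: le_lt_trans (Re_le_norm _).
Qed.

Lemma normal_Re phi : normal_functional A0 phi -> exists xi eta : nat -> H,
  [/\ cvgn (series (fun k => rnorm (xi k) ^+ 2)),
      cvgn (series (fun k => rnorm (eta k) ^+ 2)) &
      forall a, A0 a -> (fun n => \sum_(0 <= k < n) rdot (a (xi k)) (eta k)) @ \oo
            --> complex.Re (phi a)].
Proof.
move=> [xi [eta [cx ce h]]]; exists xi, eta; split=> // a /h /cvg_Re.
rewrite (_ : (fun n => complex.Re _) =
  fun n => \sum_(0 <= k < n) rdot (a (xi k)) (eta k)) //.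
by apply/funext => n; rewrite raddf_sum big_mkord.
Qed.

Lemma normal_Re_lin phi (r : R) a b : normal_functional A0 phi -> A0 a -> A0 b ->
  complex.Re (phi (fun v => r%:C *: a v + b v)) =
  r * complex.Re (phi a) + complex.Re (phi b).
Proof.
move=> /normal_Re[xi [eta [_ _ h]]] Aa Ab.
apply: limr_unique (h _ (vn_lin vA0 _ Aa Ab)) _.
rewrite (_ : (fun n => _) = fun n => r * (\sum_(0 <= k < n) rdot (a (xi k)) (eta k)) +
   \sum_(0 <= k < n) rdot (b (xi k)) (eta k)).
  by apply: cvgD; [apply: cvgMl_tmp|]; apply: h.
by apply/funext => n; rewrite mulr_sumr -big_split /=; apply: eq_bigr => k _; rewrite !rdotE.
Qed.

(** [phi] is linear on [A0] by its series, so [phi b - phi a = phi (b - a)]. *)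
Lemma normal_mono phi a b : normal_functional A0 phi -> positive_functional A0 phi ->
  A0 a -> A0 b -> symmetric_op a -> symmetric_op b ->
  (forall v, rdot (a v) v <= rdot (b v) v) -> complex.Re (phi a) <= complex.Re (phi b).
Proof.
move=> nphi pphi Aa Ab sa sb h.
have Ac : A0 (fun v => ((-1 : R)%:C) *: a v + b v) by apply: vn_lin.
have /pphi : positive_op (fun v => ((-1 : R)%:C) *: a v + b v).
  apply/positive_opP; split=> [|v w|v]; first exact: vn_bounded vA0 _ Ac.
    by rewrite !rdotE sa sb.
  by rewrite !rdotE; have := h v; lra.
move=> /(_ Ac); rewrite lecE => /andP[_]; rewrite normal_Re_lin //=; lra.
Qed.

Lemma series_tail (f : nat -> R) (t : R) : (forall k, 0 <= f k) -> cvgn (series f) -> 0 < t ->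
  exists n0, forall n m, (n0 <= n)%N -> \sum_(n <= k < n + m) f k <= t.
Proof.
move=> f0 cf t0; have := cf; move=> /cvg_ex[l fl].
have mono : nondecreasing_seq (series f) by apply: nondecreasing_series.
have le n : series f n <= l.
  by rewrite -(cvg_lim _ fl) //; apply: nondecreasing_cvgn_le.
have /cvgrPdist_lt/(_ t t0)[n0 _ hn0] := fl; exists n0 => n m nn.
have := hn0 n nn; rewrite /= ger0_norm ?subr_ge0 // => h.
have : series f (n + m)%N = series f n + \sum_(n <= k < n + m) f k.
  by rewrite /series /= (big_cat_nat _ (n := n)) //= leq_addr.
by have := le (n + m)%N; lra.
Qed.

(** Write [phi] as the sum of [<a xi_i, eta_i>]. For positive [c], polarization
    bounds each term by a quarter of the state at [xi_i + eta_i]. The tail is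
    at most [M] times a small number, and the finitely many other vectors are moved
    to [H0] by [transfer]. *)
Lemma normal_control phi (t : R) : normal_functional A0 phi -> 0 < t ->
  exists s : seq H, (forall k, k \in s -> gns_subspace Omega A0 k) /\
    forall c (M : R), A0 c -> 0 <= M -> (forall v, 0 <= rdot (c v) v) ->
      (forall v, rdot (c v) v <= M * rdot v v) -> symmetric_op c ->
      complex.Re (phi c) <= \sum_(k <- s) rdot (c k) k + M * t.
Proof.
move=> /normal_Re[xi [eta [cx ce lim]]] t0.
have t2 : 0 < t / 2 by rewrite divr_gt0.
have [n1 hn1] := series_tail (fun k => sqr_ge0 (rnorm (xi k))) cx t2.
have [n2 hn2] := series_tail (fun k => sqr_ge0 (rnorm (eta k))) ce t2.
pose n0 := maxn n1 n2.
pose tau := Num.min 1 (t / n0.+1%:R).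
have tau0 : 0 < tau by rewrite lt_min ltr01 divr_gt0.
have /choice[k hk] : forall i, exists k, gns_subspace Omega A0 k /\
    exists y : H, rnorm (y - (xi i + eta i)) < tau /\ forall a, A0 a -> rdot (a y) y = rdot (a k) k.
  move=> i; have [y [z [h1 h2 h3]]] := transfer hA hOmega hA0 (xi i + eta i) tau0.
  by exists z; split=> //; exists y.
exists [seq k i | i <- iota 0 n0]; split.
  by move=> _ /mapP[i _ ->]; have [] := hk i.
move=> c M Ac M0 c0 cM sc; have bc := vn_bounded vA0 Ac.
(* Polarization: 4 Re <c xi, eta> = <c (xi + eta), xi + eta> - <c (xi - eta), xi - eta>. *)
have quart i : rdot (c (xi i)) (eta i) <= 4^-1 * rdot (c (xi i + eta i)) (xi i + eta i).
  have := c0 (xi i - eta i); rewrite (bopB _ _ bc) (bopD _ _ bc) !rdotE.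
  by rewrite (sc (eta i) (xi i)) (rdotC (eta i) (c (xi i))); lra.
have head i : rdot (c (xi i)) (eta i) <= rdot (c (k i)) (k i) + M * (t / n0.+1%:R) / 2.
  apply: le_trans (quart i) _.
  have [_ [y [yx hy]]] := hk i; rewrite -hy //.
  move: (xi i + eta i) yx => z yx.
  have h1 := c0 (y - (z - y)); have h2 := cM (z - y).
  have h3 : rdot (z - y) (z - y) <= t / n0.+1%:R.
    have n_0 := rnorm_ge0 (z - y).
    move: yx; rewrite lt_min (rnormB y) -rnormE2 => /andP[l1 l2].
    by apply: le_trans (ltW l2); rewrite expr2 ler_piMl // ltW.
  have h4 : rdot (c z) z <= 2 * rdot (c y) y + 2 * (M * (t / n0.+1%:R)).
    apply: (@le_trans _ _ (2 * rdot (c y) y + 2 * rdot (c (z - y)) (z - y))).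
      move: h1; rewrite !(bopB _ _ bc) !rdotE; lra.
    rewrite lerD2l ler_pM2l //; apply: le_trans h2 _; exact: ler_wpM2l.
  by move: (c0 y) h4; move: (t / n0.+1%:R) => q; lra.
have tail i : rdot (c (xi i)) (eta i) <= M / 2 * (rnorm (xi i) ^+ 2 + rnorm (eta i) ^+ 2).
  apply: le_trans (quart i) _; rewrite !rnormE2.
  have h : rdot (xi i + eta i) (xi i + eta i) <= 2 * (rdot (xi i) (xi i) + rdot (eta i) (eta i)).
    by have := rdot_ge0 (xi i - eta i); rewrite !rdotE; lra.
  have := cM (xi i + eta i); have := ler_wpM2l M0 h; lra.
have lim' := lim c Ac; move: lim'; rewrite -(cvg_shiftn n0) => lim'.
apply: (limit_le lim') => m.
rewrite /= addnC (big_cat_nat _ (n := n0)) //= ?leq_addr //.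
have hh : \sum_(0 <= i < n0) rdot (c (xi i)) (eta i) <=
    \sum_(j <- [seq k i | i <- iota 0 n0]) rdot (c j) j + M * t / 2.
  rewrite big_map -/(index_iota 0 n0) /index_iota subn0.
  apply: le_trans (ler_sum _ (fun i _ => head i)) _.
  rewrite big_split /= lerD2l big_const_seq count_predT size_iota iter_addr_0 -[leLHS]mulr_natl.
  apply: (@le_trans _ _ (n0.+1%:R * (M * (t / n0.+1%:R) / 2))).
    rewrite ler_wpM2r ?ler_nat // !mulr_ge0 ?invr_ge0 // ltW //.
  have : n0.+1%:R != 0 :> R by rewrite pnatr_eq0.
  by move: (n0.+1%:R : R) => q q0; rewrite le_eqVlt; apply/orP; left; apply/eqP; field.
have ht : \sum_(n0 <= i < n0 + m) rdot (c (xi i)) (eta i) <= M * t / 2.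
  apply: le_trans (ler_sum _ (fun i _ => tail i)) _.
  rewrite -mulr_sumr big_split /=.
  have := hn1 n0 m (leq_maxl _ _); have := hn2 n0 m (leq_maxr _ _) => h2 h1.
  have := ler_wpM2l (M0 : 0 <= M) (lerD h1 h2); lra.
by move: hh ht; lra.
Qed.

End NormalFunctionals.

(** * Joint continuity of the product *)

Section Continuity.
Context {R : realType} {H : hilbertType R}.
Variables (A A0 B C : set (H -> H)) (psi : (H -> H) -> R[i]) (Omega : H)
  (E0 EB EC : (H -> H) -> (H -> H)).
Hypotheses (hA : probability_space A psi) (hOmega : is_gns A psi Omega)
  (hA0 : expected_subalgebra A psi A0 E0) (hB : expected_subalgebra A psi B EB)
  (hC : expected_subalgebra A psi C EC) (hBC : independent A0 E0 B C).
Implicit Types (v w : H) (a b c x y z : H -> H).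

Let vA0 : von_neumann A0 := sub_vn hA0.
Let vA : von_neumann A := algebra_vn hA.
Let vB : von_neumann B := sub_vn hB.
Let vC : von_neumann C := sub_vn hC.
Local Notation E_ := (hmod A0 Omega).
Local Notation N := (hmod A0 Omega A).
Local Notation ip := (inner0 A0 Omega).
Local Notation mul := (mprod A A0 Omega B).
Local Notation norm0 := (norm0 A0 Omega).

Let NB x : E_ B x -> N x.
Proof. exact: hmod_mono (sub_incl hB). Qed.

Let NC x : E_ C x -> N x.
Proof. exact: hmod_mono (sub_incl hC). Qed.

Let Nmul x y : E_ B x -> E_ C y -> N (mul x y).
Proof. exact: (mul_N hA hOmega hA0 hB hC hBC). Qed.

Let norm0_bound x v : N x -> rnorm (x v) <= norm0 x * rnorm v.
Proof. exact: (norm0_ub hA hOmega hA0). Qed.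

Let norm0_pos x : N x -> 0 <= norm0 x.
Proof. exact: (norm0_ge0 hA hOmega hA0). Qed.

Lemma mul_diff x x' y y' v : E_ B x -> E_ B x' -> E_ C y -> E_ C y' ->
  (mul x' y' \- mul x y) v = mul x' (y' \- y) v + mul (x' \- x) y v.
Proof.
move=> Bx Bx' Cy Cy'.
rewrite (mul_sub_r hA hOmega hA0 hB hC hBC) // (mul_sub_l hA hOmega hA0 hB hC hBC) //.
by rewrite /= addrA subrK.
Qed.

(** With [D] and [E] the distances of the two factors, the product moves by at most
    [(|x| + D) E + D |y|]. *)
Lemma mul_norm0_continuous :
  jointly_continuous (norm0_top A0 Omega) (E_ B) (E_ C) mul.
Proof.
move=> x y Bx Cy _ e -> epos.
have Nx := NB Bx; have Ny := NC Cy.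
have a0 := norm0_pos Nx; have b0 := norm0_pos Ny.
set a := norm0 x in a0; set b := norm0 y in b0.
have ab : 0 < a + b + 2 by lra.
exists [set norm0], (Num.min 1 (e / (a + b + 2))); split.
- exact: finite_set1.
- by [].
- by rewrite lt_min ltr01 divr_gt0.
move=> x' y' Bx' Cy' hx hy.
have dB : E_ B (x' \- x) by apply: hmod_sub.
have dC : E_ C (y' \- y) by apply: hmod_sub.
have := hx norm0 erefl; have := hy norm0 erefl.
have m0 : 0 < e / (a + b + 2) by rewrite divr_gt0.
have em : e / (a + b + 2) * (a + b + 2) = e by rewrite divfK // gt_eqF.
rewrite !lt_min => /andP[y1 y2] /andP[x1 x2].
have X0 := norm0_pos (NB dB); have Y0 := norm0_pos (NC dC).
have NX v := norm0_bound v (NB dB); have NY v := norm0_bound v (NC dC).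
set D := norm0 (x' \- x) in x1 x2 X0 NX; set E := norm0 (y' \- y) in y1 y2 Y0 NY.
apply: (@le_lt_trans _ _ ((a + D) * E + D * b)); last first.
  move: (e / (a + b + 2)) m0 em x2 y2 => m m0 em x2 y2.
  have h1 : a * E <= a * m by rewrite ler_wpM2l // ltW.
  have h2 : D * b <= m * b by rewrite ler_wpM2r // ltW.
  have h3 : D * E <= E by rewrite ler_piMl // ltW.
  lra.
apply: (norm0_le hA hOmega hA0) => [||v].
- by apply: hmod_sub => //; apply: Nmul.
- by rewrite addr_ge0 ?mulr_ge0 ?addr_ge0.
rewrite mul_diff // mulrDl; apply: le_trans (rnormD _ _) _; apply: lerD.
  rewrite -mulrA; apply: le_trans (_ : (a + D) * rnorm ((y' \- y) v) <= _).
    apply: (mul_norm_le hA hOmega hA0 hB hC hBC) => // [|w]; first by rewrite addr_ge0.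
    have := rnormD (x w) ((x' \- x) w); rewrite /= addrC subrK => /le_trans; apply.
    by rewrite mulrDl; apply: lerD; [apply: norm0_bound|apply: NX].
  by apply: ler_wpM2l; [rewrite addr_ge0|apply: NY].
rewrite -mulrA; apply: le_trans (_ : D * rnorm (y v) <= _).
  exact: (mul_norm_le hA hOmega hA0 hB hC hBC).
by apply: ler_wpM2l => //; apply: norm0_bound.
Qed.

Definition vector_seminorm k x : R :=
  Num.sqrt (complex.Re (hdot (ip x x k) k)).

Lemma vector_seminorm_sigma_stop k : sigma_stop A0 Omega (vector_seminorm k).
Proof.
exists (fun a => hdot (a k) k) => //; split; first exact: vector_functional_normal.
by move=> a _ [_]; apply.
Qed.

Lemma finite_seminorms (s : seq H) (f : H -> (H -> H) -> R) (p : (H -> H) -> R) :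
  finite_set [set q | q = p \/ exists2 k, k \in s & q = f k].
Proof.
rewrite (_ : [set q | _] = [set p] `|` f @` [set` s]).
  by rewrite finite_setU; split; [apply: finite_set1|apply: finite_image; apply: finite_seq].
apply/seteqP; split=> q [->|[k ks e]]; [by left|right|by left|right].
  by exists k.
by exists k.
Qed.

(** Split the difference of products as [x' (y' - y) + (x' - x) y]. The first part has
    [<.|.>_0] at most [K^2 <y' - y|y' - y>_0]. The second has [<y| <d|d> y>_0] with
    [d = x' - x] of norm at most [2 K]; [normal_control] bounds [phi] of it by the
    values of [<d|d>_0] at the vectors [y k], which are sigma-stop seminorms of [d]. *)
Lemma mul_sigma_stop_continuous (K : R) :
  jointly_continuous (sigma_stop A0 Omega)
    [set x | E_ B x /\ norm0 x <= K] (E_ C) mul.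
Proof.
move=> x y [Bx xK] Cy _ e [phi [nphi pphi] <-] epos.
have Nx := NB Bx; have Ny := NC Cy.
have K0 : 0 <= K by apply: le_trans (norm0_pos Nx) xK.
pose L := norm0 y; have L0 : 0 <= L by apply: norm0_pos.
pose M := (2 * K * L) ^+ 2; have M0 : 0 <= M by apply: sqr_ge0.
have e2 : 0 < e ^+ 2 by rewrite exprn_gt0.
pose t := e ^+ 2 / (8 * (M + 1)).
have M1 : 0 < 8 * (M + 1) by rewrite mulr_gt0 // ltr_wpDl.
have t0 : 0 < t by rewrite divr_gt0.
have Mt : 8 * M * t <= e ^+ 2.
  have : t * (8 * (M + 1)) = e ^+ 2 by rewrite divfK // gt_eqF.
  by move: t0; lra.
have [s [sH0 sphi]] := normal_control hA hOmega hA0 nphi t0.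
pose p z := Num.sqrt (complex.Re (phi (ip z z))).
pose S : R := 2 * K ^+ 2 + 2 * (size s)%:R + 1.
have S1 : 1 <= S by rewrite lerDr addr_ge0 // mulr_ge0 // sqr_ge0.
have S0 : 0 < S by apply: lt_le_trans S1.
pose delta := Num.min 1 (e ^+ 2 / (4 * S)).
have d0 : 0 < delta by rewrite lt_min ltr01 divr_gt0 // mulr_gt0.
have Sd : S * delta ^+ 2 <= e ^+ 2 / 4.
  have d1 : delta <= 1 by rewrite ge_min lexx.
  have d2 : delta <= e ^+ 2 / (4 * S) by rewrite ge_min lexx orbT.
  move: d2; rewrite ler_pdivlMr ?mulr_gt0 // => d2.
  have d3 : delta ^+ 2 <= delta by rewrite expr2 ler_piMl // ltW.
  by have := ler_wpM2l (ltW S0) d3; lra.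
exists [set q | q = p \/ exists2 k, k \in s & q = vector_seminorm (y k)], delta; split=> //.
- exact: finite_seminorms.
- move=> q [->|[k _ ->]]; last exact: vector_seminorm_sigma_stop.
  by exists phi.
move=> x' y' [Bx' x'K] Cy' hx hy.
have dB : E_ B (x' \- x) by apply: hmod_sub.
have dC : E_ C (y' \- y) by apply: hmod_sub.
pose w1 := mul x' (y' \- y); pose w2 := mul (x' \- x) y; pose w := mul x' y' \- mul x y.
have N1 : N w1 by apply: Nmul.
have N2 : N w2 by apply: Nmul.
have Nw : N w by apply: hmod_sub => //; apply: Nmul.
have A1 := inner0_in hA hOmega hA0 N1 N1; have A2 := inner0_in hA hOmega hA0 N2 N2.
have Aw := inner0_in hA hOmega hA0 Nw Nw.
have NdC := NC dC; have Ay := inner0_in hA hOmega hA0 NdC NdC.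
have sym z : N z -> symmetric_op (ip z z) by apply: (inner0_sym hA hOmega hA0).
have sq z v : N z -> gns_subspace Omega A0 v -> rdot (ip z z v) v = rdot (z v) (z v).
  by move=> Nz Hv; rewrite -{1}(ebar_id vA0 Hv) (inner0_dot hA hOmega hA0).
have bx'K v : rnorm (x' v) <= K * rnorm v.
  by apply: le_trans (norm0_bound _ (NB Bx')) _; rewrite ler_wpM2r ?rnorm_ge0.
have bdK v : rnorm ((x' \- x) v) <= 2 * K * rnorm v.
  apply: le_trans (rnormD _ _) _; rewrite rnormN.
  have := bx'K v; have := le_trans (norm0_bound v Nx) (ler_wpM2r (rnorm_ge0 v) xK); lra.
(* <w|w> <= 2 <w1|w1> + 2 <w2|w2>, as the difference is <w1 - w2|w1 - w2>. *)
have splitw : complex.Re (phi (ip w w)) <=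
    2 * complex.Re (phi (ip w1 w1)) + 2 * complex.Re (phi (ip w2 w2)).
  pose b2 v := (1 : R)%:C *: ip w2 w2 v + ip w2 w2 v.
  have Ab2 : A0 b2 by apply: vn_lin.
  pose b1 v := (2 : R)%:C *: ip w1 w1 v + b2 v.
  have Ab1 : A0 b1 by apply: vn_lin.
  have <- : complex.Re (phi b1) = 2 * complex.Re (phi (ip w1 w1)) + 2 * complex.Re (phi (ip w2 w2)).
    by rewrite (normal_Re_lin hA0) // (normal_Re_lin hA0) //; ring.
  apply: (normal_mono hA0 nphi pphi) => //; first exact: sym.
    by move=> v v'; rewrite /b1 /b2 !rdotE !sym.
  apply: (transfer_mono hA hOmega hA0) => // k Hk; rewrite /b1 /b2 !rdotE !sq //.
  rewrite [w k]mul_diff // -/w1 -/w2.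
  by have := rdot_ge0 (w1 k - w2 k); rewrite !rdotE; lra.
have est1 : complex.Re (phi (ip w1 w1)) <= K ^+ 2 * complex.Re (phi (ip (y' \- y) (y' \- y))).
  set a := ip (y' \- y) (y' \- y) in Ay *.
  pose b v := (K ^+ 2 - 1)%:C *: a v + a v.
  have Ab : A0 b by apply: vn_lin.
  have <- : complex.Re (phi b) = K ^+ 2 * complex.Re (phi a).
    by rewrite (normal_Re_lin hA0) //; ring.
  apply: (normal_mono hA0 nphi pphi) => //; first exact: sym.
    by move=> v v'; rewrite /b /a !rdotE !sym.
  apply: (transfer_mono hA hOmega hA0) => // k Hk; rewrite /b /a !rdotE !sq //.
  have : rnorm (w1 k) <= K * rnorm ((y' \- y) k).
    exact: (mul_norm_le hA hOmega hA0 hB hC hBC).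
  rewrite -(@ler_pXn2r _ 2) ?nnegrE ?mulr_ge0 ?rnorm_ge0 // exprMn !rnormE2 /=; lra.
have est2 : complex.Re (phi (ip w2 w2)) <=
    \sum_(k <- s) vector_seminorm (y k) (x' \- x) ^+ 2 + M * t.
  apply: le_trans (sphi (ip w2 w2) M A2 M0 _ _ (sym _ N2)) _.
  - by move=> v; apply: (inner0_ge0 hA hOmega hA0).
  - apply: (inner0_le hA hOmega hA0) => // v.
    apply: le_trans (_ : 2 * K * rnorm (y v) <= _).
      by apply: (mul_norm_le hA hOmega hA0 hB hC hBC) => //; rewrite mulr_ge0.
    by rewrite -[leRHS]mulrA; apply: ler_wpM2l; [rewrite mulr_ge0|apply: norm0_bound].
  rewrite lerD2r big_seq_cond [leRHS]big_seq_cond; apply: ler_sum => k; rewrite andbT => ks.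
  rewrite (sq _ _ N2 (sH0 _ ks)) /w2 (mul_dot hA hOmega hA0 hB hC hBC) //.
  by rewrite /vector_seminorm sqr_sqrtr // (inner0_ge0 hA hOmega hA0) //; apply: NB.
have py : complex.Re (phi (ip (y' \- y) (y' \- y))) <= delta ^+ 2.
  have pos : 0 <= complex.Re (phi (ip (y' \- y) (y' \- y))).
    have := pphi _ Ay (inner0_positive hA hOmega hA0 NdC).
    by rewrite lecE => /andP[].
  have := hy p (or_introl erefl); rewrite /p => /ltW h.
  by rewrite -[leLHS]sqr_sqrtr // ler_pXn2r ?nnegrE ?sqrtr_ge0 // ltW.
have qx : \sum_(k <- s) vector_seminorm (y k) (x' \- x) ^+ 2 <= (size s)%:R * delta ^+ 2.
  apply: le_trans (_ : \sum_(k <- s) delta ^+ 2 <= _).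
    rewrite big_seq_cond [leRHS]big_seq_cond; apply: ler_sum => k; rewrite andbT => ks.
    have := hx (vector_seminorm (y k)) (or_intror (ex_intro2 _ _ k ks erefl)) => /ltW h.
    by rewrite ler_pXn2r ?nnegrE ?sqrtr_ge0 // ltW.
  by rewrite big_const_seq count_predT iter_addr_0 -[leLHS]mulr_natl.
have arith (W P1 P2 Q n K2 Py D T E : R) : W <= 2 * P1 + 2 * P2 -> P1 <= K2 * Py ->
    K2 * Py <= K2 * D -> P2 <= Q + T -> Q <= n * D -> 8 * T <= E -> 0 < E ->
    (2 * K2 + 2 * n + 1) * D <= E / 4 -> 0 <= D -> W < E by lra.
have fin : complex.Re (phi (ip w w)) < e ^+ 2.
  apply: (arith _ _ _ _ _ _ _ _ _ _ splitw est1 _ est2 qx _ e2 Sd (sqr_ge0 _)).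
    by apply: ler_wpM2l => //; apply: sqr_ge0.
  by rewrite mulrA.
rewrite -[w in ip w w]/w -(ger0_norm (ltW epos)) -sqrtr_sqr ltr_sqrt //.
Qed.
End Continuity.

Theorem proposition5p3p1 (R : realType) (H : hilbertType R)
    (A A0 B C : set (H -> H)) (psi : (H -> H) -> R[i]) (Omega : H)
    (E0 EB EC : (H -> H) -> (H -> H))
    (hA : probability_space A psi) (hOmega : is_gns A psi Omega)
    (hA0 : expected_subalgebra A psi A0 E0)
    (hB : expected_subalgebra A psi B EB)
    (hC : expected_subalgebra A psi C EC)
    (hBC : independent A0 E0 B C) :
  let e0 := ebar Omega A0 in
  let E_ := hmod A0 Omega in
  let ip := inner0 A0 Omega in
  let mul := mprod A A0 Omega B in
  (forall x y, E_ B x -> E_ C y ->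
    [/\ exists u, approximates A0 Omega B u x,
        forall u, approximates A0 Omega B u x ->
          seq_limit (stop A0 Omega) (fun n => u n \o y) (mul x y) &
        E_ (vn_join B C) (mul x y)]) /\
  (forall b y, B b -> E_ C y -> mul (b \o e0) y = b \o y) /\
  jointly_continuous (norm0_top A0 Omega) (E_ B) (E_ C) mul /\
  (forall K : R,
    jointly_continuous (sigma_stop A0 Omega)
      [set x | E_ B x /\ norm0 A0 Omega x <= K] (E_ C) mul) /\
  (forall x1 x2 y1 y2, E_ B x1 -> E_ B x2 -> E_ C y1 -> E_ C y2 ->
    ip (mul x1 y1) (mul x2 y2) = ip y1 (ip x1 x2 \o y2)) /\
  (forall x y, E_ B x -> E_ C y ->
    ext_ce Omega B (mul x y) = mul x (ext_ce Omega A0 y) /\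
    ext_ce Omega C (mul x y) = mul (ext_ce Omega A0 x) y).
Proof.
move=> e0 E_ ip mul; have BA := sub_incl hB.
split.
  move=> x y Bx Cy; split.
  - have [u cu] := approximant_exists hA hOmega hA0 hB hBC Bx; exists u.
    exact/(approximatesP hA hOmega hA0 _ BA Bx).
  - move=> u /(approximatesP hA hOmega hA0 _ BA Bx) cu.
    apply/(stop_limitP hA hOmega hA0) => [n||v].
    + by apply: (lmul_N hA hB hC) => //; case: cu.
    + exact: (mul_N hA hOmega hA0 hB hC hBC).
    exact: (mul_lim hA hOmega hA0 hB hC hBC).
  by case: (mprod_spec hA hOmega hA0 hB hC hBC Bx Cy).
split; first by move=> b y Bb Cy; apply: (mul_embed hA hOmega hA0 hB hC hBC).
split; first exact: (mul_norm0_continuous hA hOmega hA0 hB hC hBC).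
split; first by move=> K; apply: (mul_sigma_stop_continuous hA hOmega hA0 hB hC hBC).
split; first by move=> x1 x2 y1 y2; apply: (mul_inner hA hOmega hA0 hB hC hBC).
move=> x y Bx Cy; split.
  exact: (mul_expect_left hA hOmega hA0 hB hC hBC).
exact: (mul_expect_right hA hOmega hA0 hB hC hBC).
Qed.
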